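(* Let $n\ge1$. Let $C_0=C_0(L_0)\subset\mathbb R^{N_0+1}$ be a nonzero mass-minimizing cone over a normal current $L_0$ in $\mathbb S^{N_0}$, and for $i=1,\dots,n$ let $C_i\subset\mathbb R^{N_i+1}$ be an (oriented) Lawlor cone. Suppose that the link of $C_1$ is a minimal product of (at least two) positive dimensional minimal submanifolds of unit spheres. Then the mass-minimizing Cartesian cone $C_0\times C_1\times\cdots\times C_n\subset\mathbb R^{N_0+1}\oplus\mathbb R^{N_1+1}\oplus\cdots\oplus\mathbb R^{N_n+1}$ cannot be calibrated by any globally defined continuous calibration, i.e. by any continuous calibration form on the whole space $\mathbb R^{N_0+1}\oplus\cdots\oplus\mathbb R^{N_n+1}$.
   Context: $\mathbb S^N$ is the unit sphere in $\mathbb R^{N+1}$. Currents are de Rham currents. The comass of an $m$-form $\psi$ at $x$ is $\|\psi\|_x^*=\max\{\psi_x(\xi):\xi\text{ a unit simple }m\text{-vector}\}$; the mass of a compactly supported $m$-current is $\mathbf M(T)=\sup\{T(\psi):\sup_x\|\psi\|_x^*\le1\}$; a normal current has $\mathbf M(T)<\infty$ and $\mathbf M(dT)<\infty$. A current of locally finite mass is written $T=\overrightarrow T\cdot\|T\|$ with $\|T\|$ a Radon measure and $\overrightarrow T_x$ of unit mass norm (dual to comass) $\|T\|$-a.e. Links of cones are compactly supported currents without boundary. The cone over a current $L$ in the sphere is the push-forward of $[0,\infty)\times L$ under $(t,x)\mapsto tx$; for a submanifold, $C(L)=\{tx:x\in L,\ t\ge0\}$. A cone is mass-minimizing if its truncation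 to the unit ball has least mass among all compactly supported currents with the same boundary. Continuous calibration: a continuous $m$-form $\phi$ on Euclidean space, closed (in the sense of distributions), with $\sup_x\|\phi\|_x^*=1$. It calibrates $T$ if $\phi_x(\overrightarrow T_x)=1$ for $\|T\|$-a.e. $x$. Minimal product: for closed embedded minimal submanifolds $M_j\subset\mathbb S^{n_j}$ of dimension $k_j>0$, $j=1,\dots,l$, with $k=\sum k_j$, it is $\{(\sqrt{k_1/k}\,x_1,\dots,\sqrt{k_l/k}\,x_l): x_j\in M_j\}\subset\mathbb S^{n_1+\cdots+n_l+l-1}$. Lawlor cone: an orientable (oriented) regular minimal cone satisfying Lawlor's curvature criterion. A regular minimal cone is $C=C(B)\subset\mathbb R^{N+1}$ with $B\subset\mathbb S^N$ a closed embedded minimal submanifold that is not totally geodesic. Let $k=\dim C$, and for $p\in B$ and a unit vector $v$ normal to $C$ at $p$ let $A_v$ be the shape operator of $B$ at $p$ in direction $v$. The vanishing angle $\theta_0(p)\in(0,\pi/2)$ is, if it exists, the smallest $\theta_0$ for which there is a solution $r:[0,\theta_0)\to[1,\infty)$ of $$\frac{dr}{d\theta}=r\sqrt{r^{2k}\cos^{2k-2}\theta\ \inf_{v}\big(\det(I-\tan\theta\,A_v)\big)^2-1},\qquad r(0)=1,$$ with $r(\theta)\to\infty$ as $\theta\to\theta_0$. The criterion is that $\theta_0(p)$ exists for every $p\in B$ and that the open normal wedges $W_p=\{s(\cos\theta\,p+\sin\theta\,v): s>0,\ 0\le\theta<\theta_0(p),\ v\text{ a unit normal to }C\text{ at }p\}$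 are pairwise disjoint for distinct $p\in B$. Cones satisfying it are mass-minimizing. *)

(* Defs.v *)
(* Conventions.  R^d is 'rV[R]_d with its product topology; [dotp] is the
   Euclidean inner product (the library norm on 'rV is the sup norm and is not
   used).  An m-tuple (v_0,..,v_(m-1)) of vectors is the matrix A : 'M_(m, d)
   with rows v_i, so an m-covector is an alternating multilinear function of
   the rows of A. *)
From HB Require Import structures.
From mathcomp Require Import all_boot all_order all_algebra.
From mathcomp Require Import all_classical all_reals all_analysis.

Set Implicit Arguments.
Unset Strict Implicit.
Unset Printing Implicit Defensive.

Import Order.TTheory GRing.Theory Num.Theory.
Import numFieldNormedType.Exports.

Local Open Scope classical_set_scope.
Local Open Scope ring_scope.

Definition dotp (R : realType) (d : nat) (x y : 'rV[R]_d) : R :=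
  \sum_(i < d) x 0 i * y 0 i.

Definition unit_sphere (R : realType) (d : nat) : set 'rV[R]_d :=
  [set x | dotp x x = 1].

Definition unit_ball (R : realType) (d : nat) : set 'rV[R]_d :=
  [set x | dotp x x <= 1].

(* iter_derive [:: v1; ..; vr] f = D_v1 (D_v2 (.. (D_vr f))) *)
Definition iter_derive (R : realType) (d : nat) (W : normedModType R)
    (s : seq 'rV[R]_d) (f : 'rV[R]_d -> W) : 'rV[R]_d -> W :=
  foldr (fun v g => (fun x => 'D_v g x)) f s.

(* C^oo on U (meant for U open) *)
Definition smooth_on (R : realType) (d : nat) (W : normedModType R)
    (U : set 'rV[R]_d) (f : 'rV[R]_d -> W) : Prop :=
  forall (s : seq 'rV[R]_d) (x : 'rV[R]_d), U x ->
    {for x, continuous (iter_derive s f)} /\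
    forall v, derivable (iter_derive s f) x v.

(* Lebesgue integral over R^k as an iterated integral; it is only applied to
   continuous functions with compact support, for which the order of
   integration is irrelevant. *)
Fixpoint integral_rV (R : realType) (k : nat) : ('rV[R]_k -> R) -> R :=
  match k return ('rV[R]_k -> R) -> R with
  | 0%N => fun f => f 0
  | k'.+1 => fun f =>
      Rintegral (@lebesgue_measure R) setT
        (fun t : R => integral_rV (fun y : 'rV[R]_k' =>
                        f (row_mx (t%:M : 'rV[R]_1) y)))
  end.

Definition covector (R : realType) (d m : nat) (w : 'M[R]_(m, d) -> R) : Prop :=
  (forall (A B C : 'M[R]_(m, d)) (i : 'I_m) (b c : R),
      row i A = b *: row i B + c *: row i C ->
      row' i B = row' i A -> row' i C = row' i A ->
      w A = b * w B + c * w C) /\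
  (forall (A : 'M[R]_(m, d)) (i j : 'I_m),
      i != j -> row i A = row j A -> w A = 0).

(* The norm of v_0 /\ .. /\ v_(m-1) is the square root of its Gram determinant.
   For m > 0 the absolute value is harmless, since one may change the sign of
   one v_i; for m = 0 it accounts for the unit 0-vector -1, which is not of the
   form given by a 0 x d matrix. *)
Definition comass (R : realType) (d m : nat) (w : 'M[R]_(m, d) -> R) : R :=
  sup [set `|w A| | A in [set A | \det (A *m A^T) = 1]].

Definition diff_form (R : realType) (d m : nat) : Type :=
  'rV[R]_d -> 'M[R]_(m, d) -> R.

Definition vanishes_outside (R : realType) (d m : nat) (K : set 'rV[R]_d)
    (psi : diff_form R d m) : Prop :=
  forall x, ~ K x -> forall A, psi x A = 0.

Definition test_form (R : realType) (d m : nat) (psi : diff_form R d m) :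
    Prop :=
  [/\ forall x, covector (psi x),
      forall A, smooth_on setT (fun x => psi x A : R^o) &
      exists K, compact K /\ vanishes_outside K psi].

Definition ext_derivative (R : realType) (d m : nat) (psi : diff_form R d m) :
    diff_form R d m.+1 :=
  fun x A => \sum_(i < m.+1)
    (-1) ^+ i * 'D_(row i A) (fun y => psi y (row' i A) : R^o) x.

(* The values of a current outside the test forms are irrelevant. *)
Definition functional (R : realType) (d m : nat) : Type := diff_form R d m -> R.

Definition is_current (R : realType) (d m : nat) (T : functional R d m) : Prop :=
  (forall (a : R) (psi chi : diff_form R d m), test_form psi -> test_form chi ->
     T (fun x A => a * psi x A + chi x A) = a * T psi + T chi) /\
  (forall K : set 'rV[R]_d, compact K ->
     exists (c : R) (r : nat), forall (psi : diff_form R d m) (b : R),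
       test_form psi -> vanishes_outside K psi ->
       (forall (x : 'rV[R]_d) (J : 'I_m -> 'I_d) (s : seq 'I_d),
          (size s <= r)%N ->
          `|iter_derive [seq delta_mx 0 i | i <- s]
              (fun y => psi y (rowsub J 1%:M) : R^o) x| <= b) ->
       `|T psi| <= c * b).

Definition supported_in (R : realType) (d m : nat) (T : functional R d m)
    (K : set 'rV[R]_d) : Prop :=
  forall psi, test_form psi ->
    (exists U, [/\ open U, K `<=` U & vanishes_outside (~` U) psi]) ->
    T psi = 0.

(* The boundary of a 0-dimensional current is zero. *)
Definition boundary (R : realType) (d m : nat) :
    functional R d m -> functional R d m.-1 :=
  match m return functional R d m -> functional R d m.-1 with
  | 0%N => fun _ _ => 0
  | m'.+1 => fun T psi => T (ext_derivative psi)
  end.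

Definition mass (R : realType) (d m : nat) (T : functional R d m) : \bar R :=
  ereal_sup [set (T psi)%:E | psi in
    [set psi : diff_form R d m | test_form psi /\ forall x, comass (psi x) <= 1]].

Definition normal_current (R : realType) (d m : nat) (T : functional R d m) :
    Prop :=
  [/\ is_current T, (mass T < +oo)%E & (mass (boundary T) < +oo)%E].

Definition without_boundary (R : realType) (d m : nat) (T : functional R d m) :
    Prop :=
  forall psi, test_form psi -> boundary T psi = 0.

Definition nonzero_current (R : realType) (d m : nat) (T : functional R d m) :
    Prop :=
  exists psi, test_form psi /\ T psi <> 0.

(* An m-vector is a linear form on the space of m-covectors. *)
Definition mvector (R : realType) (d m : nat)
    (xi : ('M[R]_(m, d) -> R) -> R) : Prop :=
  forall (a : R) (w z : 'M[R]_(m, d) -> R), covector w -> covector z ->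
    xi (fun A => a * w A + z A) = a * xi w + xi z.

Definition mass_norm (R : realType) (d m : nat)
    (xi : ('M[R]_(m, d) -> R) -> R) : R :=
  sup [set xi w | w in
    [set w : 'M[R]_(m, d) -> R | covector w /\ comass w <= 1]].

Notation borel_rV R d := (g_sigma_algebraType (@open 'rV[R]_d)).

(* T restricted to D, when T = xi . mu *)
Definition restriction (R : realType) (d m : nat)
    (mu : {measure set (borel_rV R d) -> \bar R})
    (xi : 'rV[R]_d -> ('M[R]_(m, d) -> R) -> R) (D : set 'rV[R]_d) :
    functional R d m :=
  fun psi => Rintegral mu D (fun x : borel_rV R d => xi x (psi x)).

(* T = xi . mu with mu = ||T|| and xi the orientation of T *)
Definition polar_decomposition (R : realType) (d m : nat)
    (T : functional R d m) (mu : {measure set (borel_rV R d) -> \bar R})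
    (xi : 'rV[R]_d -> ('M[R]_(m, d) -> R) -> R) : Prop :=
  [/\ forall K : set 'rV[R]_d, compact K -> (mu K < +oo)%E,
      forall x, mvector (xi x),
      forall w, covector w ->
        measurable_fun setT (fun x : borel_rV R d => xi x w),
      {ae mu, forall x, mass_norm (xi x) = 1} &
      forall psi, test_form psi -> T psi = restriction mu xi setT psi].

Definition cone_mass_minimizing (R : realType) (d m : nat)
    (T : functional R d m) : Prop :=
  exists (mu : {measure set (borel_rV R d) -> \bar R})
    (xi : 'rV[R]_d -> ('M[R]_(m, d) -> R) -> R),
    polar_decomposition T mu xi /\
    let T1 := restriction mu xi (@unit_ball R d) in
    forall S : functional R d m, is_current S ->
      (exists K, compact K /\ supported_in S K) ->
      (forall psi, test_form psi -> boundary S psi = boundary T1 psi) ->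
      (mass T1 <= mass S)%E.

(* Push-forward of [0, oo) x L under h(t, x) = tx: the dt-component of the
   pull-back of psi by h is, at (t, y), the m-covector
   (v_1,..,v_m) |-> psi_(ty)(y, t v_1,..,t v_m), and
   ([0, oo) x L)(dt /\ a_t) is the integral over t of L(a_t). *)
Definition cone_current (R : realType) (d m : nat) (L : functional R d m) :
    functional R d m.+1 :=
  fun psi => Rintegral (@lebesgue_measure R) `]0, +oo[%classic
    (fun t : R => L (fun (y : 'rV[R]_d) (A : 'M[R]_(m, d)) =>
                       psi (t *: y) (col_mx y (t *: A) : 'M[R]_(1 + m, d)))).

(* Characterized by (S x T)(p^* a /\ q^* b) = S(a) T(b), p and q being the two
   projections. *)
Definition product_current (R : realType) (d1 d2 m1 m2 : nat)
    (S : functional R d1 m1) (T : functional R d2 m2) :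
    functional R (d1 + d2) (m1 + m2) :=
  fun psi => S (fun x A => T (fun y B =>
    psi (row_mx x y) (block_mx A 0 0 B))).

Fixpoint sum_upto (d : nat -> nat) (n : nat) : nat :=
  match n with
  | 0%N => d 0%N
  | n'.+1 => (sum_upto d n' + d n'.+1)%N
  end.

(* T 0 x T 1 x .. x T n *)
Fixpoint iter_product (R : realType) (d m : nat -> nat)
    (T : forall i : nat, functional R (d i) (m i)) (n : nat) :
    functional R (sum_upto d n) (sum_upto m n) :=
  match n return functional R (sum_upto d n) (sum_upto m n) with
  | 0%N => T 0%N
  | n'.+1 => product_current (@iter_product R d m T n') (T n'.+1)
  end.

Arguments iter_product {R d m} T n.

(* d(phi) = 0 as a distribution: each component
   sum_i (-1)^i D_(v_i) (phi(v_0,..,v_i omitted,..,v_m)) vanishes. *)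
Definition weakly_closed (R : realType) (d m : nat) (phi : diff_form R d m) :
    Prop :=
  forall (A : 'M[R]_(m.+1, d)) (h : 'rV[R]_d -> R),
    smooth_on setT (h : 'rV[R]_d -> R^o) ->
    (exists K, compact K /\ forall x, ~ K x -> h x = 0) ->
    integral_rV (fun x => \sum_(i < m.+1)
      (-1) ^+ i * phi x (row' i A) * 'D_(row i A) (h : 'rV[R]_d -> R^o) x) = 0.

Definition continuous_calibration (R : realType) (d m : nat)
    (phi : diff_form R d m) : Prop :=
  [/\ forall x, covector (phi x),
      forall A, continuous (fun x => phi x A : R^o),
      weakly_closed phi &
      ereal_sup [set (comass (phi x))%:E | x in [set: 'rV[R]_d]] = 1%:E].

Definition calibrates (R : realType) (d m : nat) (phi : diff_form R d m)
    (T : functional R d m) : Prop :=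
  exists (mu : {measure set (borel_rV R d) -> \bar R})
    (xi : 'rV[R]_d -> ('M[R]_(m, d) -> R) -> R),
    polar_decomposition T mu xi /\ {ae mu, forall x, xi x (phi x) = 1}.

(* f : V -> B `&` U is a smooth parametrization of the k-dimensional piece
   B `&` U.  In the row-vector convention the i-th row of 'J f u is the i-th
   partial derivative of f at u. *)
Definition local_param (R : realType) (d k : nat) (B : set 'rV[R]_d)
    (V : set 'rV[R]_k) (U : set 'rV[R]_d) (f : 'rV[R]_k -> 'rV[R]_d) : Prop :=
  [/\ open V /\ open U, smooth_on V f,
      forall u, V u -> row_free ('J f u),
      f @` V = B `&` U &
      exists g : 'rV[R]_d -> 'rV[R]_k,
        {within B `&` U, continuous g} /\ forall u, V u -> g (f u) = u].

Definition embedded_submanifold (R : realType) (d k : nat)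
    (B : set 'rV[R]_d) : Prop :=
  forall p, B p -> exists (V : set 'rV[R]_k) (U : set 'rV[R]_d)
    (f : 'rV[R]_k -> 'rV[R]_d), local_param B V U f /\ U p.

(* unit vectors normal at p to the cone over the k-dimensional B *)
Definition unit_normal (R : realType) (d k : nat) (B : set 'rV[R]_d)
    (p v : 'rV[R]_d) : Prop :=
  [/\ dotp v v = 1, dotp p v = 0 &
      forall (V : set 'rV[R]_k) (U : set 'rV[R]_d) (f : 'rV[R]_k -> 'rV[R]_d)
        (u : 'rV[R]_k),
        local_param B V U f -> V u -> f u = p ->
        forall i, dotp (row i ('J f u)) v = 0].

(* Matrix, in the basis of the partial derivatives of f, of the shape operator
   in the normal direction v: second times inverse of first fundamental form. *)
Definition shape_mx (R : realType) (d k : nat) (f : 'rV[R]_k -> 'rV[R]_d)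
    (u : 'rV[R]_k) (v : 'rV[R]_d) : 'M[R]_k :=
  (\matrix_(i, j) dotp (iter_derive [:: delta_mx 0 i; delta_mx 0 j] f u) v)
  *m invmx ('J f u *m ('J f u)^T).

(* S is the matrix, in some coordinates, of the shape operator A_v of B at p. *)
Definition is_shape_operator (R : realType) (d k : nat) (B : set 'rV[R]_d)
    (p v : 'rV[R]_d) (S : 'M[R]_k) : Prop :=
  exists (V : set 'rV[R]_k) (U : set 'rV[R]_d) (f : 'rV[R]_k -> 'rV[R]_d)
    (u : 'rV[R]_k),
    [/\ local_param B V U f, V u, f u = p & S = shape_mx f u v].

Definition closed_minimal_submanifold (R : realType) (d k : nat)
    (B : set 'rV[R]_d) : Prop :=
  [/\ B `<=` @unit_sphere R d, closed B, embedded_submanifold k B &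
      forall (p v : 'rV[R]_d) (S : 'M[R]_k), B p -> unit_normal k B p v ->
        is_shape_operator B p v S -> \tr S = 0].

Definition totally_geodesic (R : realType) (d k : nat) (B : set 'rV[R]_d) :
    Prop :=
  forall (p v : 'rV[R]_d) (S : 'M[R]_k), B p -> unit_normal k B p v ->
    is_shape_operator B p v S -> S = 0.

(* r^(2K) cos^(2K-2) inf_v det(I - tan A_v)^2 - 1 with K = k + 1 = dim C(B) *)
Definition lawlor_radicand (R : realType) (d k : nat) (B : set 'rV[R]_d)
    (p : 'rV[R]_d) (r theta : R) : R :=
  r ^+ (2 * k.+1) * cos theta ^+ (2 * k.+1 - 2) *
  inf [set x | exists (v : 'rV[R]_d) (S : 'M[R]_k),
         [/\ unit_normal k B p v, is_shape_operator B p v S &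
             x = (\det (1%:M - tan theta *: S)) ^+ 2]] - 1.

(* At the end point 0 the derivative is the one-sided one. *)
Definition lawlor_solution (R : realType) (d k : nat) (B : set 'rV[R]_d)
    (p : 'rV[R]_d) (theta0 : R) (r : R -> R) : Prop :=
  [/\ r 0 = 1,
      forall t, 0 <= t < theta0 ->
        1 <= r t /\ 0 <= lawlor_radicand k B p (r t) t,
      forall t, 0 <= t < theta0 ->
        (r s - r t) / (s - t)
          @[s --> within [set s | 0 <= s < theta0 /\ s != t] (nbhs t)]
          --> r t * Num.sqrt (lawlor_radicand k B p (r t) t) &
      r t @[t --> theta0^'-] --> +oo].

Definition is_vanishing_angle (R : realType) (d k : nat) (B : set 'rV[R]_d)
    (p : 'rV[R]_d) (theta0 : R) : Prop :=
  let admissible t :=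
    0 < t < pi / 2 /\ exists r, lawlor_solution k B p t r in
  admissible theta0 /\ forall t, admissible t -> theta0 <= t.

Definition normal_wedge (R : realType) (d k : nat) (B : set 'rV[R]_d)
    (p : 'rV[R]_d) (theta0 : R) : set 'rV[R]_d :=
  [set x | exists (s theta : R) (v : 'rV[R]_d),
     [/\ 0 < s, 0 <= theta < theta0, unit_normal k B p v &
         x = s *: (cos theta *: p + sin theta *: v)]].

Definition lawlor_criterion (R : realType) (d k : nat) (B : set 'rV[R]_d) :
    Prop :=
  exists theta0 : 'rV[R]_d -> R,
    (forall p, B p -> is_vanishing_angle k B p (theta0 p)) /\
    (forall p q, B p -> B q -> p <> q ->
       normal_wedge k B p (theta0 p) `&` normal_wedge k B q (theta0 q) = set0).

(* An orientation is given by a continuous k-form along B that does not vanish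
   on the tangent spaces. *)
Definition orientation (R : realType) (d k : nat) (B : set 'rV[R]_d)
    (omega : diff_form R d k) : Prop :=
  [/\ forall p, B p -> covector (omega p),
      forall A, {within B, continuous (fun p => omega p A : R^o)} &
      forall (V : set 'rV[R]_k) (U : set 'rV[R]_d) (f : 'rV[R]_k -> 'rV[R]_d)
        (u : 'rV[R]_k),
        local_param B V U f -> V u -> omega (f u) ('J f u) <> 0].

(* The current of integration over B oriented by omega; by a partition of
   unity it is determined by its values on forms supported in one chart. *)
Definition integration_current (R : realType) (d k : nat) (B : set 'rV[R]_d)
    (omega : diff_form R d k) (L : functional R d k) : Prop :=
  is_current L /\
  forall (V : set 'rV[R]_k) (U : set 'rV[R]_d) (f : 'rV[R]_k -> 'rV[R]_d)
    (psi : diff_form R d k),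
    local_param B V U f -> test_form psi ->
    (exists K, [/\ compact K, K `<=` U & vanishes_outside K psi]) ->
    L psi = integral_rV ((fun u => Num.sg (omega (f u) ('J f u)) *
                                   psi (f u) ('J f u)) \_ V).

(* The cone over B, with link L as a current, is an oriented Lawlor cone. *)
Definition oriented_lawlor_cone (R : realType) (d k : nat) (B : set 'rV[R]_d)
    (L : functional R d k) : Prop :=
  [/\ closed_minimal_submanifold k B, ~ totally_geodesic k B,
      lawlor_criterion k B &
      exists omega, orientation B omega /\ integration_current B omega L].

(* B is a minimal product of l >= 2 factors M_j of dimensions kk j > 0 in the
   unit spheres of R^(nn j + 1). *)
Definition is_minimal_product (R : realType) (d : nat) (B : set 'rV[R]_d) :
    Prop :=
  exists (l : nat) (nn kk : 'I_l -> nat)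
    (M : forall j : 'I_l, set 'rV[R]_(nn j).+1)
    (e : (\sum_j (nn j).+1)%N = d),
    [/\ (2 <= l)%N, forall j, (0 < kk j)%N,
        forall j, closed_minimal_submanifold (kk j) (M j) &
        B = [set x | exists y : forall j : 'I_l, 'rV[R]_(nn j).+1,
               (forall j, M j (y j)) /\
               x = castmx (erefl, e) (\mxrow_j
                 (Num.sqrt ((kk j)%:R / (\sum_i kk i)%N%:R) *: y j))]].

(* Main.v *)
(* Let phi be a continuous calibration of T = C_0 x .. x C_n.  Cones are
   invariant under dilations, so that phi may be pulled towards the origin, where
   it becomes the constant form phi(0): localizing T at tangent planes tau_i of
   C_i (i >= 1) and dilating shows that phi(0) maximizes the pairing with the
   localization of T among all constant forms of comass at most 1.  Comparing
   phi(0) with its pull-backs by orthogonal maps H of the factor of C_1, the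
   contraction w of phi(0) with all the factors but C_1 satisfies
   s w(tau H) <= s w(tau) and w(tau) <> 0 for every tangent plane tau of C_1,
   s <> 0 being its orientation.
   Letting H range over reflections yields the first cousin principle: w vanishes
   as soon as one vector of a basis of tau is replaced by a normal vector.
   If the link of C_1 is a minimal product with a factor M, the vector obtained
   from the point p = (q, lam x), x in M, by rescaling its two components so as
   to be orthogonal to p is normal to C_1.  Hence a constant k_0-form Omega,
   obtained from w by fixing the other factors and nonzero on the tangent spaces
   of M, k_0 = dim M, has contraction with the position field x that vanishes
   along M; its exterior derivative is k_0 Omega, a contradiction. *)
Require Import Defs.
From HB Require Import structures.
From mathcomp Require Import all_boot all_order all_algebra all_fingroup.
From mathcomp Require Import all_classical all_reals all_analysis.
From mathcomp Require Import measurable_realfun.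
From mathcomp Require Import ring lra.

Set Implicit Arguments.
Unset Strict Implicit.
Unset Printing Implicit Defensive.

Import Order.TTheory GRing.Theory Num.Theory.
Import numFieldNormedType.Exports.

Local Open Scope classical_set_scope.
Local Open Scope ring_scope.

(** * Covectors *)

(** Currents have no values at points, and the orientation of [C_0] is an arbitrary m-vector. The
    comparison of constant forms therefore runs through [blowup]: evaluations of T weighted by
    nonnegative test functions, whose limits multiply under products. For [C_0] one fixed weight is
    enough, chosen so that some minor is not annihilated. For a Lawlor cone the weights concentrate
    at a point of a chart. Maximality gives only inequalities; they become equations because the
    reflections form a family affine in an unrestricted real parameter. The end of the argument
    rests on a 2 x 2 determinant. The position p and the normal vector y span the same plane as the
    two components q and x of p. The cousin equation with y in a tangent row therefore says that w
    vanishes with q in the position row and x in that tangent row. Along M the component q does not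
    move, so freezing it leaves a form Omega with constant coefficients. Once w vanishes with q in
    the position row, the cousin equation for the position row itself kills x there too, and w
    vanishes on the whole tangent plane. *)

Definition upd (R : realType) (m d : nat) (A : 'M[R]_(m, d)) (i : 'I_m)
    (v : 'rV[R]_d) : 'M[R]_(m, d) :=
  \matrix_(l, j) (if l == i then v 0 j else A l j).

(** [J] ranges over all maps, not only the increasing ones. No ordered index sets are needed, but
    each choice of m columns is counted m! times, whence the factor in [covector_minors]. *)
Definition minor (R : realType) (m d : nat) (J : {ffun 'I_m -> 'I_d})
    (A : 'M[R]_(m, d)) : R :=
  \det (colsub J A).

Section Covectors.
Context {R : realType}.

Lemma row_upd (m d : nat) (A : 'M[R]_(m, d)) i v : row i (upd A i v) = v.
Proof. by apply/rowP => j; rewrite !mxE eqxx. Qed.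

Lemma row_upd_neq (m d : nat) (A : 'M[R]_(m, d)) i l v :
  l != i -> row l (upd A i v) = row l A.
Proof. by move=> /negbTE li; apply/rowP => j; rewrite !mxE li. Qed.

Lemma row'_upd (m d : nat) (A : 'M[R]_(m, d)) i v :
  row' i (upd A i v) = row' i A.
Proof. by apply/matrixP => l j; rewrite !mxE eq_sym (negbTE (neq_lift _ _)). Qed.

Lemma upd_upd (m d : nat) (A : 'M[R]_(m, d)) i u v :
  upd (upd A i u) i v = upd A i v.
Proof. by apply/matrixP => l j; rewrite !mxE; case: eqP. Qed.

Lemma upd_updC (m d : nat) (A : 'M[R]_(m, d)) i l u v : i != l ->
  upd (upd A i u) l v = upd (upd A l v) i u.
Proof.
move=> /negbTE il; apply/matrixP => a j; rewrite !mxE.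
by case: (eqVneq a l) => // ->; rewrite eq_sym il.
Qed.

Lemma upd_id (m d : nat) (A : 'M[R]_(m, d)) i : upd A i (row i A) = A.
Proof. by apply/matrixP => l j; rewrite !mxE; case: eqP => // ->. Qed.

Lemma upd_mul (m n d : nat) (A : 'M[R]_(m, n)) (M : 'M[R]_(n, d)) i v :
  upd A i v *m M = upd (A *m M) i (v *m M).
Proof.
apply/matrixP => l j; rewrite !mxE; case: eqVneq => [->|li].
  by apply: eq_bigr => a _; rewrite mxE eqxx.
by apply: eq_bigr => a _; rewrite mxE (negbTE li).
Qed.

Section OneCovector.
Variables (m d : nat) (w : 'M[R]_(m, d) -> R).
Hypothesis cw : covector w.

Lemma covector_updP A i (b c : R) u v :
  w (upd A i (b *: u + c *: v)) = b * w (upd A i u) + c * w (upd A i v).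
Proof. by apply: (cw.1 _ _ _ i); rewrite ?row_upd ?row'_upd. Qed.

Lemma covector_updD A i u v : w (upd A i (u + v)) = w (upd A i u) + w (upd A i v).
Proof.
by rewrite -[u]scale1r -[v]scale1r covector_updP !scale1r !mul1r.
Qed.

Lemma covector_updZ A i b u : w (upd A i (b *: u)) = b * w (upd A i u).
Proof.
by rewrite -[b *: u]addr0 -(scale0r u) covector_updP mul0r addr0.
Qed.

Lemma covector_upd0 A i : w (upd A i 0) = 0.
Proof. by rewrite -(scale0r 0) covector_updZ mul0r. Qed.

Lemma covector_upd_sum A i (I : finType) (c : I -> R) (u : I -> 'rV_d) :
  w (upd A i (\sum_j c j *: u j)) = \sum_j c j * w (upd A i (u j)).
Proof.
elim/big_ind2: _ => [|x y x' y' <- <-|j _]; first exact: covector_upd0.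
  exact: covector_updD.
exact: covector_updZ.
Qed.

Lemma covector_alt A i j : i != j -> row i A = row j A -> w A = 0.
Proof. exact: cw.2. Qed.

Lemma covector_swap A i j u v : i != j ->
  w (upd (upd A i u) j v) = - w (upd (upd A i v) j u).
Proof.
move=> ij; have alt0 x : w (upd (upd A i x) j x) = 0.
  by apply: (covector_alt ij); rewrite row_upd row_upd_neq// row_upd.
have := alt0 (u + v); rewrite covector_updD.
rewrite 2!(upd_updC _ _ _ ij) !covector_updD -!(upd_updC _ _ _ ij) !alt0.
by rewrite add0r addr0 addrC => /eqP; rewrite addr_eq0 => /eqP ->.
Qed.

Lemma covector_row_perm (s : 'S_m) A : w (row_perm s A) = (-1) ^+ s * w A.
Proof.
have [ts -> dts] := prod_tpermP s.
elim: ts dts A => [_|t ts IH] /= => [|/andP[dt dts]] A.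
  by rewrite big_nil row_perm1 odd_perm1 mul1r.
rewrite big_cons row_permM odd_permM odd_tperm dt /=.
set B := row_perm _ A; have -> : row_perm (tperm t.1 t.2) B
    = upd (upd B t.1 (row t.2 B)) t.2 (row t.1 B).
  apply/matrixP => a b; rewrite !mxE.
  case: tpermP => [->|->|/eqP a1 /eqP a2].
  - by rewrite (negbTE dt) eqxx.
  - by rewrite eqxx.
  - by rewrite (negbTE a1) (negbTE a2).
by rewrite covector_swap// !upd_id IH// signrN mulNr.
Qed.

(** Multilinear expansion, one row at a time: the auxiliary statement for k assumes that all rows
    from k on are basis vectors, and at k = m this assumption is void. *)
Lemma covector_mul (n : nat) (A : 'M[R]_(m, n)) (M : 'M[R]_(n, d)) :
  w (A *m M) = \sum_(J : {ffun 'I_m -> 'I_n})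
                 (\prod_i A i (J i)) * w (rowsub J M).
Proof.
suff: forall k, (k <= m)%N -> forall A : 'M[R]_(m, n),
    (forall i : 'I_m, (k <= i)%N -> exists j, row i A = delta_mx 0 j) ->
    w (A *m M) = \sum_(J : {ffun 'I_m -> 'I_n})
                 (\prod_i A i (J i)) * w (rowsub J M).
  by move/(_ m (leqnn _) A); apply=> i; rewrite leqNgt ltn_ord.
clear A; elim=> [_ A HA|k IH km A HA].
  have /choice [J0 HJ0] : forall i, exists j, row i A = delta_mx 0 j.
    by move=> i; apply: HA.
  have AE i j : A i j = (j == J0 i)%:R.
    by have /rowP/(_ j) := HJ0 i; rewrite !mxE eqxx.
  rewrite (bigD1 [ffun i => J0 i]) //= [X in _ + X]big1 ?addr0 => [|J JJ0].
    rewrite big1 ?mul1r => [|i _]; last by rewrite AE ffunE eqxx.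
    congr w; apply/matrixP => i j; rewrite !mxE (bigD1 (J0 i)) //= AE eqxx mul1r.
    by rewrite big1 ?addr0 ?ffunE// => l /negbTE lJ; rewrite AE lJ mul0r.
  have [i Ji] : exists i, J i != J0 i.
    apply/existsP; apply: contraNT JJ0 => /existsPn H.
    by apply/eqP/ffunP => i; rewrite ffunE; apply/eqP; have := H i; rewrite negbK.
  by rewrite (bigD1 i)//= AE (negbTE Ji) !mul0r.
pose k0 := Ordinal km.
have -> : w (A *m M) = \sum_j A k0 j * w (upd A k0 (delta_mx 0 j) *m M).
  rewrite -{1}(upd_id A k0) upd_mul {1}(row_sum_delta (row k0 A)) mulmx_suml.
  under eq_bigr => j _ do rewrite -scalemxAl.
  by rewrite covector_upd_sum; apply: eq_bigr => j _; rewrite upd_mul mxE.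
under eq_bigr => j _.
  rewrite (IH (ltnW km)); last first.
    move=> i ki; have [->|ik] := eqVneq i k0; first by exists j; rewrite row_upd.
    rewrite row_upd_neq//; apply: HA; rewrite ltn_neqAle ki andbT.
    by apply: contraNneq ik => kE; apply/eqP/val_inj.
  over.
under eq_bigr => j _ do rewrite mulr_sumr.
rewrite exchange_big /=; apply: eq_bigr => J _.
under eq_bigr => j _ do rewrite mulrA.
rewrite -mulr_suml; congr (_ * _).
rewrite [RHS](bigD1 k0)//= [LHS](bigD1 (J k0))//= [X in _ + X]big1 ?addr0.
  rewrite (bigD1 k0)//= !mxE !eqxx /= mul1r; congr (_ * _).
  by apply: eq_bigr => i /negbTE ik; rewrite mxE ik.
move=> j /negbTE jJ; rewrite (bigD1 k0)//= !mxE !eqxx /=.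
by rewrite eq_sym jJ mul0r mulr0.
Qed.

Lemma covector_expand A :
  w A = \sum_(J : {ffun 'I_m -> 'I_d}) (\prod_i A i (J i)) * w (rowsub J 1%:M).
Proof. by rewrite -{1}(mulmx1 A) covector_mul. Qed.

Lemma covector_det (M : 'M[R]_m) A : w (M *m A) = \det M * w A.
Proof.
rewrite covector_mul /determinant mulr_suml.
rewrite (bigID (fun J : {ffun 'I_m -> 'I_m} => injectiveb J)) /= addrC.
rewrite big1 ?add0r => [|J]; last first.
  case/injectivePn => i [j ij Jij].
  rewrite [w _](covector_alt ij) ?mulr0//.
  by apply/rowP => a; rewrite !mxE Jij.
rewrite (reindex (fun s : 'S_m => val s)) /=; last first.
  have [->|m0] := posnP m; last first.
    exists (fun J => insubd (1%g : 'S_m) J) => [s _|J HJ]; last first.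
      by rewrite insubdK.
    by apply: val_inj; rewrite insubdK// -[_ \in _]/(injectiveb _) (valP s).
  exists (fun=> 1%g) => [s _|J _].
    by apply/permP => -[].
  by apply/ffunP => -[].
apply: eq_big => [s|s _]; first exact: (valP s).
rewrite -mulrA mulrCA -covector_row_perm; congr (_ * _).
  by apply: eq_bigr => i _; rewrite pvalE.
by congr w; apply/matrixP => i j; rewrite !mxE pvalE.
Qed.

(** Every permutation in the Leibniz formulas of the minors contributes [w A]: after reindexing [J]
    by it, its sign cancels against the one of [covector_row_perm]. *)
Lemma covector_minors A : (m`!)%:R * w A =
  \sum_(J : {ffun 'I_m -> 'I_d}) w (rowsub J 1%:M) * minor J A.
Proof.
transitivity (\sum_(s : 'S_m) w A).
  by rewrite sumr_const card_Sn mulr_natl.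
rewrite /minor /determinant; under [RHS]eq_bigr => J _ do rewrite mulr_sumr.
rewrite exchange_big /=; apply: eq_bigr => s _.
rewrite [LHS]covector_expand.
rewrite [RHS](reindex (fun J : {ffun 'I_m -> 'I_d} => [ffun i => J ((s^-1)%g i)])) /=;
  last first.
  exists (fun J : {ffun 'I_m -> 'I_d} => [ffun i => J (s i)]) => J _;
    by apply/ffunP => i; rewrite !ffunE ?permK ?permKV.
apply: eq_bigr => J _.
have -> : rowsub [ffun i => J ((s^-1)%g i)] (1%:M : 'M[R]_d)
    = row_perm (s^-1)%g (rowsub J 1%:M).
  by apply/matrixP => i j; rewrite !mxE ffunE.
rewrite covector_row_perm odd_permV mulrACA -signr_addb addbb mul1r mulrC.
congr (_ * _).
by apply: eq_bigr => i _; rewrite mxE ffunE permK.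
Qed.

End OneCovector.

Lemma minor_covector (m d : nat) (J : {ffun 'I_m -> 'I_d}) :
  covector (@minor R m d J).
Proof.
split=> [A B C i b c HA HB HC|A i j ij HA]; rewrite /minor.
  apply: (determinant_multilinear (i0 := i)).
  - by apply/rowP => j; have /rowP/(_ (J j)) := HA; rewrite !mxE.
  - by apply/matrixP => l j; have /matrixP/(_ l (J j)) := HB; rewrite !mxE.
  - by apply/matrixP => l j; have /matrixP/(_ l (J j)) := HC; rewrite !mxE.
apply: (determinant_alternate ij) => l.
by have /rowP/(_ (J l)) := HA; rewrite !mxE.
Qed.

Lemma covector_lin (m d : nat) (a b : R) (w z : 'M[R]_(m, d) -> R) :
  covector w -> covector z -> covector (fun A => a * w A + b * z A).
Proof.
move=> cw cz; split=> [A B C i s t HA HB HC|A i j ij HA].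
  by rewrite (cw.1 _ _ _ _ _ _ HA)// (cz.1 _ _ _ _ _ _ HA)//; ring.
by rewrite (cw.2 _ _ _ ij HA) (cz.2 _ _ _ ij HA) !mulr0 addr0.
Qed.

Lemma covectorZ (m d : nat) (a : R) (w : 'M[R]_(m, d) -> R) :
  covector w -> covector (fun A => a * w A).
Proof.
move=> cw; have := covector_lin a 0 cw cw.
by congr covector; apply/funext => A; rewrite mul0r addr0.
Qed.

Lemma covector0 (m d : nat) : covector (fun _ : 'M[R]_(m, d) => 0 : R).
Proof. by split=> // *; rewrite !mulr0 addr0. Qed.

Lemma covector_mulr (m d d' : nat) (M : 'M[R]_(d, d')) (w : 'M[R]_(m, d') -> R) :
  covector w -> covector (fun A => w (A *m M)).
Proof.
move=> cw; split=> [A B C i s t HA HB HC|A i j ij HA].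
  apply: (cw.1 _ _ _ i).
  - by rewrite !row_mul HA mulmxDl -!scalemxAl.
  - by apply/matrixP => l j; rewrite !mxE; apply: eq_bigr => a _;
      have /matrixP/(_ l a) := HB; rewrite !mxE => ->.
  - by apply/matrixP => l j; rewrite !mxE; apply: eq_bigr => a _;
      have /matrixP/(_ l a) := HC; rewrite !mxE => ->.
by apply: (cw.2 _ _ _ ij); rewrite !row_mul HA.
Qed.

Lemma covector_intro (m d : nat) (w : 'M[R]_(m, d) -> R) :
  (forall A i (b c : R) u v,
     w (upd A i (b *: u + c *: v)) = b * w (upd A i u) + c * w (upd A i v)) ->
  (forall A i j, i != j -> row i A = row j A -> w A = 0) -> covector w.
Proof.
move=> wD w0; split=> // A B C i b c HA HB HC.
have updE D : row' i D = row' i A -> upd A i (row i D) = D.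
  move=> HD; apply/matrixP => l j; rewrite !mxE; case: eqVneq => [->//|li].
  have [l' ->|lE] := @unliftP _ i l; last by rewrite lE eqxx in li.
  by have /matrixP/(_ l' j) := HD; rewrite !mxE.
by rewrite -{1}(upd_id A i) HA wD !updE.
Qed.

End Covectors.

(** * Limits and smooth functions *)

Section MatrixLimits.
Context {R : realType}.

Lemma mx_cvgP (T : Type) (F : set_system T) {FF : Filter F} (m n : nat)
    (f : T -> 'M[R]_(m, n)) (l : 'M[R]_(m, n)) :
  (f @ F --> l) <-> forall i j, (fun x => f x i j) @ F --> l i j.
Proof.
split=> [fl i j|fl].
  exact: (cvg_comp _ _ fl (@coord_continuous _ _ _ i j l)).
apply/cvgrPdist_le => e e0; near=> x.
rewrite /Num.Def.normr/= mx_normrE (bigmax_le _ (ltW e0))//= => i _.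
rewrite !mxE; move: i; near: x; apply: filter_forall => /= i.
by have /cvgrPdist_le := fl i.1 i.2; apply.
Unshelve. all: by end_near. Qed.

(* Stated for an abstract [T]: when [T] is a matrix type, unification unfolds
   [nbhs x] and the search for its filter instance fails. *)
Lemma mx_cvg_nbhsP (T : topologicalType) (x : T) (m n : nat)
    (f : T -> 'M[R]_(m, n)) (l : 'M[R]_(m, n)) :
  (f @ x --> l) <-> forall i j, (fun y => f y i j) @ x --> l i j.
Proof. exact: mx_cvgP. Qed.

Lemma cvg_nbhs_near_eq (T : topologicalType) (x : T) (f g : T -> R) (l : R) :
  (\forall y \near x, f y = g y) -> f @ x --> l -> g @ x --> l.
Proof. by move=> fg; apply: cvg_trans; apply: near_eq_cvg. Qed.

Lemma coord_le_norm (m n : nat) (x : 'M[R]_(m, n)) i j : `|x i j| <= `|x|.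
Proof.
rewrite [leRHS]/Num.Def.normr /= mx_normrE.
exact: (le_bigmax _ (fun ij => `|x ij.1 ij.2|) (i, j)).
Qed.

Lemma norm_le_coord (m n : nat) (x : 'M[R]_(m, n)) (c : R) : 0 <= c ->
  (forall i j, `|x i j| <= c) -> `|x| <= c.
Proof.
move=> c0 H; rewrite /Num.Def.normr /= mx_normrE.
by apply: bigmax_le => // i _; apply: H.
Qed.

Lemma cvg_sum (T : Type) (F : set_system T) {FF : Filter F} (I : finType)
    (f : I -> T -> R) (l : I -> R) : (forall i, f i @ F --> l i) ->
  (fun x => \sum_i f i x) @ F --> \sum_i l i.
Proof.
move=> fl; elim: (index_enum I) => [|i s IH].
  by under eq_fun do rewrite big_nil; rewrite big_nil; apply: cvg_cst.
by under eq_fun do rewrite big_cons; rewrite big_cons; apply: cvgD.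
Qed.

Lemma cvg_prod (T : Type) (F : set_system T) {FF : Filter F} (I : finType)
    (f : I -> T -> R) (l : I -> R) : (forall i, f i @ F --> l i) ->
  (fun x => \prod_i f i x) @ F --> \prod_i l i.
Proof.
move=> fl; elim: (index_enum I) => [|i s IH].
  by under eq_fun do rewrite big_nil; rewrite big_nil; apply: cvg_cst.
by under eq_fun do rewrite big_cons; rewrite big_cons; apply: cvgM.
Qed.

Lemma cvg_mulmx (T : Type) (F : set_system T) {FF : Filter F} (m n p : nat)
    (f : T -> 'M[R]_(m, n)) (g : T -> 'M[R]_(n, p)) (a : 'M[R]_(m, n))
    (b : 'M[R]_(n, p)) :
  f @ F --> a -> g @ F --> b -> (fun x => f x *m g x) @ F --> a *m b.
Proof.
move=> /mx_cvgP fa /mx_cvgP gb; apply/mx_cvgP => i j; rewrite mxE.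
under eq_fun do rewrite mxE.
by apply: cvg_sum => k; apply: cvgM.
Qed.

(** The coefficients may vary with the point. Constant ones give the continuity of a covector,
    variable ones the continuity of an orientation form along a chart. *)
Lemma cvg_expansion (m d : nat) (T : topologicalType) (x : T)
    (f : T -> 'M[R]_(m, d)) (l : 'M[R]_(m, d)) (c : {ffun 'I_m -> 'I_d} -> T -> R)
    (c0 : {ffun 'I_m -> 'I_d} -> R) :
  f @ x --> l -> (forall J, c J @ x --> c0 J) ->
  (fun y => \sum_(J : {ffun 'I_m -> 'I_d}) (\prod_i f y i (J i)) * c J y) @ x
    --> \sum_(J : {ffun 'I_m -> 'I_d}) (\prod_i l i (J i)) * c0 J.
Proof.
move=> /mx_cvg_nbhsP fl cc.
by apply: cvg_sum => J; apply: cvgM => //; apply: cvg_prod.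
Qed.

Lemma covector_cvg_nbhs (m d : nat) (w : 'M[R]_(m, d) -> R) (T : topologicalType)
    (x : T) (f : T -> 'M[R]_(m, d)) (l : 'M[R]_(m, d)) :
  covector w -> f @ x --> l -> (fun y => w (f y)) @ x --> w l.
Proof.
move=> cw fl; rewrite (covector_expand cw l).
under eq_fun do rewrite (covector_expand cw).
by apply: cvg_expansion => // J; apply: cvg_cst.
Qed.

Lemma col_mx_cvg (T : topologicalType) (x : T) (m n d : nat)
    (f : T -> 'M[R]_(m, d)) (g : T -> 'M[R]_(n, d)) (a : 'M[R]_(m, d))
    (b : 'M[R]_(n, d)) :
  f @ x --> a -> g @ x --> b -> (fun y => col_mx (f y) (g y)) @ x --> col_mx a b.
Proof.
move=> /mx_cvg_nbhsP fa /mx_cvg_nbhsP gb; apply/mx_cvg_nbhsP => i j.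
rewrite mxE; under eq_fun do rewrite mxE.
by case: (fintype.split i) => l; [exact: fa|exact: gb].
Qed.

Lemma mulmx_continuous (m n p : nat) (A : 'M[R]_(n, p)) :
  continuous (fun x : 'M[R]_(m, n) => x *m A).
Proof.
move=> x; have FF : Filter (nbhs x) by exact: nbhs_filter.
by apply: (cvg_mulmx (f := id) (g := fun=> A)); [exact: cvg_id|exact: cvg_cst].
Qed.

End MatrixLimits.

Section Lines.
Context {R : realType} {V W : normedModType R}.

(** Turns directional derivatives into derivatives in one real variable, for which the chain rule is
    available. *)
Lemma is_derive_line (f : V -> W) (x v : V) df :
  is_derive x v f df <-> is_derive (0 : R) 1 (fun h : R => f (h *: v + x)) df.
Proof.
have E : (fun h : R => h^-1 *: ((f \o shift x) (h *: v) - f x)) =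
    (fun h : R => h^-1 *: (((fun h => f (h *: v + x)) \o shift 0) (h *: 1) -
       (fun h : R => f (h *: v + x)) 0)).
  apply/funext => h /=; rewrite addr0 scale0r add0r.
  by rewrite [h *: 1]mulr1.
split=> -[H1 H2]; split.
- by rewrite /derivable -E.
- by rewrite -H2 /derive E.
- by rewrite /derivable E.
- by rewrite -H2 /derive E.
Qed.

End Lines.

Section ChainRule.
Context {R : realType}.

Lemma is_derive_chain (V : normedModType R) (f : V -> R) (g : R -> R) (x v : V)
    (df dg : R) :
  is_derive x v f df -> is_derive (f x) 1 g dg ->
  is_derive x v (fun y => g (f y)) (dg * df).
Proof.
move=> /is_derive_line Df Dg; apply/is_derive_line.
apply: (@is_derive1_comp _ g (fun h : R => f (h *: v + x))) => //.
by rewrite scale0r add0r.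
Qed.

Lemma is_derive_mulmx (d d' : nat) (W : normedModType R) (f : 'rV[R]_d' -> W)
    (A : 'M[R]_(d, d')) (x v : 'rV[R]_d) df :
  is_derive (x *m A) (v *m A) f df -> is_derive x v (fun y => f (y *m A)) df.
Proof.
move=> /is_derive_line Df; apply/is_derive_line.
by under eq_fun do rewrite mulmxDl -scalemxAl.
Qed.

Lemma is_derive_coord (m n : nat) (V : normedModType R) (f : V -> 'M[R]_(m, n))
    (x v : V) df i j :
  is_derive x v f df -> is_derive x v (fun y => f y i j : R^o) (df i j).
Proof.
move=> [Df <-]; split; first by move/derivable_mxP: Df; apply.
by rewrite (derive_mx Df) mxE.
Qed.

Lemma is_derive_mx (m n : nat) (V : normedModType R) (f : V -> 'M[R]_(m, n))
    (x v : V) (df : 'M[R]_(m, n)) :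
  (forall i j, is_derive x v (fun y => f y i j : R^o) (df i j)) ->
  is_derive x v f df.
Proof.
move=> H; have Df : derivable f x v.
  by apply/derivable_mxP => i j; case: (H i j).
split=> //; rewrite (derive_mx Df); apply/matrixP => i j; rewrite mxE.
by case: (H i j).
Qed.

Lemma is_derive_coord_id (d : nat) (i : 'I_d) (x v : 'rV[R]_d) :
  is_derive x v (fun y : 'rV[R]_d => y 0 i : R^o) (v 0 i).
Proof. exact: (is_derive_coord 0 i (is_derive_id x v)). Qed.

End ChainRule.

(* The derivatives of [x > 0 |-> exp (- 1/x)] have the form [P(1/x) exp (- 1/x)]. *)
Definition flat (R : realType) (P : {poly R}) (x : R) : R :=
  if 0 < x then P.[x^-1] * expR (- x^-1) else 0.

Section Flat.
Context {R : realType}.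
Implicit Types P : {poly R}.

(** With y = 1/x, the inequality y^(i+1) / (i+1)! <= exp y gives y^i exp(-y) <= (i+1)! x for each
    monomial. The spare factor x yields the limit 0 at the origin. *)
Lemma flat_bound P : exists2 c, 0 <= c & forall x, `|flat P x| <= c * `|x|.
Proof.
exists (\sum_(i < size P) `|P`_i| * (i.+1)`!%:R).
  by apply: sumr_ge0 => i _; apply: mulr_ge0.
move=> x; rewrite /flat; case: ifPn => [x0|_]; last first.
  by rewrite normr0 mulr_ge0// sumr_ge0// => i _; apply: mulr_ge0.
rewrite horner_coef mulr_suml (le_trans (ler_norm_sum _ _ _))// mulr_suml.
apply: ler_sum => i _; rewrite -!mulrA normrM ler_wpM2l//.
have y0 : 0 < x^-1 by rewrite invr_gt0.
have e0 : 0 < expR (- x^-1) by apply: expR_gt0.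
rewrite (gtr0_norm x0) ger0_norm; last first.
  by rewrite mulr_ge0 ?exprn_ge0// ltW.
have := ler_wpM2r (ltW e0) (expR_ge1Dxn i (ltW y0)).
rewrite -expRD subrr expR0 mulrDl mul1r => H.
have {}H : x^-1 ^+ i.+1 / (i.+1)`!%:R * expR (- x^-1) <= 1.
  by apply: le_trans H; rewrite lerDr ltW.
move: H; rewrite mulrAC ler_pdivrMr ?ltr0n ?fact_gt0// mul1r exprS => H.
rewrite -ler_pdivrMr// mulrC; apply: le_trans H.
by rewrite mulrA lexx.
Qed.

Lemma flat_cvg0 P : flat P x @[x --> (0 : R)] --> (0 : R).
Proof.
have [c c0 H] := flat_bound P.
apply/cvgrPdist_le => e e0; near=> x.
rewrite sub0r normrN (le_trans (H x))//.
have : `|x| < e / (c + 1).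
  near: x; apply: cvgr0_norm_lt; first exact: cvg_id.
  by rewrite divr_gt0// ltr_wpDl.
rewrite ltr_pdivlMr ?ltr_wpDl// => H1.
apply/ltW/(le_lt_trans _ H1); rewrite mulrC ler_wpM2l// lerDl//.
Unshelve. all: by end_near. Qed.

(** For x > 0 the derivative of P(1/x) exp(-1/x) is x^-2 (P - P')(1/x) exp(-1/x), again of the form
    [flat]; hence all derivatives exist. *)
Lemma is_derive_flat P (x : R) :
  is_derive x 1 (flat P) (flat ('X^2 * (P - P^`())) x).
Proof.
have [x0|x0|<-] := ltgtP 0 x.
- have Dv : is_derive x 1 (fun y : R => y^-1) (- x ^- 2).
    have := @is_deriveV _ (id : R -> R) x 1 1 (lt0r_neq0 x0) (is_derive_id _ _).
    by rewrite [_ *: 1]mulr1.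
  apply: (@near_eq_is_derive _ _ _ (fun y : R => P.[y^-1] * expR (- y^-1))).
    near=> y; rewrite /flat; case: ifPn => //; rewrite -leNgt => y0.
    have : 0 < y by near: y; apply: lt_nbhsr.
    by rewrite ltNge y0.
  have D1 : is_derive x 1 (fun y : R => P.[y^-1]) (P^`().[x^-1] * - x ^- 2).
    exact: is_derive_chain.
  have D2 : is_derive x 1 (fun y : R => expR (- y^-1)) (expR (- x^-1) * x ^- 2).
    have := is_deriveN Dv; rewrite opprK => DN.
    exact: is_derive_chain.
  refine (is_derive_eq (is_deriveM D1 D2) _).
  rewrite /flat x0 !(hornerE, hornerXn) exprVn.
  rewrite -![_ *: _]/(_ * _); ring.
- apply: (@near_eq_is_derive _ _ _ (fun=> 0)).
    near=> y; rewrite /flat ifF//; apply/negbTE; rewrite -leNgt ltW//.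
    by near: y; apply: lt_nbhsl.
  by rewrite /flat ltNge (ltW x0) /=; apply: is_derive_cst.
(* At 0 the difference quotient of [flat P] is [flat ('X * P)], which tends to 0 by [flat_cvg0]. *)
- rewrite {2}/flat ltxx.
  suff E : (fun h : R => h^-1 *: ((flat P \o shift 0) (h *: 1) - flat P 0)) @ 0^' --> (0 : R).
    by split; [apply/cvg_ex; exists 0|apply/cvg_lim].
  have : flat ('X * P) h @[h --> (0 : R)^'] --> (0 : R).
    by apply: cvg_trans (flat_cvg0 ('X * P)); apply: cvg_app; apply: cvg_within.
  apply: cvg_trans; apply: near_eq_cvg; near=> h.
  have h0 : h != 0 by near: h; apply: nbhs_dnbhs_neq.
  rewrite /= addr0 [h *: 1]mulr1 {3}/flat ltxx subr0 /flat.
  case: ifPn => _; last by rewrite scaler0.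
  by rewrite -[_ *: _]/(_ * _) hornerM hornerX mulrA.
Unshelve. all: by end_near. Qed.

End Flat.

Definition smooth (R : realType) (d : nat) (f : 'rV[R]_d -> R) : Prop :=
  smooth_on setT (f : 'rV[R]_d -> R^o).

(** A class of functions closed under directional derivatives: one differentiation at a time stays
    inside it, so smoothness follows without Leibniz formulas for iterated derivatives. The first
    constructor, with the identity matrix, contains every smooth function, so the closure rules for
    [smooth] are read off from the other constructors. *)
Inductive smooth_expr (R : realType) (d : nat) : ('rV[R]_d -> R) -> Prop :=
| smooth_expr_mulmx d' (A : 'M[R]_(d, d')) (f : 'rV[R]_d' -> R) :
    smooth f -> smooth_expr (fun x => f (x *m A))
| smooth_expr_cst c : smooth_expr (fun=> c)
| smooth_expr_coord i : smooth_expr (fun x => x 0 i)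
| smooth_expr_add f g :
    smooth_expr f -> smooth_expr g -> smooth_expr (fun x => f x + g x)
| smooth_expr_mul f g :
    smooth_expr f -> smooth_expr g -> smooth_expr (fun x => f x * g x)
| smooth_expr_flat P f : smooth_expr f -> smooth_expr (fun x => flat P (f x)).

Section Smooth.
Context {R : realType}.

Lemma smooth_continuous (d : nat) (f : 'rV[R]_d -> R) : smooth f -> continuous f.
Proof. by move=> sf x; have [] := sf [::] x I. Qed.

Lemma smooth_derive (d : nat) (f : 'rV[R]_d -> R) v :
  smooth f -> smooth ('D_v (f : _ -> R^o)).
Proof. by move=> sf s x _; have := sf (rcons s v) x I; rewrite /iter_derive -cats1 foldr_cat. Qed.

Lemma smooth_expr_derive (d : nat) (f : 'rV[R]_d -> R) : smooth_expr f ->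
  continuous f /\
  forall v, exists2 g, smooth_expr g & forall x, is_derive x v (f : _ -> R^o) (g x).
Proof.
elim=> {f} [d' A f sf|c|i|f g sf [cf IHf] sg [cg IHg]|f g sf [cf IHf] sg [cg IHg]|P f sf [cf IHf]].
- split=> [x|v].
    apply: (cvg_comp (fun y => y *m A) f (@mulmx_continuous _ 1 _ _ A x)).
    exact: smooth_continuous.
  exists (fun x => 'D_(v *m A) (f : _ -> R^o) (x *m A)).
    exact: (smooth_expr_mulmx A (smooth_derive (v *m A) sf)).
  move=> x; apply: is_derive_mulmx; apply/derivableP.
  by have [_] := sf [::] (x *m A) I; apply.
- split=> [|v]; first exact: cst_continuous.
  by exists (fun=> 0) => [|x]; [exact: smooth_expr_cst|exact: is_derive_cst].
- split=> [|v]; first exact: coord_continuous.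
  exists (fun=> v 0 i) => [|x]; first exact: smooth_expr_cst.
  exact: is_derive_coord_id.
- split=> [x|v]; first exact: (cvgD (cf x) (cg x)).
  have [f' sf' Df] := IHf v; have [g' sg' Dg] := IHg v.
  by exists (fun x => f' x + g' x) => [|x]; [exact: smooth_expr_add|exact: is_deriveD].
- split=> [x|v]; first exact: (cvgM (cf x) (cg x)).
  have [f' sf' Df] := IHf v; have [g' sg' Dg] := IHg v.
  exists (fun x => f x * g' x + g x * f' x) => [|x]; last exact: is_deriveM.
  by apply: smooth_expr_add; apply: smooth_expr_mul.
- split=> [x|v].
    apply: (cvg_comp f (flat P) (cf x)); apply/differentiable_continuous/derivable1_diffP.
    by have [] := is_derive_flat P (f x).
  have [f' sf' Df] := IHf v.
  exists (fun x => flat ('X^2 * (P - P^`())) (f x) * f' x) => [|x].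
    by apply: smooth_expr_mul => //; apply: smooth_expr_flat.
  by apply: is_derive_chain => //; apply: is_derive_flat.
Qed.

Lemma smooth_exprP (d : nat) (f : 'rV[R]_d -> R) : smooth_expr f -> smooth f.
Proof.
move=> sf s; have : smooth_expr (iter_derive s (f : _ -> R^o)).
  elim: s => //= v s IH; have [_ /(_ v) [g sg Dg]] := smooth_expr_derive IH.
  rewrite (_ : (fun x => _) = g)//; apply/funext => x.
  by have [] := Dg x.
move=> /smooth_expr_derive [cf Df] x _; split; first exact: cf.
by move=> v; have [g _ /(_ x) []] := Df v.
Qed.

Lemma smooth_exprE (d : nat) (f : 'rV[R]_d -> R) : smooth f -> smooth_expr f.
Proof.
move=> sf; have := smooth_expr_mulmx (1%:M) sf.
by congr smooth_expr; apply/funext => x; rewrite mulmx1.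
Qed.

Lemma smoothD (d : nat) (f g : 'rV[R]_d -> R) :
  smooth f -> smooth g -> smooth (fun x => f x + g x).
Proof. by move=> *; apply/smooth_exprP/smooth_expr_add; apply: smooth_exprE. Qed.

Lemma smoothM (d : nat) (f g : 'rV[R]_d -> R) :
  smooth f -> smooth g -> smooth (fun x => f x * g x).
Proof. by move=> *; apply/smooth_exprP/smooth_expr_mul; apply: smooth_exprE. Qed.

Lemma smooth_cst (d : nat) (c : R) : smooth (fun _ : 'rV[R]_d => c).
Proof. exact/smooth_exprP/smooth_expr_cst. Qed.

Lemma smoothZ (d : nat) (c : R) (f : 'rV[R]_d -> R) :
  smooth f -> smooth (fun x => c * f x).
Proof. by move=> sf; exact: (smoothM (smooth_cst c) sf). Qed.

Lemma smooth_mulmx (d d' : nat) (A : 'M[R]_(d, d')) (f : 'rV[R]_d' -> R) :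
  smooth f -> smooth (fun x => f (x *m A)).
Proof. by move=> ?; apply/smooth_exprP/smooth_expr_mulmx. Qed.

Lemma smooth_dilation (d : nat) (t : R) (f : 'rV[R]_d -> R) :
  smooth f -> smooth (fun x => f (t *: x)).
Proof.
move=> /(smooth_mulmx t%:M).
by congr smooth; apply/funext => x; rewrite mul_mx_scalar.
Qed.

Lemma smooth_coord (d : nat) i : smooth (fun x : 'rV[R]_d => x 0 i).
Proof. exact/smooth_exprP/smooth_expr_coord. Qed.

Lemma smooth_sum (d : nat) (I : finType) (f : I -> 'rV[R]_d -> R) :
  (forall i, smooth (f i)) -> smooth (fun x => \sum_i f i x).
Proof.
move=> sf; elim: (index_enum I) => [|i s IH].
  by under eq_fun do rewrite big_nil; exact: (smooth_cst 0).
by under eq_fun do rewrite big_cons; exact: (smoothD (sf i) IH).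
Qed.

Lemma smooth_flat (d : nat) P (f : 'rV[R]_d -> R) :
  smooth f -> smooth (fun x => flat P (f x)).
Proof. by move=> ?; apply/smooth_exprP/smooth_expr_flat/smooth_exprE. Qed.

End Smooth.

(** Since [flat 1] is exp(-1/t) for t > 0, this is the standard mollifier of the Euclidean ball of
    radius [rho] around [p], not normalized. *)
Definition bump (R : realType) (d : nat) (p : 'rV[R]_d) (rho : R)
    (x : 'rV[R]_d) : R :=
  flat 1 (rho ^+ 2 - dotp (x - p) (x - p)).

Section Bump.
Context {R : realType}.

Lemma smooth_dotp (d : nat) (p : 'rV[R]_d) : smooth (fun x => dotp (x - p) (x - p)).
Proof.
apply: smooth_sum => i.
have S : smooth (fun x : 'rV[R]_d => (x - p) 0 i).
  under eq_fun do rewrite !mxE.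
  by apply: smoothD; [exact: smooth_coord|exact: smooth_cst].
exact: smoothM.
Qed.

Lemma bump_smooth (d : nat) (p : 'rV[R]_d) rho : smooth (bump p rho).
Proof.
apply/smooth_flat; under eq_fun => x do rewrite -[dotp _ _]mul1r -mulNr.
apply: smoothD; first exact: smooth_cst.
exact: (smoothZ (-1) (smooth_dotp p)).
Qed.

Lemma bump_ge0 (d : nat) (p : 'rV[R]_d) rho x : 0 <= bump p rho x.
Proof.
by rewrite /bump /flat; case: ifP => // _; rewrite hornerC mul1r expR_ge0.
Qed.

Lemma bump_gt0 (d : nat) (p : 'rV[R]_d) rho x :
  (0 < bump p rho x) = (dotp (x - p) (x - p) < rho ^+ 2).
Proof.
rewrite /bump /flat subr_gt0; case: ifP => _; last by rewrite ltxx.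
by rewrite hornerC mul1r expR_gt0.
Qed.

End Bump.

(** * Integration *)

Section Rescaling.
Context {R : realType}.
Local Notation leb := (@lebesgue_measure R).
Local Open Scope ereal_scope.
Import HBNNSimple.

(** The integral of a nonnegative function is the supremum over the simple functions below it, and a
    larger function has more of them. *)
Lemma le_integral_setT (d : measure_display) (T : measurableType d)
    (mu : {measure set T -> \bar R}) (f g : T -> \bar R) :
  (forall x, 0 <= f x) -> (forall x, f x <= g x) ->
  \int[mu]_x f x <= \int[mu]_x g x.
Proof.
move=> f0 fg; have g0 x : 0 <= g x by apply: le_trans (f0 x) (fg x).
rewrite !ge0_integralE// !patch_setT; apply: le_ereal_sup => _ [h hf <-].
by exists h => // x; apply: le_trans (hf x) (fg x).
Qed.

Lemma integral_nnsfun_sup (d : measure_display) (T : measurableType d)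
    (mu : {measure set T -> \bar R}) (f : T -> \bar R) (b : \bar R) :
  (forall x, 0 <= f x) ->
  (forall h : T -> R, measurable_fun setT h -> (forall x, 0 <= h x)%R ->
     (forall x, (h x)%:E <= f x) -> \int[mu]_x (h x)%:E <= b) ->
  \int[mu]_x f x <= b.
Proof.
move=> f0 H; rewrite ge0_integralE// patch_setT.
apply: ge_ereal_sup => _ [h hf <-]; rewrite -integralT_nnsfun.
by apply: H => // x; apply: fun_ge0.
Qed.

Lemma measurable_dilation (r : R) :
  measurable_fun setT ((fun t => t * r)%R : measurableTypeR R -> measurableTypeR R).
Proof. exact: measurable_funM. Qed.

Lemma lebesgue_measure_dilation (r : R) (A : set R) : (0 < r)%R ->
  measurable A -> leb ((fun t => t * r)%R @^-1` A) = r^-1%:E * leb A.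
Proof.
move=> r0 mA; have mr := measurable_dilation r.
pose nu := [the measure _ _ of pushforward leb ((fun t => t * r)%R : measurableTypeR R -> measurableTypeR R)].
pose k : {nonneg R} := NngNum (ltW r0).
have := @lebesgue_measure_unique R [the measure _ _ of mscale k (nu mr)] _ A mA.
rewrite /= /mscale /pushforward => -> /=.
  by rewrite muleA -EFinM mulVf ?gt_eqF// mul1e.
move=> _ [[a b] _ <-] /=; rewrite /pushforward.
rewrite (_ : _ @^-1` _ = [set` `]a / r, b / r]%R]); last first.
  by apply/seteqP; split => x /=; rewrite !in_itv /= ltr_pdivrMr// ler_pdivlMr.
rewrite !lebesgue_measure_itv /= !lte_fin ltr_pM2r ?invr_gt0//.
case: ifP => _; last by rewrite mule0.
by rewrite -!EFinB -EFinM -mulrBl mulrC mulfVK ?gt_eqF.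
Qed.

Lemma integral_dilation (r : R) (g : R -> \bar R) : (0 < r)%R ->
  measurable_fun setT g -> (forall t, 0 <= g t) ->
  \int[leb]_t g (t * r)%R = r^-1%:E * \int[leb]_t g t.
Proof.
move=> r0 mg g0; have mr := measurable_dilation r.
pose nu := [the measure _ _ of pushforward leb ((fun t => t * r)%R : measurableTypeR R -> measurableTypeR R)].
have ri : (0 <= r^-1)%R by rewrite invr_ge0 ltW.
pose k : {nonneg R} := NngNum ri.
rewrite -(@ge0_integral_mscale _ _ _ leb setT measurableT k g)//.
transitivity (\int[nu mr]_t g t).
  by rewrite ge0_integral_pushforward// preimage_setT.
apply: eq_measure_integral => A mA _.
exact: lebesgue_measure_dilation.
Qed.

Lemma lee_EFin_mul2l (k : R) (x y : \bar R) :
  (0 <= k)%R -> x <= y -> k%:E * x <= k%:E * y.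
Proof. by move=> k0; apply: lee_wpmul2l; rewrite lee_fin. Qed.

(** A measurable [h] below the left integrand can be rescaled by the substitution rule, and x -> h(x
    r)/c then lies below [g]. *)
Lemma integral_rescale_le (c r : R) (g : R -> \bar R) :
  (0 < c)%R -> (0 < r)%R -> (forall t, 0 <= g t) ->
  \int[leb]_t (c%:E * g (t / r)%R) <= (c * r)%:E * \int[leb]_t g t.
Proof.
move=> c0 r0 g0.
apply: integral_nnsfun_sup => [t|h mh h0 hg]; first by rewrite mule_ge0// lee_fin ltW.
have mk : measurable_fun setT (fun t : measurableTypeR R => (h (t * r)%R)%:E).
  apply/measurable_EFinP.
  exact: (measurableT_comp (f := h) mh (measurable_dilation r)).
have -> : \int[leb]_x (h x)%:E = r%:E * \int[leb]_x (h (x * r)%R)%:E.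
  rewrite (@integral_dilation r (fun t => (h t)%:E))//; last exact/measurable_EFinP.
  by rewrite muleA -EFinM divff ?gt_eqF// mul1e.
have -> : (c * r)%:E * \int[leb]_t g t = r%:E * (c%:E * \int[leb]_t g t).
  by rewrite muleA -EFinM mulrC.
apply: lee_EFin_mul2l; first exact: ltW.
have -> : \int[leb]_x (h (x * r)%R)%:E = c%:E * \int[leb]_x (c^-1%:E * (h (x * r)%R)%:E).
  have ci : 0 <= c^-1%:E by rewrite lee_fin invr_ge0 ltW.
  rewrite ge0_integralZl//; last by move=> x _; rewrite lee_fin h0.
  by rewrite muleA -EFinM divff ?gt_eqF// mul1e.
apply: lee_EFin_mul2l; first exact: ltW.
apply: le_integral_setT => x.
  by apply: mule_ge0; rewrite lee_fin ?h0// invr_ge0 ltW.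
have := hg (x * r)%R; rewrite mulfK ?gt_eqF// => H.
rewrite muleC lee_pdivrMr//; by rewrite muleC.
Qed.

(** The reverse inequality is the previous one for 1/c and 1/r, applied to the rescaled function. *)
Lemma integral_rescale (c r : R) (g : R -> \bar R) :
  (0 < c)%R -> (0 < r)%R -> (forall t, 0 <= g t) ->
  \int[leb]_t (c%:E * g (t / r)%R) = (c * r)%:E * \int[leb]_t g t.
Proof.
move=> c0 r0 g0; apply/eqP; rewrite eq_le integral_rescale_le//=.
have c1 : (0 < c^-1)%R by rewrite invr_gt0.
have r1 : (0 < r^-1)%R by rewrite invr_gt0.
have := integral_rescale_le (g := fun t => c%:E * g (t / r)%R) c1 r1.
rewrite (_ : (fun t => _) = g); last first.
  by apply/funext => t; rewrite invrK mulfK ?gt_eqF// muleA -EFinM mulVf ?gt_eqF// mul1e.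
move=> H; have {}H := H (fun t => mule_ge0 (ltW (c0 : 0 < c%:E)) (g0 _)).
have -> : \int[leb]_t (c%:E * g (t / r)%R) =
    (c * r)%:E * ((c^-1 / r)%:E * \int[leb]_t (c%:E * g (t / r)%R)).
  by rewrite muleA -EFinM -invfM divff ?mul1e// gt_eqF// mulr_gt0.
by apply: lee_EFin_mul2l => //; rewrite mulr_ge0 ?ltW.
Qed.

(** The infinite cases matter, since the positive and negative parts of an arbitrary function may
    have infinite integrals; [fine] is then 0 on both sides. *)
Lemma fine_EFin_mulB (k : R) (x y : \bar R) : (0 < k)%R ->
  fine (k%:E * x - k%:E * y) = (k * fine (x - y))%R.
Proof.
move=> k0; have ky : k%:E * +oo = +oo by rewrite gt0_muley.
have kNy : k%:E * -oo = -oo by rewrite gt0_muleNy.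
move: x y => [a| |] [b| |]; rewrite ?ky ?kNy ?mulr0//=; by rewrite ?mulr0 ?mulrBr.
Qed.

(* No measurability of [f] is assumed: the integral of an arbitrary function is
   still a difference of suprema of integrals of simple functions. *)
Lemma Rintegral_rescale (c r : R) (f : R -> R) : (0 < c)%R -> (0 < r)%R ->
  (Rintegral leb `]0, +oo[%classic (fun t => c * f (t / r)) =
   c * r * Rintegral leb `]0, +oo[%classic f)%R.
Proof.
move=> c0 r0; rewrite /Rintegral integral_mkcond [in RHS]integral_mkcond.
set F := (fun x => (f x)%:E) \_ _.
have -> : (fun t => (c * f (t / r))%:E) \_ `]0%R, +oo[ = (fun t => c%:E * F (t / r)%R).
  apply/funext => t; rewrite /F /patch !mem_setE !in_itv /= !andbT.
  by rewrite pmulr_lgt0 ?invr_gt0//; case: ifP => _; rewrite ?mule0// EFinM.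
rewrite integralE [in RHS]integralE.
have -> : (fun t => c%:E * F (t / r)%R)^\+ = (fun t => c%:E * F^\+ (t / r)%R).
  by apply/funext => t; rewrite !funeposE maxe_pMr ?mule0// ?lee_fin ltW.
have -> : (fun t => c%:E * F (t / r)%R)^\- = (fun t => c%:E * F^\- (t / r)%R).
  by apply/funext => t; rewrite !funenegE maxe_pMr ?mule0 ?muleN// ?lee_fin ltW.
rewrite (@integral_rescale c r F^\+)//.
rewrite (@integral_rescale c r F^\-)//.
by apply: fine_EFin_mulB; rewrite mulr_gt0.
Qed.

End Rescaling.

Definition supp_le (R : realType) (k : nat) (M : R) (F : 'rV[R]_k -> R) : Prop :=
  forall x, M < `|x| -> F x = 0.

Section IntegralRow.
Context {R : realType}.
Local Notation leb := (@lebesgue_measure R).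

Lemma integrable_line (M : R) (g : R -> R) : continuous g ->
  (forall t, M < `|t| -> g t = 0) -> leb.-integrable setT (EFin \o g).
Proof.
move=> cg gM; have -> : EFin \o g = (EFin \o g) \_ `[- M, M]%classic.
  apply/funext => t; rewrite /patch; case: ifPn => // /negP tM /=.
  rewrite gM// ltNge; apply/negP => tM'; apply: tM.
  by rewrite inE /= in_itv /= -ler_norml.
apply/(integrable_mkcond _ _).1 => //.
apply: continuous_compact_integrable; first exact: segment_compact.
exact/continuous_subspaceT.
Qed.

Lemma Rintegral_line_bound (M C : R) (g : R -> R) : continuous g -> 0 <= M ->
  (forall t, M < `|t| -> g t = 0) -> (forall t, `|g t| <= C) ->
  `|Rintegral leb setT g| <= C * (2 * M).
Proof.
move=> cg M0 gM gC.
have gE : g = g \_ `[- M, M]%classic.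
  apply/funext => t; rewrite /patch; case: ifPn => // /negP tM /=.
  rewrite gM// ltNge; apply/negP => tM'; apply: tM.
  by rewrite inE /= in_itv /= -ler_norml.
rewrite gE -Rintegral_mkcond.
have ig : leb.-integrable `[- M, M]%classic (EFin \o g).
  apply: continuous_compact_integrable; first exact: segment_compact.
  exact/continuous_subspaceT.
apply: le_trans (le_normr_Rintegral _ ig) _ => //.
apply: (@le_trans _ _ (Rintegral leb `[- M, M]%classic (fun=> C))).
  apply: le_Rintegral => //; first exact: integrable_norm.
  apply: continuous_compact_integrable; first exact: segment_compact.
  exact/continuous_subspaceT/cst_continuous.
rewrite Rintegral_cst//= lebesgue_measure_itv /= lte_fin.
case: ifPn => [_|]; first by rewrite -EFinB /= opprK mulr_natl mulr2n.
rewrite -leNgt => MM; rewrite mulr0 !mulr_ge0//.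
by apply: le_trans (gC 0).
Qed.

Lemma Rintegral_line_gt0 (M : R) (g : R -> R) t0 : continuous g ->
  (forall t, M < `|t| -> g t = 0) -> (forall t, 0 <= g t) -> 0 < g t0 ->
  0 < Rintegral leb setT g.
Proof.
move=> cg gM g0 gt0.
have H : g t0 / 2 < g t0 by rewrite ltr_pdivrMr// ltr_pMr// ltr1n.
have : \forall t \near t0, g t0 / 2 < g t.
  have H2 : g @ t0 --> g t0 by exact: cg.
  by move/cvgr_gt: H2; apply.
move=> /nbhs_ballP[e /= e0 He].
pose A := `[t0 - e / 2, t0 + e / 2]%classic.
have mA : measurable (A : set (measurableTypeR R)) by exact: measurable_itv.
apply: (@lt_le_trans _ _ (Rintegral leb A (fun=> g t0 / 2))).
  have lA : leb A = e%:E.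
    rewrite /A lebesgue_measure_itv /= lte_fin ltrD2l gtrN ?divr_gt0//.
    by rewrite -EFinB opprD addrACA subrr add0r opprK -splitr.
  rewrite Rintegral_cst//=.
  by rewrite lA /= mulr_gt0 ?divr_gt0.
rewrite Rintegral_mkcond; apply: le_Rintegral => //.
- have -> : EFin \o (fun=> g t0 / 2) \_ A = (EFin \o (fun=> g t0 / 2)) \_ A.
    by rewrite restrict_EFin.
  apply/(integrable_mkcond _ _).1 => //.
  apply: continuous_compact_integrable; first exact: segment_compact.
  exact/continuous_subspaceT/cst_continuous.
- exact: integrable_line gM.
- move=> t _; rewrite /patch; case: ifPn => // tA.
  apply/ltW/He; move: tA; rewrite inE /A /= in_itv /= => /andP[H1 H2].
  rewrite /ball /= (le_lt_trans (y := e / 2))//.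
    by rewrite ler_norml; apply/andP; split; lra.
  by rewrite ltr_pdivrMr// ltr_pMr// ltr1n.
Qed.

Lemma continuous_lin (T : topologicalType) (a : R) (f g : T -> R) :
  continuous f -> continuous g -> continuous (fun x => a * f x + g x).
Proof.
move=> cf cg x; have ca : (fun=> a) @ x --> a by exact: cvg_cst.
exact: (cvgD (cvgM ca (cf x)) (cg x)).
Qed.

Lemma continuous_scale (T : topologicalType) (a : R) (f : T -> R) :
  continuous f -> continuous (fun x => a * f x).
Proof.
move=> cf x; have ca : (fun=> a) @ x --> a by exact: cvg_cst.
exact: (cvgM ca (cf x)).
Qed.

Lemma continuous_sum (T : topologicalType) (I : finType) (f : I -> T -> R) :
  (forall i, continuous (f i)) -> continuous (fun x => \sum_i f i x).
Proof. by move=> cf x; apply: cvg_sum => i; apply: cf. Qed.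

Lemma continuous_abs (T : topologicalType) (f : T -> R) :
  continuous f -> continuous (fun x => `|f x|).
Proof. by move=> cf x; exact: (cvg_norm (cf x)). Qed.

Lemma continuous_max0 (T : topologicalType) (f : T -> R) :
  continuous f -> continuous (fun x => Num.max (f x) 0).
Proof.
move=> cf; have E x : Num.max (f x) 0 = 2^-1 * (f x) + (2^-1 * `|f x|).
  by rewrite maxr_absE addr0 subr0 mulrDl mulrC [`|_| / _]mulrC.
under eq_fun do rewrite E.
exact: continuous_lin (continuous_scale (a := 2^-1) (continuous_abs cf)).
Qed.

Definition slice (k : nat) (F : 'rV[R]_k.+1 -> R) (t : R) : 'rV[R]_k -> R :=
  fun y => F (row_mx (t%:M : 'rV[R]_1) y).

Lemma row_mx_cvg (T : Type) (G : set_system T) {FG : Filter G} (k : nat)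
    (a : T -> R) (b : T -> 'rV[R]_k) (a0 : R) (b0 : 'rV[R]_k) :
  a @ G --> a0 -> b @ G --> b0 ->
  (fun x => row_mx ((a x)%:M : 'rV[R]_1) (b x)) @ G
    --> (row_mx (a0%:M : 'rV[R]_1) b0).
Proof.
move=> ca /mx_cvgP cb; apply/mx_cvgP => i j.
rewrite ord1 mxE; under eq_fun do rewrite mxE.
case: (fintype.split j) => l; last exact: cb.
by rewrite ord1 mxE eqxx mulr1n; under eq_fun do rewrite mxE eqxx mulr1n.
Qed.

Lemma row_mx_head (k : nat) (x : 'rV[R]_(1 + k)) :
  row_mx ((x 0 0)%:M : 'rV[R]_1) (rsubmx x) = x.
Proof.
rewrite -[RHS]hsubmxK; congr row_mx; apply/rowP => i.
by rewrite ord1 !mxE eqxx mulr1n; congr (x _ _); apply: val_inj.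
Qed.

Lemma slice_continuous (k : nat) (F : 'rV[R]_k.+1 -> R) t :
  continuous F -> continuous (slice F t).
Proof.
move=> cF y; apply: (cvg_comp _ F _ (cF _)).
have FF : Filter (nbhs y) by exact: nbhs_filter.
by apply: (row_mx_cvg (a := fun=> t) (b := id)); [exact: cvg_cst|exact: cvg_id].
Qed.

Lemma le_norm_row_mx (k : nat) (t : R) (y : 'rV[R]_k) :
  `|t| <= `|row_mx (t%:M : 'rV[R]_1) y| /\ `|y| <= `|row_mx (t%:M : 'rV[R]_1) y|.
Proof.
split.
  have := coord_le_norm (row_mx (t%:M : 'rV[R]_1) y) 0 (lshift k 0).
  by rewrite row_mxEl mxE eqxx mulr1n.
apply: norm_le_coord => // i j; rewrite ord1.
have := coord_le_norm (row_mx (t%:M : 'rV[R]_1) y) 0 (rshift 1 j).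
by rewrite row_mxEr.
Qed.

Lemma slice_supp (k : nat) (F : 'rV[R]_k.+1 -> R) M t :
  supp_le M F -> supp_le M (slice F t).
Proof.
by move=> FM y My; apply: FM; apply: lt_le_trans My (le_norm_row_mx t y).2.
Qed.

Lemma slice_out (k : nat) (F : 'rV[R]_k.+1 -> R) M t :
  supp_le M F -> M < `|t| -> slice F t = fun=> 0.
Proof.
move=> FM Mt; apply/funext => y; apply: FM.
exact: lt_le_trans Mt (le_norm_row_mx t y).1.
Qed.

Lemma compact_norm_le (k : nat) (M : R) : compact [set y : 'rV[R]_k | `|y| <= M].
Proof.
apply: bounded_closed_compact.
  by exists M; split; [exact: num_real|move=> z /ltW Mz y /= /le_trans; apply].
have H : {in ~` ((fun y : 'rV[R]_k => `|y|) @^-1` [set r | r <= M]),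
    continuous (fun y : 'rV[R]_k => `|y|)}.
  by move=> y _; exact: norm_continuous.
exact: (preimage_closed H (@closed_le _ M)).
Qed.

(** Compactness of the ball of radius [M] makes the continuity in the first variable uniform in the
    others, as needed for the continuity of partial integrals. *)
Lemma slice_unif (k : nat) (F : 'rV[R]_k.+1 -> R) M t e : continuous F ->
  supp_le M F -> 0 < e ->
  \forall s \near t, forall y, `|slice F s y - slice F t y| <= e.
Proof.
move=> cF FM e0.
pose K : set 'rV[R]_k := [set y | `|y| <= M].
have cK : compact K by exact: compact_norm_le.
pose P s y := `|slice F s y - slice F t y| <= e.
suff H : \forall s \near t, K `<=` P s.
  near=> s => y; have [yM|My] := leP `|y| M.
    suff /(_ y yM) : K `<=` P s by [].
    by near: s; exact: H.
  by rewrite /P !(slice_supp _ FM)// subrr normr0 ltW.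
have /compact_near_coveringP cov := cK.
apply: (cov R (nbhs t) P) => y Ky.
have c2 : (fun p : 'rV[R]_k * R => slice F p.2 p.1) @ filter_prod (nbhs y) (nbhs t)
    --> slice F t y.
  refine (cvg_comp (fun p : 'rV[R]_k * R => row_mx (p.2%:M : 'rV[R]_1) p.1) F _ (cF _)).
  by apply: (row_mx_cvg (a := snd) (b := fst)); [exact: cvg_snd|exact: cvg_fst].
have c1 : (fun p : 'rV[R]_k * R => slice F t p.1) @ filter_prod (nbhs y) (nbhs t)
    --> slice F t y.
  refine (cvg_comp (fun p : 'rV[R]_k * R => row_mx (t%:M : 'rV[R]_1) p.1) F _ (cF _)).
  by apply: (row_mx_cvg (a := fun=> t) (b := fst)); [exact: cvg_cst|exact: cvg_fst].
have := cvgB c2 c1; rewrite subrr => /(_ _)/cvgrPdist_le/(_ _ e0).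
by apply: filterS => -[y' s]; rewrite /= sub0r normrN.
Unshelve. all: by end_near. Qed.

(** The properties are proved by one induction because they depend on each other: linearity and the
    bound in dimension k show that the partial integral is continuous in the first variable, which
    gives integrability in dimension k + 1. *)
Lemma integral_rV_props (k : nat) :
  [/\ forall M (a : R) (F G : 'rV[R]_k -> R), continuous F -> continuous G ->
        supp_le M F -> supp_le M G ->
        integral_rV (fun x => a * F x + G x) = a * integral_rV F + integral_rV G,
      forall M C (F : 'rV[R]_k -> R), 0 <= M -> continuous F -> supp_le M F ->
        (forall x, `|F x| <= C) -> `|integral_rV F| <= C * (2 * M) ^+ k,
      forall (F : 'rV[R]_k -> R), (forall x, 0 <= F x) -> 0 <= integral_rV F &
      forall M (F : 'rV[R]_k -> R) x, continuous F -> supp_le M F ->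
        (forall x, 0 <= F x) -> 0 < F x -> 0 < integral_rV F].
Proof.
elim: k => [|k [IH1 IH2 IH3 IH4]].
  split=> [//|M C F _ _ _ /(_ 0)||M F x _ _ _] /=; first by rewrite expr0 mulr1.
    by move=> F; apply.
  by rewrite (_ : x = 0)//; apply/rowP => -[].
have lin0 : forall M (F : 'rV[R]_k -> R), supp_le M F -> supp_le (Num.max M 0) F.
  by move=> M F H x; rewrite gt_max => /andP[/H].
have cint M (F : 'rV[R]_k.+1 -> R) : continuous F -> supp_le M F ->
    continuous (fun t => integral_rV (slice F t)).
  move=> cF FM t; apply/cvgrPdist_le => e e0.
  pose M' := Num.max M 0.
  have M'0 : 0 <= M' by rewrite le_max lexx orbT.
  pose c := e / ((2 * M') ^+ k + 1).
  have d0 : 0 < (2 * M') ^+ k + 1.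
    by rewrite ltr_wpDl// exprn_ge0// mulr_ge0.
  have c0 : 0 < c by rewrite divr_gt0.
  have := slice_unif t cF FM c0; apply: filterS => s Hs.
  rewrite distrC.
  have -> : integral_rV (slice F s) - integral_rV (slice F t)
      = integral_rV (fun x => (-1) * slice F t x + slice F s x).
    rewrite (IH1 M) ?mulN1r 1?addrC//; try exact: slice_continuous;
      exact: slice_supp.
  apply: (@le_trans _ _ (c * (2 * M') ^+ k)).
    apply: IH2 => // [x|x|x].
    - exact: continuous_lin (slice_continuous (t := t) cF)
        (slice_continuous (t := s) cF) x.
    - by move=> Mx; rewrite !(lin0 _ _ (slice_supp _ FM))// mulr0 addr0.
    - by rewrite mulN1r addrC.
  by rewrite /c mulrAC ler_pdivrMr// ler_wpM2l ?lerDl// ltW.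
have I0 : integral_rV (fun _ : 'rV[R]_k => 0 : R) = 0.
  have := @IH1 0 1 (fun=> 0) (fun=> 0) (@cst_continuous _ _ 0) (@cst_continuous _ _ 0).
  move=> /(_ (fun _ _ => erefl) (fun _ _ => erefl)).
  under eq_fun do rewrite mulr0 addr0.
  by rewrite mul1r => /eqP; rewrite -subr_eq subrr eq_sym => /eqP.
have out M (F : 'rV[R]_k.+1 -> R) : supp_le M F ->
    forall t, M < `|t| -> integral_rV (slice F t) = 0.
  by move=> FM t Mt; rewrite (slice_out FM Mt).
split.
- move=> M a F G cF cG FM GM /=.
  have iF := integrable_line (cint M F cF FM) (out M F FM).
  have iG := integrable_line (cint M G cG GM) (out M G GM).
  transitivity (Rintegral leb setT
     (fun t => a * integral_rV (slice F t) + integral_rV (slice G t))).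
    apply: eq_Rintegral => t _; apply: (IH1 M); try exact: slice_continuous;
      exact: slice_supp.
  rewrite RintegralD// ?RintegralZl//.
  have := integrableZl measurableT a iF.
  by congr (_.-integrable _ _).
- move=> M C F M0 cF FM FC /=; rewrite exprSr mulrA.
  apply: (Rintegral_line_bound (g := fun t => integral_rV (slice F t))) => //.
  + exact: cint FM.
  + exact: out.
  + move=> t; apply: IH2 => //; [exact: slice_continuous|exact: slice_supp|].
    by move=> x; apply: FC.
- by move=> F F0 /=; apply: Rintegral_ge0 => t _; apply: IH3.
- move=> M F x cF FM F0 Fx /=.
  apply: (Rintegral_line_gt0 (M := M) (g := fun t => integral_rV (slice F t))
    (t0 := x 0 0)).
  + exact: cint FM.
  + exact: out.
  + by move=> t; apply: IH3 => y; apply: F0.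
  + apply: (IH4 M _ (rsubmx (x : 'rV_(1 + k)))).
    * exact: slice_continuous.
    * exact: slice_supp.
    * by move=> y; apply: F0.
    * by rewrite /slice row_mx_head.
Qed.

Lemma integral_rVD (k : nat) M (a : R) (F G : 'rV[R]_k -> R) :
  continuous F -> continuous G -> supp_le M F -> supp_le M G ->
  integral_rV (fun x => a * F x + G x) = a * integral_rV F + integral_rV G.
Proof. by case: (integral_rV_props k) => H _ _ _; apply: H. Qed.

Lemma integral_rV_ge0 (k : nat) (F : 'rV[R]_k -> R) :
  (forall x, 0 <= F x) -> 0 <= integral_rV F.
Proof. by case: (integral_rV_props k) => _ _ H _; apply: H. Qed.

Lemma integral_rV_gt0 (k : nat) M (F : 'rV[R]_k -> R) x :
  continuous F -> supp_le M F -> (forall x, 0 <= F x) -> 0 < F x ->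
  0 < integral_rV F.
Proof. by case: (integral_rV_props k) => _ _ _ H; apply: H. Qed.

Lemma integral_rV0 (k : nat) : integral_rV (fun _ : 'rV[R]_k => 0 : R) = 0.
Proof.
elim: k => //= k IH; rewrite IH.
by rewrite Rintegral_cst// mul0r.
Qed.

End IntegralRow.

(** * Polar decompositions *)

Definition test_fun (R : realType) (d : nat) (h : 'rV[R]_d -> R) : Prop :=
  smooth h /\ exists M, supp_le M h.

Section Polar.
Context {R : realType}.

Lemma test_form_mul (d m : nat) (h : 'rV[R]_d -> R) (w : 'M[R]_(m, d) -> R) :
  test_fun h -> covector w -> test_form (fun x A => h x * w A).
Proof.
move=> [sh [M hM]] cw; split=> [x|A|].
- exact: covectorZ.
- by have := smoothM sh (smooth_cst (w A)).
- exists [set y | `|y| <= M]; split; first exact: compact_norm_le.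
  move=> x xM A; rewrite hM ?mul0r// ltNge; exact/negP.
Qed.

Lemma test_form_lin (d m : nat) (a : R) (psi chi : diff_form R d m) :
  test_form psi -> test_form chi ->
  test_form (fun x A => a * psi x A + chi x A).
Proof.
move=> [cp sp [K [cK Kp]]] [cc sc [K' [cK' Kc]]]; split=> [x|A|].
- have := covector_lin a 1 (cp x) (cc x).
  by under eq_fun do rewrite mul1r.
- exact: (smoothD (smoothZ a (sp A)) (sc A)).
- exists (K `|` K'); split; first exact: compactU.
  move=> x nK A; rewrite Kp ?Kc ?mulr0 ?addr0// => Kx; apply: nK.
    by right.
  by left.
Qed.

Section MassNorm.
Variables (d m : nat) (xi : ('M[R]_(m, d) -> R) -> R).
Hypothesis xiV : mvector xi.

Lemma mvector0 : xi (fun=> 0) = 0.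
Proof.
have := xiV 1 (@covector0 R m d) (@covector0 R m d).
under eq_fun do rewrite mulr0 addr0.
by rewrite mul1r => /eqP; rewrite -subr_eq subrr eq_sym => /eqP.
Qed.

Lemma mvectorZ a w : covector w -> xi (fun A => a * w A) = a * xi w.
Proof.
move=> cw; have := xiV a cw (@covector0 R m d).
by under eq_fun do rewrite addr0; rewrite mvector0 addr0.
Qed.

Lemma mvector_sum (I : finType) (c : I -> R) (w : I -> 'M[R]_(m, d) -> R) :
  (forall i, covector (w i)) ->
  xi (fun A => \sum_i c i * w i A) = \sum_i c i * xi (w i).
Proof.
move=> cw; elim: (index_enum I) => [|i s IH].
  by under eq_fun do rewrite big_nil; rewrite big_nil mvector0.
under eq_fun do rewrite big_cons; rewrite big_cons xiV ?IH//.
elim: s {IH} => [|j s IH]; first by under eq_fun do rewrite big_nil; exact: covector0.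
under eq_fun do rewrite big_cons.
have := covector_lin (c j) 1 (cw j) IH.
by under eq_fun do rewrite mul1r.
Qed.

(** An m-vector has finitely many coordinates, its values on minors. Measurability, bounds and
    limits of m-vectors are reduced to these finite sums. *)
Lemma mvector_minors w : covector w ->
  xi w = \sum_(J : {ffun 'I_m -> 'I_d})
           ((m`!)%:R^-1 * w (rowsub J 1%:M)) * xi (minor J).
Proof.
move=> cw; rewrite -mvector_sum; last by move=> J; apply: minor_covector.
congr xi; apply/funext => A.
have m0 : (m`!)%:R != 0 :> R by rewrite pnatr_eq0 -lt0n fact_gt0.
rewrite -[LHS](mulKf m0) covector_minors// mulr_sumr.
by apply: eq_bigr => J _; rewrite mulrA.
Qed.

(* [comass w] is a junk value [0] when the supremum defining it is not finite,
   in which case no multiple of [w] has a finite comass either. *)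
Lemma comass_scale_le1 (t : R) (w : 'M[R]_(m, d) -> R) :
  0 < t -> t * comass w <= 1 -> comass (fun A => t * w A) <= 1.
Proof.
move=> t0 tw.
set S := [set `|t * w A| | A in [set A | \det (A *m A^T) = 1]].
rewrite /comass -/S; have [S1|S0] := pselect (has_sup S); last first.
  by rewrite sup_out.
apply: ge_sup; first by case: S1.
move=> _ [A A1 <-]; apply: le_trans tw.
rewrite normrM gtr0_norm// ler_pM2l//.
apply: ub_le_sup; last by exists A.
case: S1 => _ [b Sb]; exists (b / t) => _ [B B1 <-].
rewrite ler_pdivlMr// (_ : _ * t = `|t * w B|); first by apply: Sb; exists B.
by rewrite normrM (gtr0_norm t0) mulrC.
Qed.

Lemma comass_ge0 (w : 'M[R]_(m, d) -> R) : 0 <= comass w.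
Proof.
rewrite /comass; set S := (X in sup X).
have [S1|S0] := pselect (has_sup S); last by rewrite sup_out.
case: (S1) => -[x [A A1 wA]] bS.
by apply: (@le_trans _ _ `|w A|) => //; apply: ub_le_sup => //; exists A.
Qed.

Lemma comass_opp (w : 'M[R]_(m, d) -> R) : comass (fun A => - w A) = comass w.
Proof. by rewrite /comass; congr sup; apply/seteqP; split => _ [A A1 <-]; exists A; rewrite ?normrN. Qed.

Lemma mass_norm_ge w : mass_norm xi = 1 -> covector w -> comass w <= 1 -> xi w <= 1.
Proof.
move=> xi1 cw w1; rewrite -xi1; apply: ub_le_sup; last by exists w.
suff : has_sup [set xi w | w in [set w : 'M[R]_(m, d) -> R | covector w /\ comass w <= 1]].
  by case.
(* A set without supremum has [sup] equal to 0, so mass norm 1 already implies that the set is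
   bounded. *)
apply: contrapT => /sup_out; rewrite -/(mass_norm xi) xi1 => /eqP.
by rewrite oner_eq0.
Qed.

Lemma mvector_le w : mass_norm xi = 1 -> covector w -> `|xi w| <= comass w.
Proof.
move=> xi1.
suff H u : covector u -> xi u <= comass u.
  move=> cw; rewrite ler_norml H// andbT lerNl -mulN1r -mvectorZ//.
  apply: le_trans (H _ (covectorZ (-1) cw)) _.
  by under eq_fun do rewrite mulN1r; rewrite comass_opp.
(* Dividing by comass + e instead of the comass covers the case of comass 0. *)
move=> cu; apply/ler_addgt0Pr => e e0.
have c0 := comass_ge0 u.
have t0 : 0 < (comass u + e)^-1 by rewrite invr_gt0 ltr_wpDl.
have := mass_norm_ge xi1 (covectorZ (comass u + e)^-1 cu).
rewrite mvectorZ// ler_pdivrMl ?mulr1; last by rewrite ltr_wpDl.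
apply; apply: comass_scale_le1 => //.
by rewrite mulrC ler_pdivrMr ?mul1r ?ltr_wpDl// lerDl ltW.
Qed.

End MassNorm.

Lemma continuous_measurable_rV (d : nat) (h : 'rV[R]_d -> R) :
  continuous h -> measurable_fun setT (h : borel_rV R d -> R).
Proof.
move=> /continuousP ch; apply: (measurability _ (RGenOpens.measurableE R)).
move=> _ [_ [a [b ->] <-]]; rewrite setTI.
by apply: sub_sigma_algebra; apply: ch; exact: interval_open.
Qed.

Lemma norm_le_measurable (d : nat) (M : R) :
  measurable ([set y : 'rV[R]_d | `|y| <= M] : set (borel_rV R d)).
Proof.
rewrite -[X in measurable X]setCK; apply: measurableC.
apply: sub_sigma_algebra; rewrite openC.
by apply: compact_closed; [exact: norm_hausdorff|exact: compact_norm_le].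
Qed.

Section Decomposition.
Variables (d m : nat) (T : functional R d m).
Variables (mu : {measure set (borel_rV R d) -> \bar R}).
Variables (xi : 'rV[R]_d -> ('M[R]_(m, d) -> R) -> R).
Hypothesis pol : polar_decomposition T mu xi.

Let aeF : Filter (almost_everywhere mu) := ae_filter_ringOfSetsType mu.

(** In the expansion by minors the integrand is bounded almost everywhere by a continuous function,
    hence by a constant on a ball containing the support of [psi]; that ball has finite measure. *)
Lemma polar_integrable psi : test_form psi ->
  mu.-integrable setT (EFin \o (fun x : borel_rV R d => xi x (psi x))).
Proof.
case: pol => muK xiV mxi xi1 _ [cpsi spsi [K [cK Kpsi]]].
have cont J : continuous (fun x => psi x (rowsub J 1%:M)).
  exact: (smooth_continuous (spsi _)).
pose c (J : {ffun 'I_m -> 'I_d}) (x : 'rV[R]_d) := (m`!)%:R^-1 * psi x (rowsub J 1%:M).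
have cc J : continuous (c J) by exact: continuous_scale (cont J).
have fE : (fun x => xi x (psi x)) = (fun x => \sum_J c J x * xi x (minor J)).
  by apply/funext => x; rewrite (mvector_minors (xiV x)).
have mf : measurable_fun setT (fun x : borel_rV R d => xi x (psi x)).
  rewrite fE; apply: measurable_sum => J; apply: measurable_funM.
    exact: continuous_measurable_rV.
  exact: (mxi _ (@minor_covector _ _ _ J)).
have [M [_ KM]] := compact_bounded cK.
pose B := [set y : 'rV[R]_d | `|y| <= M + 1].
have mB : measurable (B : set (borel_rV R d)) := @norm_le_measurable d (M + 1).
have [b Hb] : exists b, forall x, B x -> \sum_J `|c J x| * comass (@minor R m d J) <= b.
  have cs : continuous (fun x => \sum_J `|c J x| * comass (@minor R m d J)).
    apply: continuous_sum => J.
    under eq_fun do rewrite mulrC.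
    exact/continuous_scale/continuous_abs/cc.
  have : compact ((fun x => \sum_J `|c J x| * comass (@minor R m d J)) @` B).
    apply: continuous_compact; last exact: compact_norm_le.
    exact: continuous_subspaceT.
  move=> /compact_bounded [b0 [_ Hb0]]; exists (b0 + 1) => x Bx.
  apply: le_trans (ler_norm _) _; apply: (Hb0 (b0 + 1)); first by rewrite ltrDl.
  by exists x.
apply/integrableP; split; first exact/measurable_EFinP.
apply: (@le_lt_trans _ _ (\int[mu]_x ((fun x => `|b|%:E * (\1_B x)%:E) x))%E).
  apply: ae_ge0_le_integral => //.
  - exact/measurableT_comp/measurable_EFinP.
  - by apply: measurable_funeM; exact/measurable_EFinP/measurable_indic.
  - move: xi1; apply: (@filterS _ _ aeF) => x x1 _ /=.
    have [Bx|nBx] := pselect (B x).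
      rewrite indicE mem_set// mule1 lee_fin (congr1 (@^~ x) fE).
      apply: le_trans (ler_norm_sum _ _ _) _.
      apply: le_trans (ler_norm b); apply: le_trans (Hb x Bx).
      apply: ler_sum => J _; rewrite normrM ler_wpM2l//.
      exact/mvector_le/minor_covector.
    rewrite indicE memNset// mule0 (_ : psi x = fun=> 0) ?mvector0 ?normr0//.
    apply/funext => A; apply: Kpsi => Kx; apply: nBx.
    by apply: (KM (M + 1)) => //; rewrite ltrDl.
rewrite ge0_integralZl//; last first.
- exact/measurable_EFinP/measurable_indic.
rewrite integral_indic// setIT lte_mul_pinfty//.
by apply: muK; exact: compact_norm_le.
Qed.

Lemma polar_lin (a : R) psi chi : test_form psi -> test_form chi ->
  T (fun x A => a * psi x A + chi x A) = a * T psi + T chi.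
Proof.
move=> tp tc; have ip := polar_integrable tp; have ic := polar_integrable tc.
case: pol => _ xiV _ _ HT; rewrite !HT//; last exact: test_form_lin.
rewrite /restriction -RintegralZl// -RintegralD//.
  by apply: eq_Rintegral => x _; case: tp tc => cp _ _ [cc _ _]; rewrite xiV.
have := integrableZl measurableT a ip.
by congr (_.-integrable _ _).
Qed.

Lemma polar_mvector h : test_fun h -> mvector (fun w => T (fun x A => h x * w A)).
Proof.
move=> th a w z cw cz /=.
rewrite -polar_lin; try exact: test_form_mul.
by congr T; apply/funext => x; apply/funext => A; ring.
Qed.

(** By continuity [phi x] is e-close to [phi 0] on the support of [h]. Almost everywhere there,
    [xi x (phi 0)] >= [xi x (phi x)] - e = 1 - e >= (1 - e) [xi x psi], and this is integrated
    against [h]. *)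
Lemma polar_near (phi : diff_form R d m) (e : R) :
  (forall x, covector (phi x)) ->
  (forall A, continuous (fun x => phi x A : R^o)) ->
  {ae mu, forall x, xi x (phi x) = 1} -> 0 < e -> e < 1 ->
  exists2 delta, 0 < delta & forall h psi, test_fun h -> supp_le delta h ->
    (forall x, 0 <= h x) -> covector psi -> comass psi <= 1 ->
    (1 - e) * T (fun x A => h x * psi A) <= T (fun x A => h x * phi 0 A).
Proof.
move=> cphi phic phi1 e0 e1.
pose E (x : 'rV[R]_d) : R := \sum_(J : {ffun 'I_m -> 'I_d})
  `|(m`!)%:R^-1 * (phi x (rowsub J 1%:M) - phi 0 (rowsub J 1%:M))|
   * comass (@minor R m d J).
have E0 : E x @[x --> (0 : 'rV[R]_d)] --> (0 : R).
  rewrite [X in _ --> X](_ : 0 = E 0); last first.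
    by rewrite /E big1// => J _; rewrite subrr mulr0 normr0 mul0r.
  have : continuous E.
    apply: continuous_sum => J; under eq_fun do rewrite mulrC.
    apply/continuous_scale/continuous_abs.
    have := continuous_lin (a := 1) (phic (rowsub J 1%:M))
      (@cst_continuous _ _ (- phi 0 (rowsub J 1%:M))).
    under eq_fun do rewrite mul1r; exact: continuous_scale.
  by apply.
have /nbhs_ballP [delta /= d0 Hd] : \forall x \near (0 : 'rV[R]_d), E x < e.
  by move/cvgr_lt: E0; apply.
exists (delta / 2); first by rewrite divr_gt0.
move=> h psi th hd h0 cpsi psi1.
have tpsi := test_form_mul th cpsi; have tphi := test_form_mul th (cphi 0).
rewrite -subr_ge0 addrC -mulNr -polar_lin//.
case: (pol) => _ xiV mxi xi1 HT.
have tf : test_form (fun x A => - (1 - e) * (h x * psi A) + h x * phi 0 A).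
  have := test_form_mul th (covector_lin (- (1 - e)) 1 cpsi (cphi 0)).
  by congr test_form; apply/funext => x; apply/funext => A; ring.
have If := polar_integrable tf.
rewrite HT// /restriction /Rintegral fine_ge0//.
set f := (fun x => _) in If *.
have mf : measurable_fun setT (EFin \o f) by case/integrableP: If.
(* The integrand is nonnegative only almost everywhere; its positive part has the same integral and
   is nonnegative everywhere. *)
rewrite (@ae_eq_integral _ _ _ mu setT (fun x => maxe (f x)%:E 0%E))//.
- by apply: integral_ge0 => x _; rewrite le_max lexx orbT.
- by apply: measurable_maxe.
have := @filterI _ _ aeF _ _ xi1 phi1; apply: (@filterS _ _ aeF) => x [x1 x2] _.
apply/esym/max_idPl; rewrite /f lee_fin.
have [xd|dx] := leP `|x| (delta / 2); last first.
  rewrite (hd _ dx); under [X in xi x X]eq_fun do rewrite !mul0r mulr0 addr0.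
  by rewrite mvector0.
have -> : xi x (fun A => - (1 - e) * (h x * psi A) + h x * phi 0 A)
    = h x * (xi x (phi 0) - (1 - e) * xi x psi).
  have := (xiV x) (- (1 - e)) _ _ (covectorZ (h x) cpsi) (covectorZ (h x) (cphi 0)).
  by rewrite !mvectorZ//= => ->; ring.
rewrite mulr_ge0// subr_ge0.
apply: (@le_trans _ _ (1 - e)).
  by rewrite ler_piMr ?subr_ge0 ?(ltW e1)//; apply: mass_norm_ge.
have -> : phi 0 = fun A => (-1) * (phi x A - phi 0 A) + phi x A.
  by apply/funext => A; ring.
have cd : covector (fun A => phi x A - phi 0 A).
  have := covector_lin 1 (-1) (cphi x) (cphi 0).
  by under eq_fun do rewrite mul1r mulN1r.
rewrite (xiV x)// x2; suff : xi x (fun A => phi x A - phi 0 A) <= e by lra.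
apply: le_trans (ler_norm _) _; rewrite (mvector_minors (xiV x) cd).
apply: le_trans (ler_norm_sum _ _ _) _.
apply: (@le_trans _ _ (E x)).
  apply: ler_sum => J _; rewrite normrM ler_wpM2l//.
  exact/mvector_le/minor_covector.
apply/ltW/Hd; rewrite -ball_normE /= sub0r normrN (le_lt_trans xd)//.
by rewrite ltr_pdivrMr// ltr_pMr// ltr1n.
Qed.

End Decomposition.
End Polar.

(** * Blow-ups of cones *)

Section Blocks.
Context {R : realType}.

Lemma upd_col_mx (m n d : nat) (B : 'M[R]_(m, d)) (A : 'M[R]_(n, d)) i v :
  upd (col_mx B A) (rshift m i) v = col_mx B (upd A i v).
Proof.
apply/row_matrixP => a; rewrite -[a]splitK; case: (fintype.split a) => b /=.
  rewrite rowKu row_upd_neq ?rowKu// -val_eqE /= neq_ltn.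
  by rewrite (leq_trans (ltn_ord b)) ?leq_addr.
rewrite rowKd; have [->|bi] := eqVneq b i; first by rewrite !row_upd.
by rewrite !row_upd_neq ?rowKd// eq_rshift.
Qed.

Lemma upd_col_mxu (m n d : nat) (B : 'M[R]_(m, d)) (A : 'M[R]_(n, d)) i v :
  upd (col_mx A B) (lshift m i) v = col_mx (upd A i v) B.
Proof.
apply/row_matrixP => a; rewrite -[a]splitK; case: (fintype.split a) => b /=.
  rewrite rowKu; have [->|bi] := eqVneq b i; first by rewrite !row_upd.
  by rewrite !row_upd_neq ?rowKu// eq_lshift.
rewrite rowKd row_upd_neq ?rowKd// -val_eqE /= eq_sym neq_ltn.
by rewrite (leq_trans (ltn_ord i)) ?leq_addr.
Qed.

Lemma covector_col (m n d : nat) (w : 'M[R]_(m + n, d) -> R) (B : 'M[R]_(m, d)) :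
  covector w -> covector (fun A => w (col_mx B A)).
Proof.
move=> cw; apply: covector_intro => [A i b c u v|A i j ij Aij].
  by rewrite -!upd_col_mx covector_updP.
by apply: (cw.2 _ (rshift m i) (rshift m j)); rewrite ?eq_rshift ?rowKd.
Qed.

Lemma covector_colu (m n d : nat) (w : 'M[R]_(n + m, d) -> R) (B : 'M[R]_(m, d)) :
  covector w -> covector (fun A => w (col_mx A B)).
Proof.
move=> cw; apply: covector_intro => [A i b c u v|A i j ij Aij].
  by rewrite -!upd_col_mxu covector_updP.
by apply: (cw.2 _ (lshift m i) (lshift m j)); rewrite ?eq_lshift ?rowKu.
Qed.

Lemma covector_col_scale (m d : nat) (w : 'M[R]_(1 + m, d) -> R) (y : 'rV[R]_d) A t :
  covector w -> w (col_mx y (t *: A)) = t ^+ m * w (col_mx y A).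
Proof.
move=> cw.
have -> : col_mx y (t *: A) = block_mx 1%:M 0 0 t%:M *m col_mx y A.
  by rewrite mul_block_col mul1mx !mul0mx addr0 add0r mul_scalar_mx.
by rewrite covector_det// det_ublock det1 mul1r det_scalar.
Qed.

Lemma covector_head (m d : nat) (w : 'M[R]_(1 + m, d) -> R) (y : 'rV[R]_d) A :
  covector w -> w (col_mx y A) = \sum_j y 0 j * w (col_mx (delta_mx 0 j) A).
Proof.
move=> cw; have H := @covector_upd_sum _ _ _ _ (covector_colu A cw) 0 ord0
  _ (fun j => y 0 j) (fun j => delta_mx 0 j).
rewrite -row_sum_delta in H.
have E v : upd (0 : 'M[R]_(1, d)) 0 v = v.
  by apply/rowP => j; rewrite mxE eqxx.
by rewrite -[in LHS](E y) H; under eq_bigr do rewrite E.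
Qed.

Lemma covector_blockr (m1 m2 d1 d2 : nat) (w : 'M[R]_(m1 + m2, d1 + d2) -> R)
    (A : 'M[R]_(m1, d1)) : covector w -> covector (fun B => w (block_mx A 0 0 B)).
Proof.
move=> cw; have := covector_mulr (row_mx (0 : 'M[R]_(d2, d1)) 1%:M)
  (covector_col (row_mx A 0) cw).
congr covector; apply/funext => B; congr w.
by rewrite mul_mx_row mulmx0 mulmx1.
Qed.

Lemma covector_blockl (m1 m2 d1 d2 : nat) (w : 'M[R]_(m1 + m2, d1 + d2) -> R)
    (B : 'M[R]_(m2, d2)) : covector w -> covector (fun A => w (block_mx A 0 0 B)).
Proof.
move=> cw; have := covector_mulr (row_mx 1%:M (0 : 'M[R]_(d1, d2)))
  (covector_colu (row_mx 0 B) cw).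
congr covector; apply/funext => A; congr w.
by rewrite mul_mx_row mulmx0 mulmx1.
Qed.

(** The exterior product of two m-vectors in complementary subspaces, written as the iterated
    evaluation that also defines [product_current]. *)
Definition tens (d1 d2 m1 m2 : nat) (X : ('M[R]_(m1, d1) -> R) -> R)
    (Y : ('M[R]_(m2, d2) -> R) -> R) (w : 'M[R]_(m1 + m2, d1 + d2) -> R) : R :=
  X (fun A => Y (fun B => w (block_mx A 0 0 B))).

Lemma covector_contract (d1 d2 m1 m2 : nat) (Y : ('M[R]_(m2, d2) -> R) -> R) 
    (w : 'M[R]_(m1 + m2, d1 + d2) -> R) : mvector Y -> covector w ->
  covector (fun A => Y (fun B => w (block_mx A 0 0 B))).
Proof.
move=> YV cw; have cr := fun A => covector_blockr A cw.
have cl := fun B => covector_blockl B cw.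
apply: covector_intro => [A i b c u v|A i j ij Aij].
  rewrite -[c * _](mvectorZ YV)// -YV//; last exact: covectorZ.
  by congr Y; apply/funext => B; rewrite (covector_updP (cl B)).
rewrite -[RHS](mvector0 YV); congr Y; apply/funext => B.
exact: ((cl B).2 _ _ _ ij).
Qed.

Lemma tens_mvector (d1 d2 m1 m2 : nat) (X : ('M[R]_(m1, d1) -> R) -> R)
    (Y : ('M[R]_(m2, d2) -> R) -> R) :
  mvector X -> mvector Y -> mvector (tens X Y).
Proof.
move=> XV YV a w z cw cz.
rewrite /tens -(XV a _ _ (covector_contract YV cw) (covector_contract YV cz)).
congr X; apply/funext => A.
exact: (YV a _ _ (covector_blockr A cw) (covector_blockr A cz)).
Qed.

End Blocks.

Section Cones.
Context {R : realType}.

Lemma test_form0 (d m : nat) : test_form (fun (_ : 'rV[R]_d) (_ : 'M[R]_(m, d)) => 0 : R).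
Proof.
split=> [x|A|]; [exact: covector0|exact: (smooth_cst 0)|].
by exists set0; split; [exact: compact0|].
Qed.

Lemma currentZ (d m : nat) (T : functional R d m) a psi : is_current T ->
  test_form psi -> T (fun x A => a * psi x A) = a * T psi.
Proof.
move=> [Tlin _] tp; have T0 : T (fun _ _ => 0) = 0.
  have := Tlin 1 _ _ (@test_form0 d m) (@test_form0 d m).
  have -> : (fun (x : 'rV[R]_d) (A : 'M[R]_(m, d)) => 1 * 0 + 0 : R) = fun _ _ => 0.
    by apply/funext => x; apply/funext => A; rewrite mulr0 addr0.
  by rewrite mul1r => /eqP; rewrite -subr_eq subrr eq_sym => /eqP.
have := Tlin a _ _ tp (@test_form0 d m); rewrite T0 addr0 => <-.
by congr T; apply/funext => x; apply/funext => A; rewrite addr0.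
Qed.

Lemma test_fun_dilation (d : nat) (h : 'rV[R]_d -> R) r : 0 < r ->
  test_fun h -> test_fun (fun x => h (r *: x)).
Proof.
move=> r0 [sh [M hM]]; split; first exact: smooth_dilation.
exists (M / r) => x; rewrite ltr_pdivrMr// => Mx; apply: hM.
by rewrite normrZ gtr0_norm// mulrC.
Qed.

Lemma test_form_cone (d m : nat) (h : 'rV[R]_d -> R) (w : 'M[R]_(1 + m, d) -> R) t :
  0 < t -> test_fun h -> covector w ->
  test_form (fun y A => h (t *: y) * w (col_mx y (t *: A))).
Proof.
move=> t0 th cw; have [sh [M hM]] := test_fun_dilation t0 th.
split=> [x|A|].
- apply: covectorZ; have := covectorZ (t ^+ m) (covector_col x cw).
  by congr covector; apply/funext => A; rewrite covector_col_scale.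
- have sl : smooth (fun y : 'rV[R]_d => w (col_mx y (t *: A))).
    under eq_fun do rewrite covector_head//.
    apply: smooth_sum => j.
    exact: (smoothM (smooth_coord j) (smooth_cst (w (col_mx (delta_mx 0 j) (t *: A))))).
  exact: (smoothM sh sl).
- exists [set y | `|y| <= M]; split; first exact: compact_norm_le.
  move=> x xM A; rewrite hM ?mul0r// ltNge; exact/negP.
Qed.

(** After the substitution t -> r t, the m rows scaled by t contribute r^m and the measure dt
    contributes the remaining factor r. *)
Lemma cone_current_rescale (d m : nat) (L : functional R d m)
    (h : 'rV[R]_d -> R) (w : 'M[R]_(1 + m, d) -> R) r : 0 < r -> is_current L ->
  test_fun h -> covector w ->
  cone_current L (fun x A => h (r^-1 *: x) * w A)
    = r ^+ m.+1 * cone_current L (fun x A => h x * w A).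
Proof.
move=> r0 cL th cw; rewrite /cone_current exprSr.
rewrite -Rintegral_rescale ?exprn_gt0//.
apply: eq_Rintegral => t; rewrite inE /= in_itv /= andbT => t0.
rewrite -currentZ//; last by apply: test_form_cone => //; rewrite divr_gt0.
congr L; apply/funext => y; apply/funext => A.
rewrite scalerA [r^-1 * t]mulrC mulrCA; congr (_ * _).
by rewrite -covector_col_scale// scalerA mulrCA divff ?gt_eqF// mulr1.
Qed.

End Cones.

(* The dilation identity, which cones satisfy, allows one to shrink the supports
   of the [h j] to the origin. *)
Definition blowup (R : realType) (d m : nat) (T : functional R d m)
    (X : ('M[R]_(m, d) -> R) -> R) : Prop :=
  exists h : nat -> 'rV[R]_d -> R,
  [/\ forall j, test_fun (h j) /\ forall x, 0 <= h j x,
      forall j, mvector (fun w => T (fun x A => h j x * w A)),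
      forall j r w, 0 < r -> covector w ->
        T (fun x A => h j (r^-1 *: x) * w A) = r ^+ m * T (fun x A => h j x * w A),
      mvector X &
      forall w, covector w -> T (fun x A => h j x * w A) @[j --> \oo] --> X w].

Section Blowups.
Context {R : realType}.

Lemma test_fun_tens (d1 d2 : nat) (h : 'rV[R]_d1 -> R) (k : 'rV[R]_d2 -> R) :
  test_fun h -> test_fun k ->
  test_fun (fun z : 'rV[R]_(d1 + d2) => h (lsubmx z) * k (rsubmx z)).
Proof.
move=> [sh [M hM]] [sk [N kN]]; split.
  have := smoothM (smooth_mulmx (col_mx 1%:M 0) sh) (smooth_mulmx (col_mx 0 1%:M) sk).
  congr smooth; apply/funext => z; rewrite -{1 2}[z]hsubmxK !mul_row_col.
  by rewrite !mulmx0 !mulmx1 addr0 add0r.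
exists (Num.max M N) => z; rewrite gt_max => /andP[Mz Nz].
have [lM|lM] := ltP M `|lsubmx z|; first by rewrite hM ?mul0r.
have [rN|rN] := ltP N `|rsubmx z|; first by rewrite kN ?mulr0.
exfalso; have : `|z| <= Num.max M N; last by rewrite leNgt gt_max Mz Nz.
apply: norm_le_coord => [|i j].
  by rewrite le_max (le_trans _ lM).
rewrite -[z]hsubmxK mxE; case: (fintype.split j) => l.
  by rewrite le_max (le_trans _ lM)// coord_le_norm.
by rewrite le_max (le_trans _ rN) ?orbT// coord_le_norm.
Qed.

Lemma blowup_product (d1 d2 m1 m2 : nat) (S : functional R d1 m1)
    (T : functional R d2 m2) X Y :
  blowup S X -> blowup T Y -> blowup (product_current S T) (tens X Y).
Proof.
move=> [h [h1 h2 h3 h4 h5]] [k [k1 k2 k3 k4 k5]].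
exists (fun j z => h j (lsubmx z) * k j (rsubmx z)).
have E j w : covector w -> product_current S T
    (fun z A => h j (lsubmx z) * k j (rsubmx z) * w A)
  = tens (fun w => S (fun x A => h j x * w A)) (fun w => T (fun x A => k j x * w A)) w.
  move=> cw; rewrite /product_current /tens; congr S.
  apply/funext => x; apply/funext => A.
  have cwA := covector_blockr A cw.
  rewrite -(mvectorZ (k2 j))//; congr T.
  by apply/funext => y; apply/funext => B; rewrite row_mxKl row_mxKr; ring.
split.
- by move=> j; split=> [|x]; [apply: test_fun_tens; [case: (h1 j)|case: (k1 j)]|
    apply: mulr_ge0; [case: (h1 j)|case: (k1 j)]].
- move=> j a w z cw cz /=; rewrite !E//; first exact: tens_mvector.
  by have := covector_lin a 1 cw cz; under eq_fun do rewrite mul1r.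
- move=> j r w r0 cw; rewrite E// /product_current /tens.
  have -> : (fun x A => T (fun y B => h j (lsubmx (r^-1 *: row_mx x y)) *
       k j (rsubmx (r^-1 *: row_mx x y)) * w (block_mx A 0 0 B)))
    = (fun x A => h j (r^-1 *: x) *
        (r ^+ m2 * T (fun y B => k j y * w (block_mx A 0 0 B)))).
    apply/funext => x; apply/funext => A; have cwA := covector_blockr A cw.
    rewrite mulrCA -(mvectorZ (k2 j))// -k3//; last exact: covectorZ.
    congr T; apply/funext => y; apply/funext => B.
    by rewrite scale_row_mx row_mxKl row_mxKr; ring.
  have cc := covector_contract (k2 j) cw.
  rewrite h3//; last exact: covectorZ.
  by rewrite (mvectorZ (h2 j) _ cc) exprD mulrA.
- exact: tens_mvector.
- move=> w cw; under eq_fun do rewrite E//.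
  (* Both the outer and the inner functional depend on [j]. Expanding the outer one in minors leaves
     a finite sum of products of two convergent sequences. *)
  have -> : tens X Y w = _ := mvector_minors h4 (covector_contract k4 cw).
  rewrite (funext (fun j : nat => mvector_minors (h2 j) (covector_contract (k2 j) cw)
    : tens _ _ w = _)).
  apply: cvg_sum => J; apply: cvgM; last by apply: h5; exact: minor_covector.
  by apply: cvgM; [exact: cvg_cst|apply: k5; exact: covector_blockr].
Qed.

End Blowups.

Section ConeOfNormal.
Context {R : realType}.

Lemma dotp_ge0 (d : nat) (x : 'rV[R]_d) : 0 <= dotp x x.
Proof. by apply: sumr_ge0 => i _; rewrite -expr2 sqr_ge0. Qed.

Lemma dotp_le_norm (d : nat) (x : 'rV[R]_d) : dotp x x <= d%:R * `|x| ^+ 2.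
Proof.
rewrite /dotp (le_trans (y := \sum_(i < d) `|x| ^+ 2))//.
  apply: ler_sum => i _; rewrite -expr2 -real_normK ?num_real//.
  by rewrite ler_pXn2r ?nnegrE// coord_le_norm.
by rewrite sumr_const card_ord mulr_natl.
Qed.

Lemma norm_sqr_le_dotp (d : nat) (x : 'rV[R]_d) : `|x| ^+ 2 <= dotp x x.
Proof.
have sq i : `|x 0 i| ^+ 2 <= dotp x x.
  rewrite real_normK ?num_real// /dotp (bigD1 i)//= expr2 lerDl.
  by apply: sumr_ge0 => j _; rewrite -expr2 sqr_ge0.
rewrite -(sqr_sqrtr (dotp_ge0 x)) ler_pXn2r ?nnegrE ?sqrtr_ge0//.
apply: norm_le_coord => [|i j]; first exact: sqrtr_ge0.
rewrite ord1 -(@ler_pXn2r _ 2) ?nnegrE ?sqrtr_ge0// sqr_sqrtr ?dotp_ge0//.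
Qed.

Lemma bump_test_fun (d : nat) (p : 'rV[R]_d) rho : 0 <= rho -> test_fun (bump p rho).
Proof.
move=> rho0; split; first exact: bump_smooth.
exists (`|p| + rho) => x Hx; apply/eqP; rewrite eq_le bump_ge0 andbT leNgt bump_gt0.
rewrite -leNgt; apply: le_trans (norm_sqr_le_dotp _).
rewrite ler_pXn2r ?nnegrE//.
have := ler_normD (x - p) p; rewrite subrK => H.
by have := lt_le_trans Hx H; rewrite addrC ltrD2r => /ltW.
Qed.

Lemma test_funD (d : nat) (h k : 'rV[R]_d -> R) :
  test_fun h -> test_fun k -> test_fun (fun x => h x + k x).
Proof.
move=> [sh [M hM]] [sk [N kN]]; split; first exact: smoothD.
by exists (Num.max M N) => x; rewrite gt_max => /andP[/hM -> /kN ->]; rewrite addr0.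
Qed.

Lemma test_funZ (d : nat) c (h : 'rV[R]_d -> R) :
  test_fun h -> test_fun (fun x => c * h x).
Proof.
move=> [sh [M hM]]; split; first exact: smoothZ.
by exists M => x /hM ->; rewrite mulr0.
Qed.

Lemma test_fun_dominated (d : nat) (h : 'rV[R]_d -> R) : test_fun h ->
  exists2 k : 'rV[R]_d -> R, test_fun k & forall x, `|h x| <= k x.
Proof.
move=> [sh [M hM]].
pose M1 := Num.max M 1.
have cA := @compact_norm_le R d M1.
have : compact (h @` [set y : 'rV[R]_d | `|y| <= M1]).
  apply: continuous_compact cA; apply: continuous_subspaceT.
  exact: smooth_continuous.
move=> /compact_bounded [b0 [_ Hb0]].
pose b := Num.max (b0 + 1) 0.
have hb x : `|x| <= M1 -> `|h x| <= b.
  move=> Hx; apply: (Hb0 b) => //=; last by exists x.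
  by rewrite lt_max ltrDl ltr01.
(* On the ball of radius [M1] this gives [rho ^+ 2] >= [rho] >= 1 + [dotp x x], so the bump is at
   least exp(-1) there; the factor [expR 1] compensates for it. *)
pose rho : R := d%:R * M1 ^+ 2 + 1.
have rho1 : 1 <= rho by rewrite lerDr mulr_ge0// sqr_ge0.
exists (fun x => b * expR 1 * bump 0 rho x).
  by apply/test_funZ/bump_test_fun; apply: le_trans rho1.
move=> x; have b0' : 0 <= b by rewrite le_max lexx orbT.
have [Hx|Hx] := leP `|x| M1; last first.
  rewrite hM ?normr0; last by apply: le_lt_trans Hx; rewrite le_max lexx.
  by rewrite !mulr_ge0 ?expR_ge0 ?bump_ge0.
apply: le_trans (hb x Hx) _; rewrite -mulrA ler_peMr//.
rewrite /bump /flat subr0 hornerC mul1r.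
have H1 : 1 <= rho ^+ 2 - dotp x x.
  have dx : dotp x x <= d%:R * M1 ^+ 2.
    apply: le_trans (dotp_le_norm x) _; rewrite ler_wpM2l//.
    by rewrite ler_pXn2r ?nnegrE// le_max ler01 orbT.
  have : rho <= rho ^+ 2 by rewrite expr2 ler_peMr// (le_trans _ rho1).
  rewrite {1}/rho; lra.
rewrite (lt_le_trans ltr01 H1) -expRD -[leLHS]expR0 ler_expR subr_ge0.
by rewrite invf_le1// (lt_le_trans ltr01 H1).
Qed.

Lemma test_form_coef (d m : nat) (psi : diff_form R d m) A : test_form psi ->
  test_fun (fun x => psi x A).
Proof.
move=> [_ sp [K [cK Kp]]]; split; first exact: sp.
have [M [_ KM]] := compact_bounded cK; exists (M + 1) => x Mx.
apply: Kp => Kx; have := KM (M + 1); rewrite ltrDl ltr01 => /(_ isT x Kx) /=.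
by rewrite leNgt Mx.
Qed.

(** A test form is a finite sum of functions times minors, so [T] does not vanish on one of the
    terms. The coefficient is then made nonnegative by writing it as a difference of two nonnegative
    test functions. *)
Lemma polar_nonzero (d m : nat) (T : functional R d m) mu xi psi :
  polar_decomposition T mu xi -> test_form psi -> T psi <> 0 ->
  exists (h : 'rV[R]_d -> R) (J : {ffun 'I_m -> 'I_d}),
    [/\ test_fun h, forall x, 0 <= h x & T (fun x A => h x * minor J A) != 0].
Proof.
move=> pol tp Tp.
have [h [J [th Th]]] : exists (h : 'rV[R]_d -> R) (J : {ffun 'I_m -> 'I_d}),
    test_fun h /\ T (fun x A => h x * minor J A) != 0.
  apply: contrapT => H; apply: Tp.
  have T0 : T (fun _ _ => 0) = 0.
    have t0 := @test_form0 R d m; have := polar_lin pol 1 t0 t0.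
    have -> : (fun (x : 'rV[R]_d) (A : 'M[R]_(m, d)) => 1 * 0 + 0 : R) = fun _ _ => 0.
      by apply/funext => x; apply/funext => A; rewrite mulr0 addr0.
    by rewrite mul1r => /eqP; rewrite -subr_eq subrr eq_sym => /eqP.
  have -> : psi = fun x A => \sum_(J : {ffun 'I_m -> 'I_d}) ((m`!)%:R^-1 * psi x (rowsub J 1%:M)) * minor J A.
    apply/funext => x; apply/funext => A.
    have m0 : (m`!)%:R != 0 :> R by rewrite pnatr_eq0 -lt0n fact_gt0.
    rewrite -[LHS](mulKf m0) covector_minors; last by case: tp.
    by rewrite mulr_sumr; apply: eq_bigr => J _; rewrite mulrA.
  pose S (s : seq {ffun 'I_m -> 'I_d}) := fun (x : 'rV[R]_d) A => \sum_(J <- s) ((m`!)%:R^-1 *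
    psi x (rowsub (J : {ffun 'I_m -> 'I_d}) 1%:M)) * minor J A.
  suff : forall s, test_form (S s) /\ T (S s) = 0.
    by move/(_ (index_enum _)) => [].
  elim=> [|J s [tS TS]]; rewrite /S.
    have -> : (fun (x : 'rV[R]_d) A => \sum_(J <- [::]) ((m`!)%:R^-1 *
      psi x (rowsub (J : {ffun 'I_m -> 'I_d}) 1%:M)) * minor J A) = fun _ _ => 0.
      by apply/funext => x; apply/funext => A; rewrite big_nil.
    by split=> //; exact: test_form0.
  pose g x := (m`!)%:R^-1 * psi x (rowsub J 1%:M).
  have tg : test_fun g by apply/test_funZ/test_form_coef.
  have tJ := test_form_mul tg (minor_covector J).
  have -> : (fun (x : 'rV[R]_d) A => \sum_(J <- J :: s) ((m`!)%:R^-1 *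
      psi x (rowsub (J : {ffun 'I_m -> 'I_d}) 1%:M)) * minor J A)
      = fun x A => 1 * (g x * minor J A) + S s x A.
    by apply/funext => x; apply/funext => A; rewrite big_cons mul1r.
  split; first exact: test_form_lin.
  rewrite (polar_lin pol)// TS addr0 mul1r.
  apply/eqP/negPn/negP => H1; apply: H.
  by exists g, J.
(* With [k] dominating the absolute value of [h], one has h = (h + k) - k, so [T] is nonzero for [k]
   or for h + k. *)
have [k tk hk] := test_fun_dominated th.
have tkJ := test_form_mul tk (minor_covector J).
have thk := test_funD th tk; have thkJ := test_form_mul thk (minor_covector J).
have [k0|k0] := eqVneq (T (fun x A => k x * minor J A)) 0; last first.
  by exists k, J; split=> // x; apply: le_trans (hk x).
exists (fun x => h x + k x), J; split=> // [x|].
  by have := hk x; rewrite ler_norml -subr_ge0 opprK addrC => /andP[].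
apply: contraNneq Th => hk0; apply/eqP.
have := polar_lin pol (-1) tkJ thkJ; rewrite k0 hk0 mulr0 addr0 => <-.
by congr T; apply/funext => x; apply/funext => A; ring.
Qed.

(** No regular point of the cone is available here, so the sequence of weights is constant.
    Homogeneity of the cone supplies the dilation identity, and only one nonzero coordinate of [X]
    is required. *)
Lemma cone_blowup (d m : nat) (L : functional R d m) mu xi : is_current L ->
  polar_decomposition (cone_current L) mu xi -> nonzero_current (cone_current L) ->
  exists X (J : {ffun 'I_m.+1 -> 'I_d}), blowup (cone_current L) X /\ X (minor J) != 0.
Proof.
move=> cL pol [psi [tp Tp]].
have [h [J [th h0 hJ]]] := polar_nonzero pol tp Tp.
exists (fun w => cone_current L (fun x A => h x * w A)), J; split=> //.
have mv := polar_mvector pol th.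
exists (fun=> h); split=> // [j r w r0 cw|w cw].
  exact: cone_current_rescale.
exact: cvg_cst.
Qed.

End ConeOfNormal.

(** * Charts of the link *)

Section Charts.
Context {R : realType}.
Variables (d k : nat) (B : set 'rV[R]_d) (V : set 'rV[R]_k) (U : set 'rV[R]_d).
Variables (f : 'rV[R]_k -> 'rV[R]_d).
Hypothesis k_gt0 : (0 < k)%N.
Hypothesis chart : local_param B V U f.

(* Where [f] is not differentiable, ['d f u] is the default linear map [0]. *)
Lemma chart_differentiable u : V u -> differentiable f u.
Proof.
move=> Vu; case: chart => _ _ /(_ u Vu) + _ _.
apply: contraPP => nd; rewrite /jacobian /diff.
set P := (fun df => _); have [H|H] := pselect (exists df, P df).
  have := getPex H; set df := get P => -[H1 H2].
  by exfalso; apply: nd; apply/diffP; split.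
rewrite (getPN (P := P)); last by move=> df Pdf; apply: H; exists df.
move=> /eqP.
rewrite (_ : lin1_mx _ = 0) ?mxrank0; last first.
  by apply/matrixP => i j; rewrite !mxE.
by move=> k0; move: k_gt0; rewrite -k0.
Qed.

Lemma chart_row u i : V u -> row i ('J f u) = 'D_(delta_mx 0 i) f u.
Proof.
by move=> Vu; rewrite deriveEjacobian ?rowE//; exact: chart_differentiable.
Qed.

Lemma chart_open : open V.
Proof. by case: chart => -[]. Qed.

Lemma chart_cvg u : V u -> f x @[x --> u] --> f u.
Proof. by move=> Vu; case: chart => _ /(_ [::] u Vu) []. Qed.

Lemma chart_jacobian_cvg u : V u -> 'J f x @[x --> u] --> 'J f u.
Proof.
move=> Vu; apply/mx_cvg_nbhsP => i j.
have : 'D_(delta_mx 0 i) f x 0 j @[x --> u] --> 'D_(delta_mx 0 i) f u 0 j.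
  case: chart => _ /(_ [:: delta_mx 0 i] u Vu) [c _] _ _ _.
  by have /mx_cvg_nbhsP/(_ 0 j) := c.
rewrite -chart_row// mxE; apply: cvg_nbhs_near_eq.
have := open_nbhs_nbhs (conj chart_open Vu); apply: filterS => x Vx.
by rewrite -chart_row// mxE.
Qed.

Lemma chart_in u : V u -> B (f u) /\ U (f u).
Proof.
move=> Vu; have : (f @` V) (f u) by exists u.
by case: chart => _ _ _ -> _.
Qed.

(** Embeddedness enters here: by continuity of the inverse chart, points of the chart close in the
    ambient space have close parameters. *)
Lemma chart_inverse_near (phi : 'rV[R]_k -> R) u0 e :
  V u0 -> phi u @[u --> u0] --> phi u0 -> 0 < e ->
  exists2 delta, 0 < delta & forall u, V u -> `|f u - f u0| <= delta ->
    `|phi u - phi u0| <= e.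
Proof.
move=> Vu0 cphi e0; case: (chart) => _ _ _ imf [g [cg gf]].
have BU : (B `&` U) (f u0) by exact: chart_in.
have cgp : g y @[y --> within (B `&` U) (nbhs (f u0))] --> u0.
  by rewrite (nbhs_subspace_in BU) -[X in _ --> X](gf u0)//; exact: cg.
have cpg : phi (g y) @[y --> within (B `&` U) (nbhs (f u0))] --> phi u0.
  exact: (cvg_comp g phi cgp cphi).
have : \forall y \near within (B `&` U) (nbhs (f u0)), `|phi u0 - phi (g y)| <= e.
  by move/cvgrPdist_le: cpg; apply.
move=> /nbhs_ballP[delta /= d0 Hd]; exists (delta / 2); first by rewrite divr_gt0.
move=> u Vu fu; rewrite distrC -(gf u)//; apply: Hd; last exact: chart_in.
rewrite -ball_normE /= distrC (le_lt_trans fu)//.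
by rewrite ltr_pdivrMr// ltr_pMr// ltr1n.
Qed.

End Charts.
Lemma continuous_dist (R : realType) (W : normedModType R) (p : W) :
  continuous (fun y => `|y - p|).
Proof.
move=> y; have ci : (fun z => z) @ y --> y by exact: cvg_id.
have cp : (fun=> p) @ y --> p by exact: cvg_cst.
exact: (cvg_norm (cvgB ci cp)).
Qed.

Section Dot.
Context {R : realType} {d : nat}.
Implicit Types x y z : 'rV[R]_d.

Lemma dotpC x y : dotp x y = dotp y x.
Proof. by apply: eq_bigr => i _; rewrite mulrC. Qed.

Lemma dotpDl x y z : dotp (x + y) z = dotp x z + dotp y z.
Proof. by rewrite -big_split; apply: eq_bigr => i _ /=; rewrite mxE mulrDl. Qed.

Lemma dotpZl a x z : dotp (a *: x) z = a * dotp x z.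
Proof. by rewrite /dotp mulr_sumr; apply: eq_bigr => i _ /=; rewrite mxE mulrA. Qed.

Lemma dotpDr x y z : dotp z (x + y) = dotp z x + dotp z y.
Proof. by rewrite !(dotpC z) dotpDl. Qed.

Lemma dotpZr a x z : dotp z (a *: x) = a * dotp z x.
Proof. by rewrite !(dotpC z) dotpZl. Qed.

Lemma dotpNl x z : dotp (- x) z = - dotp x z.
Proof. by rewrite -scaleN1r dotpZl mulN1r. Qed.

Lemma dotpNr x z : dotp z (- x) = - dotp z x.
Proof. by rewrite !(dotpC z) dotpNl. Qed.

Lemma dotp_norm_le x r : 0 <= r -> dotp x x <= r ^+ 2 -> `|x| <= r.
Proof.
move=> r0 H; rewrite -(@ler_pXn2r _ 2) ?nnegrE//.
exact: le_trans (norm_sqr_le_dotp x) H.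
Qed.

(** For unit vectors, t^2 - 2 t <y, p> + 1 >= (t - 1)^2. *)
Lemma dotp_sphere_dist (p y : 'rV[R]_d) t r : dotp p p = 1 -> dotp y y = 1 ->
  0 <= t -> 0 <= r -> dotp (t *: y - p) (t *: y - p) <= r ^+ 2 -> `|t - 1| <= r.
Proof.
move=> p1 y1 t0 r0 H; rewrite -(@ler_pXn2r _ 2) ?nnegrE// real_normK ?num_real//.
apply: le_trans H; have := dotp_ge0 (y - p).
rewrite !(dotpDl, dotpDr, dotpNl, dotpNr, dotpZl, dotpZr) p1 y1 (dotpC p y) => H.
have H1 : dotp y p <= 1 by lra.
have : t * dotp y p <= t * 1 by rewrite ler_wpM2l.
by rewrite expr2; lra.
Qed.

(** The vector t (y - p) differs from t y - p by (t - 1) p, so its norm is at most 2 r; dividing by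
    t >= 1/2 gives 4 r. The constants 1/2 and 4 reappear in all localizations below. *)
Lemma dotp_cone_dist (p y : 'rV[R]_d) t r : dotp p p = 1 -> 0 <= r -> r <= 2^-1 ->
  `|t - 1| <= r -> dotp (t *: y - p) (t *: y - p) <= r ^+ 2 -> `|y - p| <= 4 * r.
Proof.
move=> p1 r0 r1 tr /(dotp_norm_le r0) H.
have pn : `|p| <= 1 by apply: dotp_norm_le => //; rewrite p1 expr1n.
have t2 : 2^-1 <= t by move: tr; rewrite ler_norml => /andP[]; lra.
have t0 : 0 < t by apply: lt_le_trans t2; rewrite invr_gt0.
have E : t *: (y - p) = (t *: y - p) - (t - 1) *: p.
  by rewrite scalerBr scalerBl scale1r opprB addrA addrNK.
have : `|t *: (y - p)| <= r + r.
  rewrite E (le_trans (ler_normB _ _))// lerD// normrZ.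
  by apply: le_trans tr; rewrite ler_piMr.
rewrite normrZ gtr0_norm// => H2.
have : 2^-1 * `|y - p| <= t * `|y - p| by rewrite ler_wpM2r.
lra.
Qed.

Lemma mulmx_tr_dotp x : x *m x^T = (dotp x x)%:M.
Proof.
apply/matrixP => a b; rewrite !ord1 [LHS]mxE [RHS]mxE eqxx mulr1n.
by apply: eq_bigr => j _; rewrite mxE.
Qed.

End Dot.

(** * The integrand of the cone current near a regular point *)

Section RegularPoint.
Context {R : realType}.
Variables (d k : nat) (B : set 'rV[R]_d) (V : set 'rV[R]_k) (U : set 'rV[R]_d).
Variables (f : 'rV[R]_k -> 'rV[R]_d) (u0 : 'rV[R]_k).
Hypothesis k_gt0 : (0 < k)%N.
Hypothesis chart : local_param B V U f.
Hypothesis Vu0 : V u0.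
Hypothesis B_sphere : B `<=` @unit_sphere R d.
Hypothesis B_closed : closed B.

Let p := f u0.

(** As [B] is closed, its part in a closed ball inside [U] is compact, and so is the image under the
    inverse chart. This keeps the localized densities away from the boundary of [V]. *)
Lemma chart_core r : [set y | `|y - p| <= r] `<=` U ->
  exists Kc : set 'rV[R]_k, [/\ compact Kc, Kc `<=` V &
    forall u, V u -> `|f u - p| <= r -> Kc u].
Proof.
move=> rU; case: (chart) => _ _ _ imf [g [cg gf]].
pose A := B `&` [set y | `|y - p| <= r].
have cA : compact A.
  apply: bounded_closed_compact.
    exists (r + `|p|); split; first exact: num_real.
    move=> z Mz y [_ /= yr]; apply: ltW; apply: le_lt_trans Mz.
    by rewrite -[y](subrK p) (le_trans (ler_normD _ _))// lerD2r.
  apply: closedI => //.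
  have H : {in ~` ((fun y : 'rV[R]_d => `|y - p|) @^-1` [set s | s <= r]),
      continuous (fun y : 'rV[R]_d => `|y - p|)}.
    by move=> y _; exact: continuous_dist.
  exact: (preimage_closed H (@closed_le _ r)).
have AV : forall y, A y -> exists2 u, V u & f u = y.
  move=> y [By yr]; have : (B `&` U) y by split=> //; exact: rU.
  by rewrite -imf => -[u Vu <-]; exists u.
exists (g @` A); split.
- apply: continuous_compact cA; apply: continuous_subspaceW cg.
  by move=> y [By yr]; split=> //; exact: rU.
- by move=> _ [y Ay <-]; have [u Vu <-] := AV y Ay; rewrite gf.
- move=> u Vu fu; exists (f u); last exact: (gf u Vu).
  by split=> //; have [] := chart_in chart Vu.
Qed.

Definition tangent_value (w : 'M[R]_(1 + k, d) -> R) (u : 'rV[R]_k) : R :=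
  w (col_mx (f u) ('J f u)).

Lemma tangent_value_cvg w u : covector w -> V u ->
  tangent_value w x @[x --> u] --> tangent_value w u.
Proof.
move=> cw Vu; apply: (@covector_cvg_nbhs R _ _ w _ u
  (fun x => col_mx (f x) ('J f x)) (col_mx (f u) ('J f u)) cw).
exact: (col_mx_cvg (chart_cvg chart Vu) (chart_jacobian_cvg k_gt0 chart Vu)).
Qed.

(* The integrand of [cone_current] in the coordinates [(t, u)], for the form
   whose value at [(f u, 'J f u)] is [h (t *: f u) * q u]; the truncation of [t]
   at [0] extends it continuously to the whole space. *)
Definition density (h : 'rV[R]_d -> R) (q : 'rV[R]_k -> R)
    (x : 'rV[R]_(1 + k)) : R :=
  let t := Num.max (x 0 0) 0 in
  ((fun u => t ^+ k * h (t *: f u) * q u) \_ V) (rsubmx x).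

Section Localized.
Variables (h : 'rV[R]_d -> R) (rho : R).
Hypothesis th : test_fun h.
Hypothesis rho0 : 0 < rho.
Hypothesis rho1 : rho <= 2^-1.
Hypothesis h_supp : forall x, h x != 0 -> dotp (x - p) (x - p) <= rho ^+ 2.
Hypothesis rhoU : [set y | `|y - p| <= 4 * rho] `<=` U.

Let p1 : dotp p p = 1.
Proof. by apply: B_sphere; case: (chart_in chart Vu0). Qed.

Lemma localized_near t u : 0 <= t -> V u -> h (t *: f u) != 0 ->
  `|t - 1| <= rho /\ `|f u - p| <= 4 * rho.
Proof.
move=> t0 Vu /h_supp H; have u1 : dotp (f u) (f u) = 1.
  by apply: B_sphere; case: (chart_in chart Vu).
have tr := dotp_sphere_dist p1 u1 t0 (ltW rho0) H.
by split=> //; apply: dotp_cone_dist H => //; exact: ltW.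
Qed.

Lemma density_supp q : exists M, supp_le M (density h q).
Proof.
have [Kc [cK KV HK]] := chart_core rhoU.
have [M [_ KM]] := compact_bounded cK.
(* On the support t <= 1 + [rho] <= 3/2, while the parameter stays in the compact set [Kc], bounded
   by M + 1. *)
exists (Num.max (M + 1) 2) => x; rewrite gt_max => /andP[xM x2].
rewrite /density; set t := Num.max _ _; set u := rsubmx _.
rewrite /patch; case: ifPn => // /set_mem Vu.
have t0 : 0 <= t by rewrite le_max lexx orbT.
have [->|h0] := eqVneq (h (t *: f u)) 0; first by rewrite mulr0 mul0r.
have [tr fu] := localized_near t0 Vu h0.
have tp : 0 < t by move: tr; rewrite ler_norml => /andP[]; move: rho1; lra.
exfalso; have : `|x| <= Num.max (M + 1) 2; last by rewrite leNgt gt_max xM x2.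
apply: norm_le_coord => [|i j]; first by rewrite le_max [0 <= 2]ler0n orbT.
rewrite -[x](@row_mx_head R k) -/u mxE; case: (fintype.split (j : 'I_(1 + k))) => l.
  rewrite [i]ord1 [l]ord1 mxE eqxx mulr1n le_max; apply/orP; right.
  have tx : t = x 0 0.
    by move: tp; rewrite /t lt_max ltxx orbF => x0; apply/max_idPl/ltW.
  rewrite -tx gtr0_norm//; move: tr; rewrite ler_norml => /andP[_]; move: rho1; lra.
rewrite le_max; apply/orP; left; apply: le_trans (coord_le_norm u i l) _.
by apply: (KM (M + 1)); [rewrite ltrDl|exact: HK].
Qed.

(** Over [V] the density is a product of continuous functions; off the compact set [Kc], contained
    in [V], it is locally zero. These two open sets cover the space. *)
Lemma density_continuous (q : 'rV[R]_k -> R) : (forall u, V u -> q x @[x --> u] --> q u) ->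
  continuous (density h q).
Proof.
move=> cq x; have [Kc [cK KV HK]] := chart_core rhoU.
have cr : continuous (fun y : 'rV[R]_(1 + k) => rsubmx y).
  move=> y; apply/mx_cvg_nbhsP => i j; rewrite mxE; under eq_fun do rewrite mxE.
  exact: coord_continuous.
have [Vx|nVx] := pselect (V (rsubmx x)).
  have nV : \forall y \near x, V (rsubmx y).
    by apply: (cr x); exact: open_nbhs_nbhs (conj (chart_open chart) Vx).
  pose G (y : 'rV[R]_(1 + k)) := Num.max (y 0 0) 0 ^+ k *
    h (Num.max (y 0 0) 0 *: f (rsubmx y)) * q (rsubmx y).
  have E (y : 'rV[R]_(1 + k)) : V (rsubmx y) -> G y = density h q y.
    by move=> Vy; rewrite /density /patch mem_set.
  rewrite /continuous_at -(E x Vx); apply: cvg_nbhs_near_eq.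
    by apply: filterS nV => y; exact: E.
  have ct : continuous (fun y : 'rV[R]_(1 + k) => Num.max (y 0 0) 0).
    exact: (continuous_max0 (@coord_continuous _ _ _ 0 0)).
  have ctk : continuous (fun y : 'rV[R]_(1 + k) => Num.max (y 0 0) 0 ^+ k).
    by move=> y; apply: (cvg_comp _ (fun t : R => t ^+ k) (ct y)); exact: exprn_continuous.
  have cw' : q (rsubmx y) @[y --> x] --> q (rsubmx x).
    exact: (cvg_comp _ q (cr x) (cq _ Vx)).
  have cf : f (rsubmx y) @[y --> x] --> f (rsubmx x).
    exact: (cvg_comp _ f (cr x) (chart_cvg chart Vx)).
  have ctf : (fun y : 'rV[R]_(1 + k) => Num.max (y 0 0) 0 *: f (rsubmx y)) @ x
      --> Num.max (x 0 0) 0 *: f (rsubmx x).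
    exact: (cvgZ (ct x) cf).
  have sh : continuous h := smooth_continuous th.1.
  have ch := cvg_comp _ h ctf (sh _).
  exact: (cvgM (cvgM (ctk x) ch) cw').
have D0 (y : 'rV[R]_(1 + k)) : ~ Kc (rsubmx y) -> 0 = density h q y.
  move=> nK; rewrite /density; set t := Num.max _ _; set u := rsubmx _.
  rewrite /patch; case: ifPn => // /set_mem Vu.
  have t0 : 0 <= t by rewrite le_max lexx orbT.
  have [->|h0] := eqVneq (h (t *: f u)) 0; first by rewrite mulr0 mul0r.
  by have [_ /(HK _ Vu)] := localized_near t0 Vu h0.
have nKx : ~ Kc (rsubmx x) by move=> /KV.
rewrite /continuous_at -(D0 x nKx); apply: (@cvg_nbhs_near_eq _ _ _ (fun=> 0)); last exact: cst_continuous.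
have oK : open (~` Kc).
  by rewrite openC; apply: compact_closed => //; exact: norm_hausdorff.
have nK : \forall y \near x, ~ Kc (rsubmx y).
  exact: (cr x (~` Kc) (open_nbhs_nbhs (conj oK nKx))).
by apply: filterS nK => y; exact: D0.
Qed.

End Localized.
End RegularPoint.

Lemma cvg_addl (R : realType) (T : topologicalType) (x : T) (f : T -> R) (a l : R) :
  f @ x --> l -> (fun y => a + f y) @ x --> a + l.
Proof. by move=> fl; apply: cvgD => //; apply: cvg_cst. Qed.

(** * The cone current as an integral over a chart *)

Section LawlorCone.
Context {R : realType}.
Variables (d k : nat) (B : set 'rV[R]_d) (V : set 'rV[R]_k) (U : set 'rV[R]_d).
Variables (f : 'rV[R]_k -> 'rV[R]_d) (u0 : 'rV[R]_k).
Variables (omega : diff_form R d k) (L : functional R d k).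
Hypothesis k_gt0 : (0 < k)%N.
Hypothesis chart : local_param B V U f.
Hypothesis Vu0 : V u0.
Hypothesis B_sphere : B `<=` @unit_sphere R d.
Hypothesis B_closed : closed B.
Hypothesis B_orient : orientation B omega.
Hypothesis L_int : integration_current B omega L.

Let p := f u0.
Variable s : R.
Local Notation density := (density V f).

Lemma sphere_chart u : V u -> dotp (f u) (f u) = 1.
Proof. by move=> Vu; apply: B_sphere; have [] := chart_in chart Vu. Qed.

Lemma density_row (h : 'rV[R]_d -> R) (q : 'rV[R]_k -> R) (t : R) (y : 'rV[R]_k) : density h q (row_mx (t%:M : 'rV[R]_1) y) =
  ((fun u => Num.max t 0 ^+ k * h (Num.max t 0 *: f u) * q u) \_ V) y.
Proof.
rewrite /density row_mxKr; congr ((_ \_ V) y); apply/funext => u.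
suff -> : row_mx (t%:M : 'rV[R]_1) y 0 0 = t by [].
have -> : 0 = lshift k 0 :> 'I_(1 + k) by apply: val_inj.
by rewrite row_mxEl mxE eqxx mulr1n.
Qed.

Lemma density_lin (h : 'rV[R]_d -> R) (a : R) (q1 q2 : 'rV[R]_k -> R) x :
  density h (fun u => a * q1 u + q2 u) x = a * density h q1 x + density h q2 x.
Proof.
by rewrite /density /patch; case: ifP => _; [ring|rewrite mulr0 addr0].
Qed.

Lemma density_scale (a : R) (h : 'rV[R]_d -> R) (q : 'rV[R]_k -> R) x :
  density (fun y => a * h y) q x = a * density h q x.
Proof. by rewrite /density /patch; case: ifP => _; [ring|rewrite mulr0]. Qed.

Section Localized.
Variables (h : 'rV[R]_d -> R) (rho : R).
Hypothesis th : test_fun h.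
Hypothesis rho0 : 0 < rho.
Hypothesis rho1 : rho <= 2^-1.
Hypothesis h_supp : forall x, h x != 0 -> dotp (x - p) (x - p) <= rho ^+ 2.
Hypothesis rhoU : [set y | `|y - p| <= 4 * rho] `<=` U.
Hypothesis rho_sign : forall u, V u -> `|f u - p| <= 4 * rho ->
  Num.sg (omega (f u) ('J f u)) = s.

Let near_supp t u := localized_near chart Vu0 B_sphere rho0 rho1 h_supp (t := t) (u := u).

Lemma integral_density_lin (a : R) (q1 q2 : 'rV[R]_k -> R) :
  (forall u, V u -> q1 x @[x --> u] --> q1 u) ->
  (forall u, V u -> q2 x @[x --> u] --> q2 u) ->
  integral_rV (density h (fun u => a * q1 u + q2 u))
    = a * integral_rV (density h q1) + integral_rV (density h q2).
Proof.
move=> c1 c2.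
have [M1 HM1] := density_supp chart Vu0 B_sphere B_closed rho0 rho1 h_supp rhoU q1.
have [M2 HM2] := density_supp chart Vu0 B_sphere B_closed rho0 rho1 h_supp rhoU q2.
rewrite -(@integral_rVD _ _ (Num.max M1 M2)).
- by congr integral_rV; apply/funext => x; rewrite density_lin.
- exact: (density_continuous chart Vu0 B_sphere B_closed th rho0 rho1 h_supp rhoU).
- exact: (density_continuous chart Vu0 B_sphere B_closed th rho0 rho1 h_supp rhoU).
- by move=> x; rewrite gt_max => /andP[/HM1].
- by move=> x; rewrite gt_max => /andP[_ /HM2].
Qed.

Lemma compact_near_support : compact [set y | `|y - p| <= 4 * rho].
Proof.
apply: bounded_closed_compact.
  exists (4 * rho + `|p|); split; first exact: num_real.
  move=> z Mz y /= yr; apply: ltW; apply: le_lt_trans Mz.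
  by rewrite -[y](subrK p) (le_trans (ler_normD _ _))// lerD2r.
have H : {in ~` ((fun y : 'rV[R]_d => `|y - p|) @^-1` [set s | s <= 4 * rho]),
    continuous (fun y : 'rV[R]_d => `|y - p|)}.
  by move=> y _; exact: continuous_dist.
exact: (preimage_closed H (@closed_le _ (4 * rho))).
Qed.

Lemma compact_dilated_support t : 0 < t ->
  compact [set y : 'rV[R]_d | dotp (t *: y - p) (t *: y - p) <= rho ^+ 2].
Proof.
move=> t0; pose D := fun y : 'rV[R]_d => dotp (t *: y - p) (t *: y - p).
apply: bounded_closed_compact.
  exists ((rho + `|p|) / t); split; first exact: num_real.
  move=> z Mz y /= /(dotp_norm_le (ltW rho0)) yr; apply: ltW; apply: le_lt_trans Mz.
  rewrite ler_pdivlMr// (_ : `|y| * t = `|t *: y|); last by rewrite normrZ gtr0_norm// mulrC.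
  by rewrite -[t *: y](subrK p) (le_trans (ler_normD _ _))// lerD2r.
have cD : continuous D.
  exact: (smooth_continuous (smooth_dilation t (smooth_dotp p))).
have H : {in ~` (D @^-1` [set s | s <= rho ^+ 2]), continuous D}.
  by move=> y _; exact: cD.
exact: (preimage_closed H (@closed_le _ (rho ^+ 2))).
Qed.

(** An [integration_current] is given by its values on forms supported in one chart. The chart with
    empty domain over the complement of [B] shows that it vanishes on forms supported off [B]. *)
Lemma empty_chart : local_param B set0 (~` B) f.
Proof.
split.
- by split; [exact: open0|rewrite openC].
- by [].
- by [].
- by rewrite image_set0 setICr.
- exists (fun=> 0); split => // y; exact: cvg_cst.
Qed.

Lemma current_slice w t : covector w -> 0 < t ->
  L (fun y A => h (t *: y) * w (col_mx y (t *: A)))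
  = s * integral_rV (slice (density h (tangent_value f w)) t).
Proof.
move=> cw t0; have tpsi := test_form_cone t0 th cw.
have tE : Num.max t 0 = t by apply/max_idPl/ltW.
case: L_int => _ HL.
(* If t is within [rho] of 1, the slice of the form is supported in a ball inside [U]. Otherwise its
   support misses the unit sphere, hence [B], and [empty_chart] applies. *)
have [tr|tr] := leP `|t - 1| rho.
  rewrite (HL _ _ _ _ chart tpsi); last first.
    exists [set y | `|y - p| <= 4 * rho]; split=> //; first exact: compact_near_support.
    move=> y /= ny A; have [->|h0] := eqVneq (h (t *: y)) 0; first by rewrite mul0r.
    exfalso; apply: ny; apply: (dotp_cone_dist _ (ltW rho0) rho1 tr) => //.
      exact: sphere_chart.
    exact: h_supp.
  have [M HM] := density_supp chart Vu0 B_sphere B_closed rho0 rho1 h_supp rhoU (tangent_value f w).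
  have cd := density_continuous chart Vu0 B_sphere B_closed th rho0 rho1 h_supp rhoU
    (fun u Vu => tangent_value_cvg k_gt0 chart cw Vu).
  have cs := slice_continuous (t := t) cd.
  have ss := slice_supp t HM.
  rewrite -[RHS]addr0 -[X in _ = _ + X](integral_rV0 (R := R) k).
  rewrite -(@integral_rVD _ _ M)//; last exact: cst_continuous.
  congr integral_rV; apply/funext => u; rewrite addr0 /slice density_row tE.
  rewrite /patch; case: ifPn => [/set_mem Vu|_]; last by rewrite mulr0.
  have [->|h0] := eqVneq (h (t *: f u)) 0.
    by rewrite mul0r !mulr0 mul0r mulr0.
  have [_ fu] := near_supp (ltW t0) Vu h0.
  by rewrite rho_sign// covector_col_scale//; congr (s * _); rewrite mulrCA mulrA.
have -> : slice (density h (tangent_value f w)) t = fun=> 0.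
  apply/funext => u; rewrite /slice density_row tE /patch.
  case: ifPn => // /set_mem Vu.
  have [->|h0] := eqVneq (h (t *: f u)) 0; first by rewrite !(mul0r, mulr0).
  by have [] := near_supp (ltW t0) Vu h0; rewrite leNgt tr.
rewrite integral_rV0 mulr0 (HL _ _ _ _ empty_chart tpsi).
  rewrite (_ : _ \_ set0 = fun=> 0) ?integral_rV0//.
  by apply/funext => u; rewrite /patch in_set0.
exists [set y : 'rV[R]_d | dotp (t *: y - p) (t *: y - p) <= rho ^+ 2]; split.
- exact: compact_dilated_support.
- move=> y /= Hy By.
  have := dotp_sphere_dist (sphere_chart Vu0) (B_sphere By) (ltW t0) (ltW rho0) Hy.
  by rewrite leNgt tr.
- move=> y /= ny A; have [->|h0] := eqVneq (h (t *: y)) 0; first by rewrite mul0r.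
  by exfalso; apply: ny; exact: h_supp.
Qed.

(** No Fubini theorem is involved: in [integral_rV] the first coordinate is integrated last, exactly
    as t is in [cone_current]. *)
Lemma cone_density w : covector w ->
  cone_current L (fun x A => h x * w A)
  = s * integral_rV (density h (tangent_value f w)).
Proof.
move=> cw; rewrite /cone_current.
set D := density h (tangent_value f w).
transitivity (Rintegral (@lebesgue_measure R) `]0, +oo[%classic
    (fun t => s * integral_rV (slice D t))).
  apply: eq_Rintegral => t; rewrite inE /= in_itv /= andbT => t0.
  exact: current_slice.
have [M HM] := density_supp chart Vu0 B_sphere B_closed rho0 rho1 h_supp rhoU (tangent_value f w).
have cD : continuous D := density_continuous chart Vu0 B_sphere B_closed th rho0 rho1 h_supp rhoU
  (fun u Vu => tangent_value_cvg k_gt0 chart cw Vu).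
rewrite Rintegral_mkcond.
have -> : (fun t => s * integral_rV (slice D t)) \_ `]0, +oo[ =
    (fun t => integral_rV (slice (fun x => s * D x + 0) t)).
  apply/funext => t; rewrite /patch mem_setE in_itv /= andbT.
  have E : integral_rV (slice (fun x => s * D x + 0) t) = s * integral_rV (slice D t).
    have := @integral_rVD R k M s (slice D t) (fun=> 0) (slice_continuous cD)
      (@cst_continuous _ _ 0) (slice_supp t HM) (fun _ _ => erefl).
    by rewrite integral_rV0 addr0.
  rewrite E; case: ifPn => //; rewrite -leNgt => t0.
  (* For t <= 0 the truncated factor is 0^k, which vanishes because k > 0. *)
  suff -> : slice D t = fun=> 0 by rewrite integral_rV0 mulr0.
  apply/funext => u; rewrite /slice /D density_row (max_idPr t0) /patch.
  by case: ifPn => // _; rewrite expr0n gtn_eqF// !mul0r.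
rewrite -[LHS]/(integral_rV (fun x : 'rV[R]_k.+1 => s * D x + 0)).
have := @integral_rVD R k.+1 M s D (fun=> 0) cD (@cst_continuous _ _ 0) HM (fun _ _ => erefl).
by rewrite integral_rV0 addr0.
Qed.

Lemma density_ge0 (q : 'rV[R]_k -> R) : (forall x, 0 <= h x) ->
  (forall u, V u -> `|f u - p| <= 4 * rho -> 0 <= q u) ->
  0 <= integral_rV (density h q).
Proof.
move=> h0 q0; apply: integral_rV_ge0 => x; rewrite /density.
set t := Num.max _ _; set u := rsubmx _.
rewrite /patch; case: ifPn => // /set_mem Vu.
have t0 : 0 <= t by rewrite le_max lexx orbT.
have [->|hn0] := eqVneq (h (t *: f u)) 0; first by rewrite mulr0 mul0r.
have [_ fu] := near_supp t0 Vu hn0.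
by rewrite !mulr_ge0 ?exprn_ge0// q0.
Qed.

Lemma integral_density_approx (q : 'rV[R]_k -> R) (q0 eps : R) :
  (forall x, 0 <= h x) -> (forall u, V u -> q x @[x --> u] --> q u) ->
  (forall u, V u -> `|f u - p| <= 4 * rho -> `|q u - q0| <= eps) ->
  `|integral_rV (density h q) - q0 * integral_rV (density h (fun=> 1))|
    <= eps * integral_rV (density h (fun=> 1)).
Proof.
move=> h0 qc Hq.
have cc (a : R) : forall u, V u -> (fun=> a) @ u --> a by move=> u _; exact: cst_continuous.
have I0 : integral_rV (density h (fun=> 0)) = 0.
  rewrite (_ : density _ _ = fun=> 0) ?integral_rV0//.
  by apply/funext => x; rewrite /density /patch; case: ifP => // _; rewrite mulr0.
have Ic a : a * integral_rV (density h (fun=> 1)) = integral_rV (density h (fun=> a)).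
  have := integral_density_lin a (cc 1) (cc 0); rewrite I0 [RHS]addr0 => <-.
  by congr (integral_rV (density h _)); apply/funext => u; rewrite mulr1 addr0.
have qa a : forall u, V u -> a + q x @[x --> u] --> a + q u.
  by move=> u Vu; apply: cvg_addl; exact: qc.
have -> : integral_rV (density h q) - q0 * integral_rV (density h (fun=> 1))
    = integral_rV (density h (fun u => - q0 + q u)).
  rewrite addrC -mulNr -(integral_density_lin (- q0) (cc 1) qc).
  by congr (integral_rV (density h _)); apply/funext => u; rewrite mulr1.
rewrite ler_norml; apply/andP; split.
  rewrite -subr_ge0 opprK addrC -(integral_density_lin eps (cc 1) (qa (- q0))).
  apply: density_ge0 => // u Vu Hu; have := Hq u Vu Hu.
  by rewrite ler_norml => /andP[H1 _]; move: H1; lra.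
rewrite -subr_ge0 Ic addrC -mulN1r -(integral_density_lin (-1) (qa (- q0)) (cc eps)).
apply: density_ge0 => // u Vu Hu; have := Hq u Vu Hu.
by rewrite ler_norml => /andP[_ H1]; move: H1; lra.
Qed.

End Localized.
End LawlorCone.

Lemma sgr_near (R : realType) (a b : R) : a != 0 -> `|b - a| <= `|a| / 2 ->
  Num.sg b = Num.sg a.
Proof.
move=> a0; case: (ltrgt0P a) a0 => // a0 _; rewrite ler_norml => /andP[H1 H2].
  by rewrite !gtr0_sg//; move: H1; lra.
by rewrite !ltr0_sg//; move: H2; lra.
Qed.

Section RegularConeBlowup.
Context {R : realType}.
Variables (d k : nat) (B : set 'rV[R]_d) (V : set 'rV[R]_k) (U : set 'rV[R]_d).
Variables (f : 'rV[R]_k -> 'rV[R]_d) (u0 : 'rV[R]_k).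
Variables (omega : diff_form R d k) (L : functional R d k).
Hypothesis k_gt0 : (0 < k)%N.
Hypothesis chart : local_param B V U f.
Hypothesis Vu0 : V u0.
Hypothesis B_sphere : B `<=` @unit_sphere R d.
Hypothesis B_closed : closed B.
Hypothesis B_orient : orientation B omega.
Hypothesis L_int : integration_current B omega L.

(** [omega] is continuous only along [B], so the limit is taken through the filter [within B]; the
    chart takes its values in [B]. *)
Lemma orientation_cvg :
  omega (f u) ('J f u) @[u --> u0] --> omega (f u0) ('J f u0).
Proof.
case: B_orient => om_cov om_cont _.
have Bu u : V u -> B (f u) by move=> Vu; have [] := chart_in chart Vu.
have nV : \forall u \near u0, V u := open_nbhs_nbhs (conj (chart_open chart) Vu0).
rewrite (covector_expand (om_cov _ (Bu _ Vu0))).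
apply: (@cvg_nbhs_near_eq _ _ _ (fun u => \sum_(J : {ffun 'I_k -> 'I_d})
  (\prod_i 'J f u i (J i)) * omega (f u) (rowsub J 1%:M))).
  by apply: filterS nV => u Vu; rewrite [RHS](covector_expand (om_cov _ (Bu _ Vu))).
apply: (cvg_expansion (c := fun J u => omega (f u) (rowsub J 1%:M))
  (chart_jacobian_cvg k_gt0 chart Vu0)) => J.
have cp : f u @[u --> u0] --> within B (nbhs (f u0)).
  move=> P; rewrite /within /= => HP.
  have := chart_cvg chart Vu0 HP; rewrite /= => H.
  by apply: filterS2 nV H => u Vu; apply; exact: Bu.
apply: (cvg_comp f (fun q => omega q (rowsub J 1%:M)) cp).
by rewrite (nbhs_subspace_in (Bu _ Vu0)); exact: om_cont.
Qed.

Lemma orientation_sign_near : exists2 delta, 0 < delta &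
  forall u, V u -> `|f u - f u0| <= delta ->
    Num.sg (omega (f u) ('J f u)) = Num.sg (omega (f u0) ('J f u0)).
Proof.
have a0 : omega (f u0) ('J f u0) != 0.
  by apply/eqP; case: B_orient => _ _ H; exact: H chart Vu0.
have e0 : 0 < `|omega (f u0) ('J f u0)| / 2 by rewrite divr_gt0// normr_gt0.
have [delta d0 H] := chart_inverse_near chart Vu0 orientation_cvg e0.
exists delta; first exact: d0.
by move=> u Vu fu; exact: (sgr_near a0 (H u Vu fu)).
Qed.

(** Bumps shrinking to [f u0], divided by the mass [c j] of their densities, form an approximate
    identity on the cone. The cone current then evaluates to [s] times a weighted mean of
    [tangent_value f w] near [u0]. *)
Lemma regular_cone_blowup_sign (s : R) : `|s| <= 1 ->
  (exists2 delta, 0 < delta & forall u, V u -> `|f u - f u0| <= delta ->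
     Num.sg (omega (f u) ('J f u)) = s) ->
  blowup (cone_current L) (fun w => s * tangent_value f w u0).
Proof.
move=> s1 [delta d0 Hd].
have cL : is_current L by case: L_int.
have pU : U (f u0) by have [] := chart_in chart Vu0.
have oU : open U by case: (chart) => -[].
have /nbhs_ballP[e /= e0 He] : nbhs (f u0) U by exact: open_nbhs_nbhs.
(* The bound 1/2 is the one of [dotp_cone_dist], e/8 keeps the ball of radius 4 rho inside [U], and
   delta/4 keeps the orientation sign constant on it. *)
pose rho0 := Num.min (2^-1) (Num.min (e / 8) (delta / 4)).
have rho0_gt0 : 0 < rho0 by rewrite !lt_min invr_gt0 ltr0n !divr_gt0.
pose rho j := rho0 / j.+1%:R.
have rho_gt0 j : 0 < rho j by rewrite divr_gt0.
have rho_le j : rho j <= rho0 by rewrite ler_pdivrMr// ler_peMr ?ler1n// ltW.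
have rho1 j : rho j <= 2^-1 by apply: le_trans (rho_le j) _; rewrite ge_min lexx.
have rhoe j : rho j <= e / 8 by apply: le_trans (rho_le j) _; rewrite !ge_min lexx !orbT.
have rhod j : rho j <= delta / 4 by apply: le_trans (rho_le j) _; rewrite !ge_min lexx !orbT.
have rhoU j : [set y | `|y - f u0| <= 4 * rho j] `<=` U.
  move=> y /= Hy; apply: He; rewrite -ball_normE /= distrC (le_lt_trans Hy)//.
  by move: (rhoe j) e0; lra.
have rho_sign j u : V u -> `|f u - f u0| <= 4 * rho j ->
    Num.sg (omega (f u) ('J f u)) = s.
  by move=> Vu Hu; apply: Hd => //; move: Hu (rhod j); lra.
pose b j := bump (f u0) (rho j).
have tb j : test_fun (b j) by apply: bump_test_fun; exact: ltW.
have b_supp j x : b j x != 0 -> dotp (x - f u0) (x - f u0) <= rho j ^+ 2.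
  by move=> bx; rewrite ltW// -bump_gt0 lt_neqAle eq_sym bx bump_ge0.
have b_ge0 j x : 0 <= b j x by exact: bump_ge0.
pose I j q := integral_rV (density V f (b j) q).
have c1 : forall u, V u -> (fun=> 1) @ u --> (1 : R) by move=> u _; exact: cst_continuous.
have Ilin j := integral_density_lin chart Vu0 B_sphere B_closed (tb j) (rho_gt0 j)
  (rho1 j) (b_supp j) (rhoU j).
have Ige0 j q := density_ge0 chart Vu0 B_sphere (rho_gt0 j) (rho1 j) (b_supp j)
  (q := q) (b_ge0 j).
have cW w := tangent_value_cvg k_gt0 chart (w := w).
pose c j := I j (fun=> 1).
have c_gt0 j : 0 < c j.
  have [M HM] := density_supp chart Vu0 B_sphere B_closed (rho_gt0 j) (rho1 j)
    (b_supp j) (rhoU j) (fun=> 1).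
  have cD := density_continuous chart Vu0 B_sphere B_closed (tb j) (rho_gt0 j)
    (rho1 j) (b_supp j) (rhoU j) c1.
  apply: (integral_rV_gt0 cD HM (x := row_mx (1%:M : 'rV[R]_1) u0)) => [x|].
    rewrite /density /patch; case: ifP => // _.
    by rewrite mulr1 mulr_ge0 ?exprn_ge0 ?b_ge0// le_max lexx orbT.
  rewrite density_row (max_idPl ler01) /patch mem_set// expr1n mul1r mulr1 scale1r.
  by rewrite bump_gt0 subrr (_ : dotp 0 0 = 0) ?exprn_gt0// /dotp big1// => i _; rewrite mxE mul0r.
pose h j x := (c j)^-1 * b j x.
have th j : test_fun (h j) by exact: test_funZ.
have h_supp j x : h j x != 0 -> dotp (x - f u0) (x - f u0) <= rho j ^+ 2.
  by rewrite mulf_eq0 negb_or => /andP[_]; exact: b_supp.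
have coneE j w : covector w -> cone_current L (fun x A => h j x * w A)
    = s * ((c j)^-1 * I j (tangent_value f w)).
  move=> cw; rewrite (cone_density k_gt0 chart Vu0 B_sphere B_closed L_int (th j)
    (rho_gt0 j) (rho1 j) (h_supp j) (rhoU j) (rho_sign j) cw); congr (s * _).
  have [M HM] := density_supp chart Vu0 B_sphere B_closed (rho_gt0 j) (rho1 j)
    (b_supp j) (rhoU j) (tangent_value f w).
  have cD := density_continuous chart Vu0 B_sphere B_closed (tb j) (rho_gt0 j)
    (rho1 j) (b_supp j) (rhoU j) (fun u Vu => cW w u cw Vu).
  have := @integral_rVD R _ M (c j)^-1 _ (fun=> 0) cD (@cst_continuous _ _ 0) HM
    (fun _ _ => erefl).
  rewrite integral_rV0 addr0 => <-; congr integral_rV; apply/funext => x.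
  by rewrite addr0 -density_scale.
have XV : mvector (fun w => s * tangent_value f w u0).
  by move=> a w z _ _; rewrite /tangent_value; ring.
exists h; split.
- by move=> j; split=> // x; rewrite mulr_ge0// invr_ge0 ltW.
- move=> j a w z cw cz.
  have caz : covector (fun A => a * w A + z A).
    by have := covector_lin a 1 cw cz; under eq_fun do rewrite mul1r.
  rewrite !coneE//; have := Ilin j a _ _ (fun u Vu => cW w u cw Vu) (fun u Vu => cW z u cz Vu).
  by rewrite /I => ->; ring.
- by move=> j r w r0 cw; apply: cone_current_rescale.
- exact: XV.
move=> w cw; under eq_fun do rewrite coneE//.
set W := tangent_value f w.
apply/cvgrPdist_le => eps eps0.
have [dl dl0 Hdl] := chart_inverse_near chart Vu0 (cW w u0 cw Vu0) eps0.
have q0 : 0 < dl / (4 * rho0) by rewrite divr_gt0// mulr_gt0.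
near=> j.
have rj : 4 * rho j <= dl.
  have : j.+1%:R^-1 < dl / (4 * rho0).
    by near: j; exact: (near_infty_natSinv_lt (PosNum q0)).
  by rewrite ltr_pdivlMr ?mulr_gt0// /rho => /ltW; rewrite mulrC mulrA.
have key : `|I j W - W u0 * c j| <= eps * c j.
  apply: (integral_density_approx chart Vu0 B_sphere B_closed (tb j) (rho_gt0 j)
    (rho1 j) (b_supp j) (rhoU j) (b_ge0 j) (fun u Vu => cW w u cw Vu)).
  by move=> u Vu Hu; apply: Hdl => //; exact: le_trans Hu rj.
move: key; move: (I j W) (W u0) (c j) (c_gt0 j) => x y z z0 key.
rewrite -mulrBr normrM (le_trans (y := `|y - z^-1 * x|))//; first by rewrite ler_piMl.
have -> : y - z^-1 * x = - (z^-1 * (x - y * z)) by field; rewrite gt_eqF.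
by rewrite normrN normrM gtr0_norm ?invr_gt0// mulrC ler_pdivrMr.
Unshelve. all: by end_near. Qed.

Lemma regular_cone_blowup : blowup (cone_current L)
  (fun w => Num.sg (omega (f u0) ('J f u0)) * tangent_value f w u0).
Proof.
apply: regular_cone_blowup_sign; last exact: orientation_sign_near.
by rewrite normr_sg; case: (_ == _).
Qed.

End RegularConeBlowup.

(** * Calibrations, blow-ups and the contraction to one factor *)

Section CalibratedBlowups.
Context {R : realType}.

(* Dilating [h j] towards the origin preserves the inequality to be proved, and
   [phi] is close to [phi 0] there. *)
Lemma calibrated_blowup (d m : nat) (T : functional R d m) X
    (phi : diff_form R d m) (psi : 'M[R]_(m, d) -> R) :
  continuous_calibration phi -> calibrates phi T -> blowup T X ->
  covector psi -> comass psi <= 1 -> X psi <= X (phi 0).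
Proof.
move=> [cphi phic _ _] [mu [xi [pol phi1]]] [h [h1 _ h3 _ h5]] cpsi psi1.
suff H j : T (fun x A => h j x * psi A) <= T (fun x A => h j x * phi 0 A).
  by apply: (ler_cvg_to (h5 _ cpsi) (h5 _ (cphi 0))); exact: nearW.
have [th h0] := h1 j; have [_ [M hM]] := th.
set a := T _; set b := T _.
apply/ler_addgt0Pr => e e0.
pose e' := Num.min (2^-1) (e / (`|a| + 1)).
have a1 : 0 < `|a| + 1 by rewrite ltr_wpDl.
have e'0 : 0 < e' by rewrite lt_min invr_gt0 ltr0n divr_gt0.
have e'1 : e' < 1 by rewrite gt_min invf_lt1 ?ltr0n// ltr1n.
have e'a : e' * `|a| <= e.
  have : e' * (`|a| + 1) <= e by rewrite -ler_pdivlMr// ge_min lexx orbT.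
  by apply: le_trans; rewrite ler_pM2l// lerDl.
have [delta delta0 Hd] := polar_near pol cphi phic phi1 e'0 e'1.
have M1 : 0 < `|M| + 1 by rewrite ltr_wpDl.
(* Where the norm of x exceeds [delta], that of x/r exceeds [M], so the dilated weight vanishes
   there. The absolute value is taken because [M] may be negative. *)
pose r := delta / (`|M| + 1).
have r0 : 0 < r by rewrite divr_gt0.
have ri : 0 < r^-1 by rewrite invr_gt0.
have := Hd (fun x => h j (r^-1 *: x)) psi (test_fun_dilation ri th).
rewrite !h3// -/a -/b mulrCA ler_pM2l ?exprn_gt0// => Hab.
have {Hab} : (1 - e') * a <= b.
  apply: Hab => // x dx; apply: hM.
  rewrite normrZ gtr0_norm// /r invf_div mulrAC ltr_pdivlMr//.
  apply: (@le_lt_trans _ _ (`|M| * delta)).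
    by rewrite ler_wpM2r ?ler_norm// ltW.
  apply: (@lt_le_trans _ _ ((`|M| + 1) * delta)).
    by rewrite ltr_pM2r// ltrDl.
  by rewrite ler_wpM2l// ltW.
have : e' * a <= e' * `|a| by rewrite ler_wpM2l ?ler_norm// ltW.
lra.
Qed.

Lemma comass_phi0 (d m : nat) (phi : diff_form R d m) :
  continuous_calibration phi -> comass (phi 0) <= 1.
Proof.
move=> [_ _ _ phi1]; rewrite -lee_fin -phi1; apply: ereal_sup_ubound.
by exists 0.
Qed.

Lemma comass_orthogonal (d m : nat) (w : 'M[R]_(m, d) -> R) (H : 'M[R]_d) :
  H *m H^T = 1%:M -> comass (fun A => w (A *m H)) = comass w.
Proof.
move=> HH; have HH' : H^T *m H = 1%:M by apply: mulmx1C.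
have E (A : 'M[R]_(m, d)) (G : 'M[R]_d) : G *m G^T = 1%:M ->
    (A *m G) *m (A *m G)^T = A *m A^T.
  by move=> GG; rewrite trmx_mul mulmxA -(mulmxA A) GG mulmx1.
rewrite /comass; congr sup; apply/seteqP; split => _ [A /= A1 <-].
  by exists (A *m H) => //=; rewrite E.
exists (A *m H^T) => /=; first by rewrite E// trmxK.
by rewrite -mulmxA HH' mulmx1.
Qed.

Lemma minor_block (d1 d2 m1 m2 : nat) (J1 : {ffun 'I_m1 -> 'I_d1})
    (J2 : {ffun 'I_m2 -> 'I_d2}) : exists J : {ffun 'I_(m1 + m2) -> 'I_(d1 + d2)},
  forall (A : 'M[R]_(m1, d1)) (B : 'M[R]_(m2, d2)),
    minor J (block_mx A 0 0 B) = minor J1 A * minor J2 B.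
Proof.
exists [ffun i => match fintype.split i with
  inl a => lshift d2 (J1 a) | inr b => rshift d1 (J2 b) end] => A B.
rewrite /minor -(det_ublock _ 0); congr (\det _).
apply/matrixP => i j; rewrite mxE ffunE.
case: (split_ordP i) => a ->; case: (split_ordP j) => b ->;
  rewrite ?(unsplitK (inl b)) ?(unsplitK (inr b));
  by rewrite ?(block_mxEul, block_mxEur, block_mxEdl, block_mxEdr) !mxE.
Qed.

End CalibratedBlowups.

Section Products.
Context {R : realType}.
Variables (d m : nat -> nat) (C : forall i : nat, functional R (d i) (m i)).
Arguments C : clear implicits.

(* [E] contracts a form with blow-ups of all the factors but [C 1]; by the last
   clause it does not vanish identically. *)
Definition factor_contraction (n : nat)
    (E : ('M[R]_(sum_upto m n, sum_upto d n) -> R) -> ('M[R]_(m 1%N, d 1%N) -> R)) :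
    Prop :=
  [/\ forall w, covector w -> covector (E w),
      forall a w, covector w -> forall A, E (fun A => a * w A) A = a * E w A,
      forall s tau, blowup (C 1%N) (fun w => s * w tau) ->
        exists2 X, blowup (iter_product C n) X &
          forall w, covector w -> X w = s * E w tau,
      forall H : 'M[R]_(d 1%N), H *m H^T = 1%:M ->
        exists2 G : 'M[R]_(sum_upto d n), G *m G^T = 1%:M &
          forall w, covector w -> forall A, E (fun A => w (A *m G)) A = E w (A *m H) &
      forall J1, exists J c, c != 0 /\ forall A, E (minor J) A = c * minor J1 A].

Lemma factor_contraction1 X0 J0 : blowup (C 0%N) X0 -> X0 (minor J0) != 0 ->
  exists E, @factor_contraction 1 E.
Proof.
move=> bX X0J; have X0V : mvector X0 by case: bX => h [].
exists (fun w A => X0 (fun A0 => w (block_mx A0 0 0 A))); split.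
- move=> w cw; apply: covector_intro => [A i b c u v|A i j ij Aij].
    have cl := fun B => covector_blockl B cw.
    rewrite -[c * _](mvectorZ X0V)// -X0V//; last exact: covectorZ.
    congr X0; apply/funext => B.
    exact: (covector_updP (covector_blockr B cw)).
  rewrite -[RHS](mvector0 X0V); congr X0; apply/funext => B.
  exact: ((covector_blockr B cw).2 _ _ _ ij).
- by move=> a w cw A; rewrite (mvectorZ X0V)//; exact: covector_blockl.
- move=> s tau bY; exists (tens X0 (fun w => s * w tau)); first exact: blowup_product.
  by move=> w cw; rewrite /tens (mvectorZ X0V)//; exact: covector_blockl.
- move=> H HH; exists (block_mx 1%:M 0 0 H : 'M[R]_(d 0%N + d 1%N)).
    rewrite tr_block_mx mulmx_block !(trmx0, trmx1, mulmx0, mul0mx, mulmx1, addr0, add0r).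
    by rewrite HH -scalar_mx_block.
  move=> w cw A; congr X0; apply/funext => A0; congr w.
  by rewrite (@mulmx_block R (m 0%N) (m 1%N) (d 0%N) (d 1%N) (d 0%N) (d 1%N))
    !(mulmx0, mul0mx, mulmx1, addr0, add0r).
- move=> J1; have [J HJ] := minor_block (R := R) J0 J1.
  exists J, (X0 (minor J0)); split=> // A.
  rewrite [RHS]mulrC -(mvectorZ X0V); last exact: minor_covector.
  by congr X0; apply/funext => A0; rewrite HJ mulrC.
Qed.

Lemma factor_contractionS n E Y J0 : @factor_contraction n.+1 E ->
  blowup (C n.+2) Y -> Y (minor J0) != 0 -> exists E', @factor_contraction n.+2 E'.
Proof.
move=> [E1 E2 E3 E4 E5] bY YJ; have YV : mvector Y by case: bY => h [].
exists (fun w => E (fun A => Y (fun B => w (block_mx A 0 0 B)))).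
have cc := fun w cw => covector_contract (w := w) YV cw.
split.
- by move=> w cw; apply: E1; exact: cc.
- move=> a w cw A; rewrite -E2; last exact: cc.
  congr E; apply/funext => A'; rewrite (mvectorZ YV)//; exact: covector_blockr.
- move=> s tau /E3 [X bX XE]; exists (tens X Y); first exact: blowup_product.
  by move=> w cw; rewrite /tens XE//; exact: cc.
- move=> H /E4 [G GG GE].
  exists (block_mx G 0 0 1%:M : 'M[R]_(sum_upto d n.+1 + d n.+2)).
    rewrite tr_block_mx mulmx_block !(trmx0, trmx1, mulmx0, mul0mx, mulmx1, addr0, add0r).
    by rewrite GG -scalar_mx_block.
  move=> w cw A; rewrite -GE; last exact: cc.
  congr (E _ A); apply/funext => A'; congr Y; apply/funext => B'; congr w.
  by rewrite (@mulmx_block R (sum_upto m n.+1) (m n.+2) (sum_upto d n.+1) (d n.+2)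
    (sum_upto d n.+1) (d n.+2)) !(mulmx0, mul0mx, mulmx1, addr0, add0r).
- move=> J1; have [J [c [c0 HJ]]] := E5 J1.
  have [J' HJ'] := minor_block (R := R) J J0.
  exists J', (Y (minor J0) * c); split=> [|A]; first by rewrite mulf_neq0.
  rewrite -mulrA -HJ -E2; last exact: minor_covector.
  congr (E _ A); apply/funext => A'; rewrite mulrC -(mvectorZ YV); last exact: minor_covector.
  by congr Y; apply/funext => B'; rewrite HJ'.
Qed.

Lemma factor_contraction_exists n X0 J0 : (1 <= n)%N ->
  blowup (C 0%N) X0 -> X0 (minor J0) != 0 ->
  (forall i, (2 <= i <= n)%N -> exists Y J, blowup (C i) Y /\ Y (minor J) != 0) ->
  exists E, @factor_contraction n E.
Proof.
move=> + bX X0J; case: n => // n _; elim: n => [|n IH] HC.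
  exact: factor_contraction1 bX X0J.
have [i /andP[i2 iln]|E HE] := IH.
  by apply: HC; rewrite i2 (leq_trans iln).
have [|Y [J [bY YJ]]] := HC n.+2; first by rewrite !ltnS leqnn.
exact: factor_contractionS HE bY YJ.
Qed.

Lemma factor_contraction_calibrated n E phi s tau :
  @factor_contraction n E -> continuous_calibration phi ->
  calibrates phi (iter_product C n) -> blowup (C 1%N) (fun w => s * w tau) ->
  s != 0 -> (exists J, minor J tau != 0) ->
  E (phi 0) tau != 0 /\
  forall H : 'M[R]_(d 1%N), H *m H^T = 1%:M ->
    s * E (phi 0) (tau *m H) <= s * E (phi 0) tau.
Proof.
move=> [E1 E2 E3 E4 E5] cal calT btau s0 [J1 J1tau].
have [X bX XE] := E3 _ _ btau.
have cphi := let: And4 H _ _ _ := cal in H 0.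
have Xle psi cpsi psi1 := @calibrated_blowup _ _ _ _ X phi psi cal calT bX cpsi psi1.
split.
  (* If the contraction vanished, the maximum [X (phi 0)] would be 0. Both signs of a small multiple
     of a minor are admissible competitors, so [X] would vanish on that minor, whose value is a
     multiple of the nonzero [minor J1 tau]. *)
  apply/eqP => E0; have [J [c [c0 HJ]]] := E5 J1.
  have cJ := @minor_covector R _ _ J.
  have cm0 : 0 <= comass (@minor R _ _ J) by exact: comass_ge0.
  pose t := (comass (@minor R _ _ J) + 1)^-1.
  have t0 : 0 < t by rewrite invr_gt0 ltr_wpDl.
  have t1 : t * comass (@minor R _ _ J) <= 1.
    by rewrite mulrC ler_pdivrMr ?mul1r ?lerDl// ltr_wpDl.
  have ct := comass_scale_le1 t0 t1.
  have X0 : X (phi 0) = 0 by rewrite XE// E0 mulr0.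
  have X1 : X (fun A => t * minor J A) <= 0.
    by rewrite -X0; exact: (Xle _ (covectorZ t cJ) ct).
  have X2 : X (fun A => - t * minor J A) <= 0.
    rewrite -X0; apply: Xle; first exact: (covectorZ (- t) cJ).
    under [X in comass X]eq_fun do rewrite mulNr.
    by rewrite comass_opp.
  move: X1 X2; rewrite !XE; try exact: covectorZ.
  rewrite !E2// HJ !mulNr mulrN oppr_le0 => X1 X2.
  have /eqP : s * (t * (c * minor J1 tau)) = 0 by apply/eqP; rewrite eq_le X1 X2.
  by rewrite !mulf_eq0 (negbTE s0) (negbTE c0) (negbTE J1tau) gt_eqF.
move=> H HH; have [G GG GE] := E4 H HH.
rewrite -GE// -!XE//; last exact: covector_mulr.
apply: Xle; first exact: covector_mulr.
by rewrite comass_orthogonal//; exact: comass_phi0 cal.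
Qed.

End Products.

(** * First variation and tangent spaces *)

Section Calculus.
Context {R : realType}.

Lemma is_derive_affine (V W : normedModType R) (f : V -> W) (y v : V) (t : R) df :
  is_derive (t *: v + y) v f df -> is_derive t 1 (fun t : R => f (t *: v + y)) df.
Proof.
have E : (fun h : R => h^-1 *: ((f \o shift (t *: v + y)) (h *: v) - f (t *: v + y))) =
    (fun h : R => h^-1 *: (((fun t => f (t *: v + y)) \o shift t) (h *: 1) - f (t *: v + y))).
  by apply/funext => h /=; rewrite [h *: 1]mulr1 addrA -scalerDl.
move=> [H1 H2]; split.
- by rewrite /derivable -E.
- by rewrite -H2 /derive E.
Qed.

Lemma mvt_line (V : normedModType R) (f df : V -> R) (y v : V) (s : R) : 0 < s ->
  (forall t, 0 <= t <= s -> is_derive (t *: v + y) v (f : V -> R^o) (df (t *: v + y))) ->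
  exists2 t, 0 <= t <= s & f (s *: v + y) - f y = df (t *: v + y) * s.
Proof.
move=> s0 Df.
have Dg (t : R) : 0 <= t <= s ->
    is_derive t 1 (fun t : R => f (t *: v + y) : R^o) (df (t *: v + y)).
  by move=> /Df; exact: is_derive_affine.
have [||t ts E] := @MVT R (fun t => f (t *: v + y)) (fun t => df (t *: v + y)) 0 s s0.
- by move=> t; rewrite in_itv /= => /andP[t0 ts]; apply: Dg; rewrite !ltW.
- apply: derivable_within_continuous => t; rewrite in_itv /= => /Dg.
  by move=> [].
exists t; first by move: ts; rewrite in_itv /= => /andP[t0 ts]; rewrite !ltW.
by move: E; rewrite scale0r add0r subr0.
Qed.

Lemma is_derive_shift (V : normedModType R) (f : V -> R) (x v c : V) df :
  is_derive (c + x) v (f : V -> R^o) df -> is_derive x v (fun y => f (c + y) : R^o) df.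
Proof.
move=> /is_derive_line Df; apply/is_derive_line.
by under eq_fun do rewrite addrCA.
Qed.

(** The mean value theorem twice: along [a] for the increment of [f] in the direction [b], then
    along [b] for [fa]. *)
Lemma second_difference (V : normedModType R) (f fa fab : V -> R) (a b x : V)
    (s : R) : 0 < s ->
  (forall t t', 0 <= t <= s -> 0 <= t' <= s ->
     is_derive (t' *: b + (t *: a + x)) a (f : V -> R^o) (fa (t' *: b + (t *: a + x))) /\
     is_derive (t' *: b + (t *: a + x)) b (fa : V -> R^o) (fab (t' *: b + (t *: a + x)))) ->
  exists t t', [/\ 0 <= t <= s, 0 <= t' <= s &
    f (s *: b + (s *: a + x)) - f (s *: a + x) - (f (s *: b + x) - f x) =
      fab (t' *: b + (t *: a + x)) * s * s].
Proof.
move=> s0 Df.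
have [|t ts E1] := @mvt_line V (fun y => f (s *: b + y) - f y)
    (fun y => fa (s *: b + y) - fa y) x a s s0.
  move=> t ts; apply: is_deriveB.
    by apply: is_derive_shift; apply: (Df t s ts _).1; rewrite lexx ltW.
  have := (Df t 0 ts _).1; rewrite scale0r add0r; apply.
  by rewrite lexx ltW.
have [|t' ts' E2] := @mvt_line V fa fab (t *: a + x) b s s0.
  by move=> t' ts'; exact: (Df t t' ts ts').2.
by exists t, t'; split=> //; rewrite E1 E2.
Qed.

(** The second difference is symmetric in [a] and [b], so the two mixed derivatives agree at two
    points arbitrarily close to [x]; continuity does the rest. *)
Lemma schwarz (V : normedModType R) (D : set V) (f fa fb fab fba : V -> R)
    (a b x : V) : open D -> D x ->
  (forall y, D y -> is_derive y a (f : V -> R^o) (fa y)) ->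
  (forall y, D y -> is_derive y b (f : V -> R^o) (fb y)) ->
  (forall y, D y -> is_derive y b (fa : V -> R^o) (fab y)) ->
  (forall y, D y -> is_derive y a (fb : V -> R^o) (fba y)) ->
  {for x, continuous fab} -> {for x, continuous fba} -> fab x = fba x.
Proof.
move=> oD Dx Hfa Hfb Hfab Hfba cab cba.
apply/eqP; rewrite -subr_eq0 -normr_le0; apply/ler_addgt0Pr => e e0.
rewrite add0r.
have e20 : 0 < e / 2 by rewrite divr_gt0.
have nD : \forall y \near x, D y := open_nbhs_nbhs (conj oD Dx).
have nab : \forall y \near x, `|fab x - fab y| <= e / 2 by move/cvgrPdist_le: cab; apply.
have nba : \forall y \near x, `|fba x - fba y| <= e / 2 by move/cvgrPdist_le: cba; apply.
have nDab : nbhs x (D `&` ([set y | `|fab x - fab y| <= e / 2] `&`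
    [set y | `|fba x - fba y| <= e / 2])) .
  by apply: filterI nD _; exact: filterI nab nba.
move: nDab => /nbhs_ballP[r /= r0 Hr].
pose s := r / (2 * (`|a| + `|b| + 1)).
have c0 : 0 < `|a| + `|b| + 1 by rewrite ltr_wpDl// addr_ge0.
have s0 : 0 < s by rewrite divr_gt0// mulr_gt0.
have near t t' : 0 <= t <= s -> 0 <= t' <= s -> ball x r (t' *: b + (t *: a + x)).
  move=> /andP[t0 ts] /andP[t'0 t's]; rewrite -ball_normE /= distrC.
  rewrite !addrA addrK (le_lt_trans (ler_normD _ _))// !normrZ !ger0_norm//.
  apply: (@le_lt_trans _ _ (s * (`|a| + `|b| + 1))).
    rewrite mulrDr mulr1 mulrDr addrC -[leLHS]addr0; apply: lerD; last exact: ltW.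
    by rewrite lerD// ler_wpM2r.
  rewrite /s invfM mulrA -mulrA mulVf ?gt_eqF// mulr1.
  by rewrite ltr_pdivrMr// ltr_pMr// ltr1n.
have near' t t' : 0 <= t <= s -> 0 <= t' <= s -> ball x r (t' *: a + (t *: b + x)).
  by move=> ts ts'; rewrite addrCA; exact: near.
have [t [t' [ts ts' E1]]] : exists t t', [/\ 0 <= t <= s, 0 <= t' <= s &
    f (s *: b + (s *: a + x)) - f (s *: a + x) - (f (s *: b + x) - f x) =
      fab (t' *: b + (t *: a + x)) * s * s].
  apply: (@second_difference V f fa fab) => // t t' ts ts'.
  by have [Dt _] := Hr _ (near t t' ts ts'); split; [exact: Hfa|exact: Hfab].
have [u [u' [us us' E2]]] : exists t t', [/\ 0 <= t <= s, 0 <= t' <= s &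
    f (s *: a + (s *: b + x)) - f (s *: b + x) - (f (s *: a + x) - f x) =
      fba (t' *: a + (t *: b + x)) * s * s].
  apply: (@second_difference V f fb fba) => // u u' us us'.
  by have [Dt _] := Hr _ (near' u u' us us'); split; [exact: Hfb|exact: Hfba].
have E : fab (t' *: b + (t *: a + x)) = fba (u' *: a + (u *: b + x)).
  apply: (mulIf (lt0r_neq0 s0)); apply: (mulIf (lt0r_neq0 s0)).
  by rewrite -E1 -E2 [s *: a + (s *: b + x)]addrCA; ring.
have [_ [H1 _]] := Hr _ (near _ _ ts ts').
have [_ [_ H2]] := Hr _ (near' _ _ us us').
rewrite -(subrK (fab (t' *: b + (t *: a + x))) (fab x)) -addrA.
rewrite (le_trans (ler_normD _ _))// [leRHS]splitr lerD//.
by rewrite E distrC.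
Qed.

Lemma is_derive_prod (V : normedModType R) (I : eqType) (s : seq I)
    (f : I -> V -> R) (df : I -> R) (x v : V) : uniq s ->
  (forall i, is_derive x v (f i : V -> R^o) (df i)) ->
  is_derive x v (fun y => \prod_(i <- s) f i y : R^o)
    (\sum_(i <- s) df i * \prod_(l <- s | l != i) f l x).
Proof.
move=> + Df; elim: s => [_|a s IH /= /andP[as_ us]].
  under eq_fun do rewrite big_nil; rewrite big_nil; exact: is_derive_cst.
under eq_fun do rewrite big_cons.
apply: (is_derive_eq (is_deriveM (Df a) (IH us))).
rewrite -![_ *: _]/(_ * _) big_cons addrC big_cons eqxx /=; congr (_ + _).
  rewrite mulrC; congr (_ * _); rewrite [RHS]big_seq_cond [LHS]big_seq.
  apply: eq_bigl => i; case: (boolP (i \in s)) => //= si; apply/esym.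
  by apply: contraNneq as_ => <-.
rewrite mulr_sumr; apply: eq_big_seq => i si.
rewrite big_cons ifT; last by apply: contraNneq as_ => ->.
by rewrite mulrCA.
Qed.

Lemma is_derive_covector (V : normedModType R) (m d : nat)
    (w : 'M[R]_(m, d) -> R) (A : V -> 'M[R]_(m, d)) (x v : V) dA : covector w ->
  is_derive x v A dA ->
  is_derive x v (fun y => w (A y) : R^o) (\sum_i w (upd (A x) i (row i dA))).
Proof.
move=> cw DA; have Dij i j := is_derive_coord i j DA.
have -> : (fun y => w (A y)) = \sum_(J : {ffun 'I_m -> 'I_d})
    (fun y => w (rowsub J 1%:M) * \prod_(i <- index_enum 'I_m) A y i (J i)).
  apply/funext => y; rewrite fct_sumE covector_expand//.
  by apply: eq_bigr => J _; rewrite mulrC.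
have -> : \sum_i w (upd (A x) i (row i dA)) = \sum_(J : {ffun 'I_m -> 'I_d})
    w (rowsub J 1%:M) * (\sum_(i <- index_enum 'I_m)
      dA i (J i) * \prod_(l <- index_enum 'I_m | l != i) A x l (J l)).
  under eq_bigr => i _ do rewrite covector_expand//.
  rewrite exchange_big; apply: eq_bigr => J _ /=.
  rewrite mulr_sumr; apply: eq_bigr => i _; rewrite mulrC; congr (_ * _).
  rewrite (bigD1 i)//= !mxE eqxx; congr (_ * _).
  by apply: eq_bigr => l /negbTE li; rewrite mxE li.
elim: (index_enum _) => [|J s IH].
  by rewrite !big_nil; exact: is_derive_cst.
rewrite !big_cons; refine (is_deriveD _ IH).
apply: is_deriveZ; apply: (@is_derive_prod _ _ _ (fun i y => A y i (J i))).
exact: index_enum_uniq.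
Qed.

(* [tau H] for the reflection [H] along [e + t y], with [e] dual to the [i]-th
   row of [tau], only changes that row, by a multiple of [e + t y]; and [t] is
   an arbitrary real number. *)
Lemma first_cousin (d n : nat) (w : 'M[R]_(n, d) -> R) (tau : 'M[R]_(n, d))
    (s : R) (y : 'rV[R]_d) : covector w -> row_free tau -> s != 0 ->
  (forall H : 'M[R]_d, H *m H^T = 1%:M -> s * w (tau *m H) <= s * w tau) ->
  tau *m y^T = 0 -> forall i, w (upd tau i y) = 0.
Proof.
move=> cw tau_free s0 Hmax tau_y i.
(* A vector with inner product 1 with row [i] of [tau] and 0 with the other rows, obtained from a
   right inverse of [tau]. *)
pose e := (col i (pinvmx tau))^T.
have tau_e : tau *m e^T = delta_mx i 0.
  by rewrite trmxK colE mulmxA mulmxVp// mul1mx.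
have step t : 0 <= s * (w (upd tau i e) + t * w (upd tau i y)).
  pose z := e + t *: y.
  have tau_z : tau *m z^T = delta_mx i 0.
    by rewrite linearD linearZ /= mulmxDr -scalemxAr tau_y scaler0 addr0.
  have z0 : z != 0.
    apply/eqP => z0; move: tau_z; rewrite z0 trmx0 mulmx0 => /matrixP/(_ i 0).
    by rewrite !mxE !eqxx => /eqP; rewrite eq_sym oner_eq0.
  pose q := dotp z z.
  have q0 : 0 < q.
    rewrite lt_neqAle dotp_ge0 andbT eq_sym; apply: contraNneq z0 => q0.
    rewrite -normr_le0; apply: dotp_norm_le => //; rewrite -/q q0.
    by rewrite expr0n.
  have zz : z *m z^T = q%:M := mulmx_tr_dotp z.
  pose H : 'M[R]_d := 1%:M - (2 / q) *: (z^T *m z).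
  have HT : H^T = H by rewrite /H linearB linearZ /= trmx1 trmx_mul trmxK.
  have HH : H *m H^T = 1%:M.
    rewrite HT /H mulmxBr mulmx1 mulmxBl mul1mx -scalemxAl -scalemxAr.
    rewrite mulmxA -(mulmxA z^T z z^T) zz mul_mx_scalar -scalemxAl.
    rewrite !scalerA.
    have -> : 2 / q * (2 / q * q) = 2 / q + 2 / q by field; rewrite gt_eqF.
    by rewrite scalerDl opprB addrK subrK.
  have tauH : tau *m H = upd tau i (row i tau - (2 / q) *: z).
    rewrite /H mulmxBr mulmx1 -scalemxAr mulmxA tau_z.
    apply/matrixP => a b; rewrite !mxE; case: eqVneq => [->|ai].
      by rewrite !big_ord1 !mxE !eqxx mul1r.
    by rewrite big_ord1 !mxE (negbTE ai) mul0r mulr0 subr0.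
  have := Hmax H HH; rewrite tauH -(scaleN1r (_ *: z)) -[row i tau]scale1r.
  rewrite covector_updP// upd_id mul1r covector_updZ// /z.
  rewrite -[e]scale1r covector_updP// mul1r => h.
  have q20 : 0 < 2 / q by rewrite divr_gt0.
  rewrite -(pmulr_rge0 _ q20) scale1r; lra.
apply/eqP/negP => /negP wy.
pose a := w (upd tau i e); pose b := w (upd tau i y).
(* An affine function of t bounded below has slope 0; this value of t would make it equal to -1. *)
have := step (- (a + s^-1) / b).
rewrite -/a -/b (_ : s * _ = -1); last by field; rewrite s0 wy.
by rewrite oppr_ge0 ler10.
Qed.

(** A linear relation among the rows, inserted as row [i], reduces by alternation to its [i]-th
    coefficient times [w tau]. *)
Lemma covector_row_free (d n : nat) (w : 'M[R]_(n, d) -> R) (tau : 'M[R]_(n, d)) :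
  covector w -> w tau != 0 -> row_free tau.
Proof.
move=> cw w0; apply: inj_row_free => u utau; apply/rowP => i; rewrite mxE.
have := covector_upd_sum cw tau i (fun l => u 0 l) (fun l => row l tau).
rewrite -mulmx_sum_row utau covector_upd0// (bigD1 i)//= big1 ?addr0 => [|l li].
  rewrite upd_id => /esym/eqP; rewrite mulf_eq0 (negbTE w0) orbF => /eqP.
  exact.
rewrite (cw.2 _ i l) ?mulr0// 1?eq_sym// row_upd row_upd_neq//.
Qed.

End Calculus.

Section Tangent.
Context {R : realType}.

Lemma mulmx_norm_le (m n p : nat) (A : 'M[R]_(m, n)) (M : 'M[R]_(n, p)) :
  `|A *m M| <= n%:R * `|M| * `|A|.
Proof.
apply: norm_le_coord => [|i j]; first by rewrite !mulr_ge0.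
rewrite mxE (le_trans (ler_norm_sum _ _ _))//.
have -> : n%:R * `|M| * `|A| = \sum_(l < n) `|A| * `|M|.
  by rewrite sumr_const card_ord -[RHS]mulr_natl mulrAC mulrA.
by apply: ler_sum => l _; rewrite normrM ler_pM// coord_le_norm.
Qed.

Lemma jacobian_taylor (k d : nat) (f : 'rV[R]_k -> 'rV[R]_d) (u0 : 'rV[R]_k) (e : R) :
  differentiable f u0 -> 0 < e -> exists2 delta, 0 < delta &
    forall u, `|u - u0| <= delta ->
      `|f u - f u0 - (u - u0) *m 'J f u0| <= e * `|u - u0|.
Proof.
move=> df e0; have /eqaddoP/(_ e e0) := diff_locally df.
move=> /nbhs_ballP[r /= r0 Hr]; exists (r / 2); first by rewrite divr_gt0.
move=> u ur; have := Hr (u - u0).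
rewrite -ball_normE /= sub0r normrN => H.
have {H} := H (le_lt_trans ur _).
rewrite /= !fctE /= subrK => H; rewrite -deriveEjacobian// deriveE// -addrA -opprD.
by apply: H; rewrite ltr_pdivrMr// ltr_pMr// ltr1n.
Qed.

Variables (d k : nat) (B : set 'rV[R]_d) (V : set 'rV[R]_k) (U : set 'rV[R]_d).
Variables (f : 'rV[R]_k -> 'rV[R]_d) (u0 : 'rV[R]_k).
Hypothesis k_gt0 : (0 < k)%N.
Hypothesis chart : local_param B V U f.
Hypothesis Vu0 : V u0.

Let J := 'J f u0.

Lemma chart_free : row_free J.
Proof. by case: chart => _ _ + _ _; apply. Qed.

(** [cokermx J] kills the row space of [J], so only the Taylor remainder survives. It is small
    relative to the parameter increment, which the injectivity of [J] bounds by the increment in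
    space. *)
Lemma tangent_defect e : 0 < e -> exists2 delta, 0 < delta &
  forall y, B y -> U y -> `|y - f u0| <= delta ->
    `|(y - f u0) *m cokermx J| <= e * `|y - f u0|.
Proof.
move=> e0; have Jfree := chart_free; have df := chart_differentiable k_gt0 chart Vu0.
pose K' : R := d%:R * `|cokermx J| + 1.
pose D : R := d%:R * `|pinvmx J| + 1.
have K0 : 0 < D by rewrite ltr_wpDl// mulr_ge0.
have K'0 : 0 < K' by rewrite ltr_wpDl// mulr_ge0.
(* The first bound gives D e1 <= 1/2, so that the remainder is absorbed in the estimate of [v]; the
   second gives 2 D K' e1 <= e for the conclusion. *)
pose e1 := Num.min (D^-1 / 2) (e / (2 * D * K')).
have e10 : 0 < e1 by rewrite lt_min !divr_gt0 ?invr_gt0// !mulr_gt0.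
have [r r0 Hr] := jacobian_taylor df e10.
have cd : `|u - u0| @[u --> u0] --> `|u0 - u0| by exact: continuous_dist.
have [delta d0 Hd] := chart_inverse_near chart Vu0 cd r0.
exists delta; first exact: d0.
move=> y By Uy yd; have : (f @` V) y by case: chart => _ _ _ -> _.
move=> [u Vu fu]; subst y.
have ur : `|u - u0| <= r.
  have := Hd u Vu yd; rewrite subrr normr0 subr0.
  by rewrite ger0_norm.
have {Hr} := Hr u ur; set x := f u - f u0; set v := u - u0; rewrite -/J => Hr.
have vx : `|v| <= 2 * D * `|x|.
  have Ev : v = v *m J *m pinvmx J by rewrite -mulmxA mulmxVp// mulmx1.
  have H1 : `|v| <= D * `|v *m J|.
    rewrite {1}Ev (le_trans (mulmx_norm_le _ _))// ler_wpM2r//.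
    by rewrite lerDl.
  have H2 : `|v *m J| <= `|x| + e1 * `|v|.
    rewrite -[v *m J](subKr x) (le_trans (ler_normB _ _))// lerD2l.
    exact: Hr.
  have H3 : D * (e1 * `|v|) <= `|v| / 2.
    rewrite mulrA mulrC ler_wpM2l//.
    have : D * e1 <= D * (D^-1 / 2).
      by apply: (ler_wpM2l (ltW K0)); rewrite /e1 ge_min lexx.
    by rewrite mulrA mulfV ?gt_eqF// mul1r.
  have : D * `|v *m J| <= D * (`|x| + e1 * `|v|) by rewrite ler_wpM2l// ltW.
  rewrite mulrDr; lra.
have -> : x *m cokermx J = (x - v *m J) *m cokermx J.
  by rewrite [RHS]mulmxBl -(mulmxA v) mulmx_coker mulmx0 subr0.
apply: (le_trans (mulmx_norm_le _ _)).
apply: (@le_trans _ _ (K' * (e1 * `|v|))).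
  apply: (@le_trans _ _ (K' * `|x - v *m J|)); first by rewrite ler_wpM2r// lerDl.
  by apply: (ler_wpM2l (ltW K'0)).
apply: (@le_trans _ _ (K' * (e1 * (2 * D * `|x|)))).
  by apply: (ler_wpM2l (ltW K'0)); exact: (ler_wpM2l (ltW e10)).
have -> : K' * (e1 * (2 * D * `|x|)) = e1 * (2 * D * K') * `|x| by ring.
rewrite ler_wpM2r// -ler_pdivlMr ?mulr_gt0//.
by rewrite /e1 ge_min lexx orbT.
Qed.

(** The curve is not lifted to the chart: [tangent_defect] is applied to its difference quotients,
    and in the limit the component of [c'] transverse to [J] is at most e times the norm of [c'] for
    every e. *)
Lemma chart_tangent (c : R -> 'rV[R]_d) c' : c 0 = f u0 ->
  is_derive (0 : R) 1 c c' -> (\forall t \near (0 : R), B (c t)) -> (c' <= J)%MS.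
Proof.
move=> c0 [Dc Ec] nB; rewrite submxE -normr_le0.
have lim : (fun t : R => t^-1 *: (c t - f u0)) @ 0^' --> c'.
  rewrite -Ec /derive c0 /=.
  have -> : (fun t : R => t^-1 *: (c t - f u0)) =
      (fun h : R => h^-1 *: (c (h *: 1 + 0) - f u0)).
    by apply/funext => h; rewrite [h *: 1]mulr1 addr0.
  by move: Dc; rewrite /derivable c0.
have cc : c t @[t --> (0 : R)] --> f u0.
  rewrite -c0; apply: differentiable_continuous.
  exact/derivable1_diffP.
have oU : open U by case: chart => -[].
have nU : \forall t \near (0 : R), U (c t).
  apply: (cc U); apply: open_nbhs_nbhs; split=> //.
  by have [] := chart_in chart Vu0.
suff H e : 0 < e -> `|c' *m cokermx J| <= e * `|c'|.
  apply/ler_addgt0Pr => e e0; rewrite add0r.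
  have c1 : 0 < `|c'| + 1 by rewrite ltr_wpDl.
  have := H (e / (`|c'| + 1)); rewrite divr_gt0// => /(_ isT)/le_trans; apply.
  by rewrite mulrAC ler_pdivrMr// ler_pM2l// lerDl.
move=> e0; have [delta d0 Hd] := tangent_defect e0.
have nd : \forall t \near (0 : R), `|c t - f u0| <= delta.
  by move/cvgrPdistC_le: cc; apply.
have L1 : (fun t : R => `|(t^-1 *: (c t - f u0)) *m cokermx J|) @ 0^' -->
    `|c' *m cokermx J|.
  apply: cvg_norm; apply: (cvg_comp _ (fun x => x *m cokermx J) lim).
  exact: mulmx_continuous.
have L2 : (fun t : R => e * `|t^-1 *: (c t - f u0)|) @ 0^' --> e * `|c'|.
  by apply: cvgMr; exact: cvg_norm.
apply: (ler_cvg_to L1 L2); apply: nbhs_dnbhs.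
apply: filterS3 nB nU nd => t Bt Ut dt.
rewrite -scalemxAl !normrZ mulrCA ler_wpM2l//.
exact: Hd.
Qed.

End Tangent.

(** * Position field and second derivatives of a chart *)

Section SphericalChart.
Context {R : realType}.
Variables (d k : nat) (M : set 'rV[R]_d) (V : set 'rV[R]_k) (U : set 'rV[R]_d).
Variables (f : 'rV[R]_k -> 'rV[R]_d).
Hypothesis k_gt0 : (0 < k)%N.
Hypothesis chart : local_param M V U f.

Let Jm (v : 'rV[R]_k) : 'M[R]_(k, d) :=
  \matrix_(l, j) 'D_(delta_mx 0 l) f v 0 j.
Let S (i l : 'I_k) (v : 'rV[R]_k) : 'rV[R]_d :=
  iter_derive [:: delta_mx 0 i; delta_mx 0 l] f v.

Lemma chart_jacobianE v : V v -> 'J f v = Jm v.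
Proof.
by move=> Vv; apply/row_matrixP => l; rewrite (chart_row k_gt0 chart)//; apply/rowP => j; rewrite !mxE.
Qed.

Lemma is_derive_chart v i : V v -> is_derive v (delta_mx 0 i) f (row i (Jm v)).
Proof.
move=> Vv; rewrite -chart_jacobianE// (chart_row k_gt0 chart)//.
by case: chart => _ /(_ [::] v Vv)[_ /(_ (delta_mx 0 i)) D] _ _ _; exact: derivableP.
Qed.

(** Half the derivative of [dotp (f v) (f v)], which is constant on [V]. *)
Lemma chart_normal v : M `<=` @unit_sphere R d -> V v -> 'J f v *m (f v)^T = 0.
Proof.
move=> M1 Vv; rewrite chart_jacobianE//; apply/colP => i; rewrite !mxE.
have D1 : is_derive v (delta_mx 0 i) (\sum_(j < d) (fun y => f y 0 j : R^o) * (fun y => f y 0 j))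
    (\sum_(j < d) (f v 0 j * Jm v i j + f v 0 j * Jm v i j)).
  apply: is_derive_sum => j; have D := is_derive_coord 0 j (is_derive_chart i Vv).
  by have := is_deriveM D D; rewrite mxE.
have D2 : is_derive v (delta_mx 0 i)
    (\sum_(j < d) (fun y => f y 0 j : R^o) * (fun y => f y 0 j)) 0.
  apply: (@near_eq_is_derive R _ R^o (cst (1 : R^o))).
  have nV : \forall y \near v, V y := open_nbhs_nbhs (conj (chart_open chart) Vv).
  apply: filterS nV => y Vy; rewrite fct_sumE /=.
  by have [/M1] := chart_in chart Vy.
have E : \sum_(j < d) (f v 0 j * Jm v i j + f v 0 j * Jm v i j) = 0.
  by rewrite -(@derive_val _ _ _ _ _ _ _ D1) (@derive_val _ _ _ _ _ _ _ D2).
have {E} : (\sum_j Jm v i j * (f v)^T j 0) *+ 2 = 0.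
  rewrite -[RHS]E mulr2n -big_split /=; apply: eq_bigr => j _.
  have -> : (f v)^T j 0 = f v 0 j by rewrite mxE.
  by rewrite [Jm v i j * _]mulrC.
by move=> /eqP; rewrite mulrn_eq0 => /orP[//|/eqP].
Qed.

Lemma is_derive2_chart v i l : V v ->
  is_derive v (delta_mx 0 i) (fun y => row l (Jm y)) (S i l v).
Proof.
move=> Vv.
have -> : (fun y => row l (Jm y)) = 'D_(delta_mx 0 l) f.
  by apply/funext => y; apply/rowP => j; rewrite !mxE.
case: chart => _ /(_ [:: delta_mx 0 l] v Vv)[_ /(_ (delta_mx 0 i)) D] _ _ _.
exact: derivableP.
Qed.

Lemma chart_schwarz v i l : V v -> S i l v = S l i v.
Proof.
move=> Vv; apply/rowP => j.
have cS a b : {for v, continuous (fun y => S a b y 0 j)}.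
  case: chart => _ /(_ [:: delta_mx 0 a; delta_mx 0 b] v Vv)[+ _] _ _ _.
  by move=> /mx_cvg_nbhsP/(_ 0 j).
apply: (@schwarz R _ V (fun y => f y 0 j) (fun y => Jm y l j) (fun y => Jm y i j)
  (fun y => S i l y 0 j) (fun y => S l i y 0 j) (delta_mx 0 l) (delta_mx 0 i) v
  (chart_open chart) Vv); last 2 first.
- exact: cS.
- exact: cS.
- move=> y Vy; have := is_derive_coord 0 j (is_derive_chart l Vy).
  by rewrite mxE.
- move=> y Vy; have := is_derive_coord 0 j (is_derive_chart i Vy).
  by rewrite mxE.
- move=> y Vy; have := is_derive_coord 0 j (is_derive2_chart i l Vy).
  by under eq_fun do rewrite mxE.
- move=> y Vy; have := is_derive_coord 0 j (is_derive2_chart l i Vy).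
  by under eq_fun do rewrite mxE.
Qed.

(* [d (i_x Omega) = k Omega] for the position vector field [x] and a constant
   [Omega]. *)
Lemma covector_position_eq0 (Omega : 'M[R]_(k, d) -> R) v0 : covector Omega -> V v0 ->
  (forall v i, V v -> Omega (upd ('J f v) i (f v)) = 0) -> Omega ('J f v0) = 0.
Proof.
move=> cO Vv0 H0; rewrite chart_jacobianE//.
pose T i l := Omega (upd (upd (Jm v0) i (f v0)) l (S i l v0)).
(* The hypothesis for row [i], differentiated in the direction [i]. The derivative of the position
   restores row [i] of the Jacobian, and the derivative of row [l] produces [T i l]. *)
have Hi i : Omega (Jm v0) + \sum_(l | l != i) T i l = 0.
  pose A y := upd (Jm y) i (f y).
  pose dA : 'M[R]_(k, d) :=
    \matrix_(l, j) (if l == i then Jm v0 i j else S i l v0 0 j).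
  have DA : is_derive v0 (delta_mx 0 i) A dA.
    apply: is_derive_mx => l j; rewrite mxE; under eq_fun do rewrite mxE.
    have [_|li] := eqVneq l i.
      by have := is_derive_coord 0 j (is_derive_chart i Vv0); rewrite mxE.
    have := is_derive_coord 0 j (is_derive2_chart i l Vv0).
    by under eq_fun do rewrite mxE.
  have := is_derive_covector cO DA => D1.
  have D2 : is_derive v0 (delta_mx 0 i) (fun y => Omega (A y) : R^o) 0.
    apply: (@near_eq_is_derive _ _ _ (cst 0)).
    have nV : \forall y \near v0, V y := open_nbhs_nbhs (conj (chart_open chart) Vv0).
    by apply: filterS nV => y Vy; rewrite /A -chart_jacobianE// H0.
  have E : \sum_l Omega (upd (A v0) l (row l dA)) = 0.
    by rewrite -(@derive_val _ _ _ _ _ _ _ D1) (@derive_val _ _ _ _ _ _ _ D2).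
  rewrite -[RHS]E [RHS](bigD1 i)//=; congr (_ + _).
    rewrite /A upd_upd; congr Omega; rewrite -[LHS](upd_id _ i); congr upd.
    by apply/rowP => j; rewrite !mxE eqxx.
  apply: eq_bigr => l li; rewrite /T /A; congr Omega; congr upd.
  by apply/rowP => j; rewrite !mxE (negbTE li).
(* Second derivatives are symmetric and [Omega] is alternating. Summing [Hi] over [i] thus cancels
   all [T] and leaves k [Omega (Jm v0)] = 0. *)
have T_anti i l : l != i -> T l i = - T i l.
  move=> li; rewrite /T (chart_schwarz l i Vv0).
  move: (S i l v0) (Jm v0) (f v0) => s J p.
  by rewrite (covector_swap cO _ _ _ li) (upd_updC _ _ _ li).
clearbody T.
have : \sum_i (Omega (Jm v0) + \sum_(l | l != i) T i l) = 0.
  by rewrite big1.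
rewrite big_split /= sumr_const card_ord.
set X := (X in _ + X = 0).
have -> : X = 0.
  have XX : X = - X.
    rewrite {1}/X (exchange_big_dep xpredT)//=.
    rewrite /X -sumrN; apply: eq_bigr => l _; rewrite -sumrN.
    by apply: eq_big => i; rewrite eq_sym// => li; rewrite T_anti// eq_sym.
  by clearbody X; lra.
rewrite addr0 => /eqP; rewrite mulrn_eq0 => /orP[/eqP k0|/eqP//].
by move: k_gt0; rewrite k0.
Qed.

End SphericalChart.

(** * Minimal products *)

Section ProductFactor.
Context {R : realType}.

Lemma mul_tr_submxrow (l : nat) (q : 'I_l -> nat) (i j : 'I_l) :
  i != j -> (submxrow 1%:M i)^T *m submxrow 1%:M j = 0 :> 'M[R]_(q i, q j).
Proof.
move=> ij; rewrite tr_submxrow trmx1 mul_submxrow mulmx1.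
apply/matrixP => a b; rewrite !mxE.
by rewrite -val_eqE /= tagnat.eq_Rank (negbTE ij).
Qed.

Lemma tr_submxrowK (l : nat) (q : 'I_l -> nat) (j : 'I_l) :
  (submxrow 1%:M j)^T *m submxrow 1%:M j = 1%:M :> 'M[R]_(q j).
Proof.
rewrite tr_submxrow trmx1 mul_submxrow mulmx1.
by apply/matrixP => a b; rewrite !mxE -val_eqE /= tagnat.eq_Rank eqxx.
Qed.

(* [E] embeds the factor isometrically as a block and [1 - E E^T] erases it. *)
Lemma minimal_product_factor (d : nat) (B : set 'rV[R]_d) :
  is_minimal_product B ->
  exists (d0 k0 : nat) (M : set 'rV[R]_d0) (lam : R) (E : 'M[R]_(d, d0)),
    [/\ (0 < k0)%N, closed_minimal_submanifold k0 M, 0 < lam < 1,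
        E^T *m E = 1%:M &
        (forall p, B p -> exists2 z, M z & p *m E = lam *: z) /\
        (forall p z, B p -> M z ->
           B (p *m (1%:M - E *m E^T) + lam *: (z *m E^T)))].
Proof.
move=> [l [nn [kk [M [e [l2 kk0 HM ->]]]]]]; subst d.
pose j0 : 'I_l := Ordinal (ltnW l2); pose j1 : 'I_l := Ordinal l2.
pose E : 'M[R]_(_, (nn j0).+1) := @submxrow _ _ (fun j => (nn j).+1) _ 1%:M j0.
pose K := (\sum_i kk i)%N; pose lam := Num.sqrt ((kk j0)%:R / K%:R) : R.
(* The second factor has positive dimension, which makes [lam] strictly smaller than 1. *)
have kK : (kk j0 < K)%N.
  rewrite /K (bigD1 j0)//= (bigD1 j1)//= -[ltnLHS]addn0 ltn_add2l.
  by rewrite (leq_trans (kk0 j1))// leq_addr.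
have K0 : (0 < K)%N by rewrite (leq_ltn_trans _ kK).
have lam0 : 0 < lam by rewrite sqrtr_gt0 divr_gt0// ltr0n.
have lam1 : lam < 1.
  rewrite -sqrtr1 ltr_sqrt// ltr_pdivrMr ?ltr0n// mul1r ltr_nat//.
exists (nn j0).+1, (kk j0), (M j0), lam, E; split=> //.
- by rewrite lam0.
- exact: tr_submxrowK.
have sub m (x : 'M[R]_(m, _)) j : submxrow x j = x *m submxrow (1%:M) j.
  by rewrite mul_submxrow mulmx1.
split=> [p [y [My ->]]|p z [y [My ->]] Mz].
  by exists (y j0) => //; rewrite castmx_id /E -sub mxrowK.
exists (eqtype.dfwith y z); split=> [j|]; first by case: eqtype.dfwithP.
rewrite !castmx_id; apply/mxrowP => j; rewrite mxrowK sub mulmxDl -scalemxAl -!mulmxA.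
rewrite mulmxBl mul1mx -mulmxA; case: eqtype.dfwithP => [|{}j j0j].
  by rewrite !(tr_submxrowK, mulmx1) subrr mulmx0 add0r.
by rewrite !(mul_tr_submxrow _ j0j, mulmx0) subr0 scaler0 addr0 -sub mxrowK.
Qed.

End ProductFactor.

Section Lines.
Context {R : realType}.

Lemma line_near (V : normedModType R) (D : set V) (u v : V) : open D -> D u ->
  \forall t \near (0 : R), D (t *: v + u).
Proof.
move=> oD Du.
have ct : (fun t : R => t *: v + u) @ (0 : R) --> 0 *: v + u.
  by apply: cvgD (cvg_cst _); apply: cvgZ (cvg_cst _); exact: cvg_id.
apply: (ct D); apply: open_nbhs_nbhs; split=> //.
by rewrite scale0r add0r.
Qed.

Lemma is_derive_mulmxr (V : normedModType R) (m n p : nat) (f : V -> 'M[R]_(m, n))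
    (X : 'M[R]_(n, p)) (x v : V) df :
  is_derive x v f df -> is_derive x v (fun y => f y *m X) (df *m X).
Proof.
move=> Df; apply: is_derive_mx => i j.
have -> : (df *m X) i j = \sum_l X l j * df i l.
  by rewrite mxE; apply: eq_bigr => l _; rewrite mulrC.
have -> : (fun y => (f y *m X) i j : R^o) =
    \sum_(l < n) (X l j \*: (fun y => f y i l : R^o)).
  by apply/funext => y; rewrite mxE fct_sumE; apply: eq_bigr => l _; rewrite /= mulrC.
apply: is_derive_sum => l; apply: is_deriveZ; exact: is_derive_coord.
Qed.

Lemma covector_pair (d n : nat) (w : 'M[R]_(n, d) -> R) A (i j : 'I_n)
    (a b c e : R) u v : covector w -> i != j ->
  w (upd (upd A i (a *: u + b *: v)) j (c *: u + e *: v)) =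
  (a * e - b * c) * w (upd (upd A i u) j v).
Proof.
move=> cw ij; have alt0 x : w (upd (upd A i x) j x) = 0.
  by apply: (covector_alt cw ij); rewrite row_upd row_upd_neq// row_upd.
rewrite covector_updP// !(upd_updC _ _ _ ij) !covector_updP//.
rewrite -!(upd_updC _ _ _ ij) !alt0 (covector_swap cw A v u ij).
ring.
Qed.

End Lines.

Section ProductTangent.
Context {R : realType}.
Variables (d d0 k k0 : nat) (B : set 'rV[R]_d) (M : set 'rV[R]_d0) (lam : R).
Variables (E : 'M[R]_(d, d0)).
Hypothesis k_gt0 : (0 < k)%N.
Hypothesis k0_gt0 : (0 < k0)%N.
Hypothesis lam_gt0 : 0 < lam.
Hypothesis factor_in : forall p, B p -> exists2 z, M z & p *m E = lam *: z.
Hypothesis factor_out : forall p z, B p -> M z ->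
  B (p *m (1%:M - E *m E^T) + lam *: (z *m E^T)).

Let Q := 1%:M - E *m E^T.

Variables (VB : set 'rV[R]_k) (UB : set 'rV[R]_d) (fB : 'rV[R]_k -> 'rV[R]_d).
Variables (uB : 'rV[R]_k).
Hypothesis chartB : local_param B VB UB fB.
Hypothesis VuB : VB uB.
Variables (V0 : set 'rV[R]_k0) (U0 : set 'rV[R]_d0) (f0 : 'rV[R]_k0 -> 'rV[R]_d0).
Hypothesis chart0 : local_param M V0 U0 f0.

Lemma is_derive_chart_line (d' k' : nat) (M' : set 'rV[R]_d') V' U' (f' : 'rV[R]_k' -> _) u i :
  (0 < k')%N -> local_param M' V' U' f' -> V' u ->
  is_derive (0 : R) 1 (fun t : R => f' (t *: delta_mx 0 i + u)) (row i ('J f' u)).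
Proof.
move=> k'0 chart' Vu; apply: (proj1 (is_derive_line f' u (delta_mx 0 i) _)); rewrite (chart_jacobianE k'0 chart')//.
exact: (is_derive_chart k'0 chart' _ Vu).
Qed.

(** Moving the factor component along the chart of [M], with the other components fixed, gives
    curves in [B] through [f u]. In [cofactor_tangent] the roles are exchanged. Both hold for any
    chart of [B] at the point. *)
Lemma factor_tangent v V U (f : 'rV[R]_k -> 'rV[R]_d) u : V0 v -> local_param B V U f -> V u ->
  f u = fB uB *m Q + lam *: (f0 v *m E^T) -> ('J f0 v *m E^T <= 'J f u)%MS.
Proof.
move=> V0v chart Vu fu; apply/row_subP => i; rewrite row_mul.
rewrite -(eqmx_scale _ (lt0r_neq0 lam_gt0)).
apply: (chart_tangent k_gt0 chart Vu
  (c := fun t => fB uB *m Q + lam *: (f0 (t *: delta_mx 0 i + v) *m E^T))).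
- by rewrite scale0r add0r fu.
- have D := is_derive_chart_line i k0_gt0 chart0 V0v.
  have := is_deriveD (is_derive_cst (fB uB *m Q) _ _)
    (is_deriveZ lam (is_derive_mulmxr E^T D)).
  by rewrite add0r; apply.
- apply: filterS (line_near (delta_mx 0 i) (chart_open chart0) V0v) => t V0t.
  apply: factor_out; first by have [] := chart_in chartB VuB.
  by have [] := chart_in chart0 V0t.
Qed.

Lemma cofactor_tangent v V U (f : 'rV[R]_k -> 'rV[R]_d) u : V0 v -> local_param B V U f -> V u ->
  f u = fB uB *m Q + lam *: (f0 v *m E^T) -> ('J fB uB *m Q <= 'J f u)%MS.
Proof.
move=> V0v chart Vu fu; apply/row_subP => i; rewrite row_mul.
apply: (chart_tangent k_gt0 chart Vu
  (c := fun t => fB (t *: delta_mx 0 i + uB) *m Q + lam *: (f0 v *m E^T))).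
- by rewrite scale0r add0r fu.
- have D := is_derive_chart_line i k_gt0 chartB VuB.
  have := is_deriveD (is_derive_mulmxr Q D) (is_derive_cst (lam *: (f0 v *m E^T)) _ _).
  by rewrite addr0; apply.
- apply: filterS (line_near (delta_mx 0 i) (chart_open chartB) VuB) => t VBt.
  apply: factor_out; first by have [] := chart_in chartB VBt.
  by have [] := chart_in chart0 V0v.
Qed.

(** A curve in [B], projected by [E] and divided by [lam], is a curve in [M]. *)
Lemma projection_tangent v : V0 v -> fB uB *m E = lam *: f0 v ->
  ('J fB uB *m E <= 'J f0 v)%MS.
Proof.
move=> V0v fE; apply/row_subP => i; rewrite row_mul.
have li0 : lam^-1 != 0 by rewrite invr_eq0 gt_eqF.
rewrite -(eqmx_scale _ li0).
apply: (chart_tangent k0_gt0 chart0 V0v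
  (c := fun t => lam^-1 *: (fB (t *: delta_mx 0 i + uB) *m E))).
- by rewrite scale0r add0r fE scalerA mulVf ?gt_eqF// scale1r.
- have D := is_derive_chart_line i k_gt0 chartB VuB.
  exact: (is_deriveZ lam^-1 (is_derive_mulmxr E D)).
- apply: filterS (line_near (delta_mx 0 i) (chart_open chartB) VuB) => t VBt.
  have [/factor_in[z Mz ->] _] := chart_in chartB VBt.
  by rewrite scalerA mulVf ?gt_eqF// scale1r.
Qed.

End ProductTangent.

(** * The contradiction on a minimal product *)

Section NoConstantCalibration.
Context {R : realType}.

Lemma row_base_exists (m d : nat) (A : 'M[R]_(m, d)) :
  exists (r : nat) (A' : 'M[R]_(r, d)), [/\ row_free A', (A' <= A)%MS & (A <= A')%MS].
Proof.
exists (\rank A), (row_base A); split; first exact: row_base_free.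
  by rewrite eq_row_base.
by rewrite eq_row_base.
Qed.

(** Passes from the frame of a chart to an adapted frame of the same tangent space: the change of
    basis is invertible by rank, and its determinant is the factor [c], the same for all [H]. *)
Lemma covector_frame (k d : nat) (w : 'M[R]_(1 + k, d) -> R) (p : 'rV[R]_d)
    (X J : 'M[R]_(k, d)) : covector w -> row_free X -> (X <= J)%MS ->
  exists2 c, c != 0 &
    forall H : 'M[R]_d, w (col_mx p X *m H) = c * w (col_mx p J *m H).
Proof.
move=> cw Xfree /submxP[D XD]; exists (\det D).
  rewrite -unitfE -unitmxE -row_free_unit /row_free eqn_leq rank_leq_row /=.
  by rewrite -{1}(eqP Xfree) XD mxrankM_maxl.
move=> H; rewrite -[\det D]mul1r -(det1 R 1) -(det_ublock _ 0) -covector_det//.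
by rewrite mulmxA mul_block_col mul1mx !mul0mx addr0 add0r -XD.
Qed.

(** Multiplication by [E] kills the rows of [A] and restores those of [J], so a relation splits into
    one for each block. *)
Lemma tangent_frame_free (d d0 k0 r : nat) (E : 'M[R]_(d, d0)) (J : 'M[R]_(k0, d0))
    (A : 'M[R]_(r, d)) : E^T *m E = 1%:M -> row_free J -> row_free A ->
  A *m E = 0 -> row_free (col_mx (J *m E^T) A).
Proof.
move=> EE Jf Af AE; apply: inj_row_free => u.
rewrite -[u]hsubmxK mul_row_col => u0.
have l0 : lsubmx u = 0.
  apply: (row_free_inj Jf); rewrite mul0mx.
  have := congr1 (mulmx^~ E) u0; rewrite mulmxDl -!mulmxA EE AE !mulmx1 mulmx0.
  by rewrite addr0 mul0mx.
move: u0; rewrite l0 mul0mx add0r => u0.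
have r0 : rsubmx u = 0 by apply: (row_free_inj Af); rewrite mul0mx.
by rewrite r0 row_mx0.
Qed.

Lemma no_constant_calibration (d k : nat) (B : set 'rV[R]_d) (p0 : 'rV[R]_d)
    (w : 'M[R]_(1 + k, d) -> R) : (0 < k)%N ->
  B `<=` @unit_sphere R d -> embedded_submanifold k B -> is_minimal_product B ->
  B p0 -> covector w ->
  (forall V U (f : 'rV[R]_k -> 'rV[R]_d) u, local_param B V U f -> V u ->
     exists2 s, s != 0 & w (col_mx (f u) ('J f u)) != 0 /\
       forall H : 'M[R]_d, H *m H^T = 1%:M ->
         s * w (col_mx (f u) ('J f u) *m H) <= s * w (col_mx (f u) ('J f u))) ->
  False.
Proof.
move=> k_gt0 B1 embB /minimal_product_factor[d0 [k0 [M [lam [E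
  [k0_gt0 [M1 _ embM _] /andP[lam0 lam1] EE [fin fout]]]]]]] Bp0 cw Hcal.
have [z0 Mz0 p0E] := fin p0 Bp0.
have [VB [UB [fB [chartB UBp0]]]] := embB p0 Bp0.
have [V0 [U0 [f0 [chart0 U0z0]]]] := embM z0 Mz0.
have [uB VuB fuB] : exists2 u, VB u & fB u = p0.
  have : (B `&` UB) p0 by [].
  by case: chartB => _ _ _ <- _ [u Vu <-]; exists u.
have [v0 Vv0 fv0] : exists2 v, V0 v & f0 v = z0.
  have : (M `&` U0) z0 by [].
  by case: chart0 => _ _ _ <- _ [u Vu <-]; exists u.
pose Q : 'M[R]_d := 1%:M - E *m E^T.
have QE : Q *m E = 0 by rewrite mulmxBl mul1mx -mulmxA EE mulmx1 subrr.
have EtQ : E^T *m Q = 0 by rewrite mulmxBr mulmx1 mulmxA EE mul1mx subrr.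
have QT : Q^T = Q by rewrite linearB /= trmx1 trmx_mul trmxK.
have QQ : Q *m Q = Q by rewrite {2}/Q mulmxBr mulmx1 mulmxA QE mul0mx subr0.
(* [A] is a basis of the tangent directions of the remaining factors at [p0]. These directions stay
   tangent at every [p v], where only the component in [M] has moved, so one fixed [A] serves for
   all [v]. *)
have [r [A [Afree AJ JA]]] := row_base_exists ('J fB uB *m Q).
have AE : A *m E = 0.
  by have /submxP[D ->] := AJ; rewrite -!mulmxA QE !mulmx0.
pose q := p0 *m Q.
pose p v := q + lam *: (f0 v *m E^T).
pose tau v := col_mx ('J f0 v *m E^T) A.
have pE : p v0 = p0.
  by rewrite /p /q fv0 scalemxAl -p0E mulmxBr mulmx1 mulmxA subrK.
have tau_free v : V0 v -> row_free (tau v).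
  move=> Vv; apply: tangent_frame_free => //.
  by case: chart0 => _ _ + _ _; apply.
have tau_sub v V U (f : 'rV[R]_k -> 'rV[R]_d) u : V0 v -> local_param B V U f ->
    V u -> f u = p v -> (tau v <= 'J f u)%MS.
  rewrite /p /q -fuB => Vv chart Vu fu; rewrite col_mx_sub.
  rewrite (factor_tangent k_gt0 k0_gt0 lam0 fout chartB VuB chart0 Vv chart Vu fu).
  apply: submx_trans AJ _.
  exact: (cofactor_tangent k_gt0 fout chartB VuB chart0 Vv chart Vu fu).
have JE : ('J fB uB *m E <= 'J f0 v0)%MS.
  apply: (projection_tangent k_gt0 k0_gt0 lam0 fin chartB VuB chart0 Vv0).
  by rewrite fuB fv0.
(* The adapted frame spans the whole tangent space at [p0]: a tangent vector splits by [Q] and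
   [E *m E^T] into a part in [A] and a part tangent to [M]. Comparing ranks gives the equality. *)
have hk : (k0 + r)%N = k.
  have Jfree : row_free ('J fB uB) by case: chartB => _ _ + _ _; apply.
  rewrite -(eqP (tau_free v0 Vv0)) -(eqP Jfree); apply: eqmx_rank.
  apply/andP; split.
    by apply: (tau_sub v0 VB UB fB uB); rewrite ?pE.
  rewrite -['J fB uB]mulmx1 -(subrK (E *m E^T) 1%:M) mulmxDr addmx_sub//.
    by apply: submx_trans JA _; rewrite /tau -addsmxE addsmxSr.
  by rewrite mulmxA (submx_trans (submxMr _ JE))// /tau -addsmxE addsmxSl.
subst k.
(* [y v] is normal to the cone at [p v]: both its components are multiples of
   those of [p v], and the scalings make it orthogonal to [p v]. *)
pose F v := f0 v *m E^T; pose c := (1 - lam ^+ 2)^-1.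
pose y v := (- c) *: q + lam^-1 *: F v.
pose sigma v := col_mx (p v) (tau v).
have lam2 : 1 - lam ^+ 2 != 0.
  by rewrite gt_eqF// subr_gt0 expr_lt1// ltW.
have f0f0 v : V0 v -> f0 v *m (f0 v)^T = 1%:M.
  by move=> Vv; rewrite mulmx_tr_dotp M1//; have [] := chart_in chart0 Vv.
have Qp0 : Q *m p0^T = q^T by rewrite trmx_mul QT.
have p0Qp0 m (X : 'M[R]_(m, d)) :
    X *m Q *m p0^T = X *m p0^T - lam *: (X *m E *m (f0 v0)^T).
  rewrite scalemxAr fv0.
  have -> : lam *: z0^T = E^T *m p0^T by rewrite -trmx_mul p0E linearZ.
  by rewrite mulmxBr mulmx1 mulmxBl !mulmxA.
have qq : q *m q^T = (1 - lam ^+ 2)%:M.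
  rewrite -Qp0 mulmxA -(mulmxA p0) QQ p0Qp0 p0E -fv0 -scalemxAl f0f0// scalerA.
  by rewrite mulmx_tr_dotp B1// scalemx1 -raddfB expr2.
have Aq : A *m q^T = 0.
  have /submxP[D ->] := AJ; rewrite -Qp0 mulmxA -!(mulmxA D) -(mulmxA _ Q Q) QQ.
  rewrite p0Qp0 -{1}fuB (chart_normal k_gt0 chartB B1 VuB) sub0r.
  have /submxP[D' ->] := JE.
  by rewrite -mulmxA (chart_normal k0_gt0 chart0 M1 Vv0) mulmx0 scaler0 oppr0 mulmx0.
have orth v : V0 v -> sigma v *m (y v)^T = 0.
  move=> Vv; have FT : (F v)^T = E *m (f0 v)^T by rewrite trmx_mul trmxK.
  have FF : F v *m (F v)^T = 1%:M.
    by rewrite FT /F -mulmxA (mulmxA E^T) EE mul1mx f0f0.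
  have qF : q *m (F v)^T = 0 by rewrite FT mulmxA -(mulmxA p0) QE mulmx0 mul0mx.
  have Fq m (X : 'M[R]_(m, d0)) : X *m E^T *m q^T = 0.
    by rewrite -Qp0 -!mulmxA (mulmxA E^T) EtQ mul0mx mulmx0.
  have -> : (y v)^T = (- c) *: q^T + lam^-1 *: (F v)^T.
    by rewrite linearD !linearZ.
  rewrite mulmxDr -!scalemxAr !mul_col_mx Aq Fq.
  have -> : p v *m q^T = (1 - lam ^+ 2)%:M.
    by rewrite mulmxDl -scalemxAl Fq scaler0 addr0.
  have -> : p v *m (F v)^T = lam%:M.
    by rewrite mulmxDl qF add0r -scalemxAl FF scalemx1.
  have -> : 'J f0 v *m E^T *m (F v)^T = 0.
    by rewrite FT -mulmxA (mulmxA E^T) EE mul1mx (chart_normal k0_gt0 chart0 M1 Vv).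
  have -> : A *m (F v)^T = 0 by rewrite FT mulmxA AE mul0mx.
  rewrite col_mx0 !scale_col_mx !scaler0 add_col_mx addr0 !scale_scalar_mx.
  rewrite -raddfD /c mulNr mulVf// mulVf ?gt_eqF// addNr raddf0; exact: col_mx0.
have cousin v : V0 v -> w (sigma v) != 0 /\ forall i, w (upd (sigma v) i (y v)) = 0.
  move=> Vv; have Bpv : B (p v).
    by apply: fout => //; have [] := chart_in chart0 Vv.
  have [V [U [f [chart UV]]]] := embB _ Bpv.
  have [u Vu fu] : exists2 u, V u & f u = p v.
    have : (B `&` U) (p v) by [].
    by case: chart => _ _ _ <- _ [u Vu <-]; exists u.
  have [s s0 [wJ Hs]] := Hcal V U f u chart Vu.
  have [e e0 He] := covector_frame (p v) cw (tau_free v Vv) (tau_sub v V U f u Vv chart Vu fu).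
  have He1 : w (sigma v) = e * w (col_mx (p v) ('J f u)).
    by have := He 1%:M; rewrite !mulmx1.
  (* Replacing the chart frame by [sigma v] multiplies [w] by [e], so the orientation factor [s]
     becomes s / e below. *)
  have ws : w (sigma v) != 0 by rewrite He1 mulf_neq0// -fu.
  split=> // i; apply: (@first_cousin R _ _ w (sigma v) (s / e)) => //.
  - exact: covector_row_free cw ws.
  - by rewrite mulf_neq0// invr_eq0.
  - move=> H HH; rewrite He He1 !mulrA !divfK// -fu; exact: Hs.
  - exact: orth.
pose i0 : 'I_(1 + (k0 + r)) := lshift (k0 + r) ord0.
have upd0 v x : upd (sigma v) i0 x = col_mx x (tau v).
  rewrite upd_col_mxu; congr col_mx; apply/rowP => j.
  by rewrite mxE.
have sigmaE v : sigma v = upd (sigma v) i0 (1 *: q + lam *: F v).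
  by rewrite upd0 scale1r.
pose Omega (X : 'M[R]_(k0, d0)) := w (col_mx q (col_mx (X *m E^T) A)).
have cOmega : covector Omega.
  exact: (covector_mulr E^T (covector_colu A (covector_col q cw))).
have Omega0 v i : V0 v -> Omega (upd ('J f0 v) i (f0 v)) = 0.
  move=> Vv; pose i1 : 'I_(1 + (k0 + r)) := rshift 1 (lshift r i).
  (* Rows [i0] and [i1] will hold [p v] and [y v], combinations of [q] and [F v] with determinant
     lam^-1 + lam c > 0. The vanishing therefore holds with [q] and [F v] in these rows. *)
  have i01 : i0 != i1 by rewrite /i0 /i1 eq_lrshift.
  have [_ /(_ i1)] := cousin v Vv.
  rewrite sigmaE /y covector_pair// => /eqP; rewrite mulf_eq0 => /orP[|].
    have l0 : lam^-1 > 0 by rewrite invr_gt0.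
    have c0 : 0 < c by rewrite invr_gt0 subr_gt0 expr_lt1// ltW.
    by rewrite gt_eqF// mul1r mulrN opprK addr_gt0// mulr_gt0.
  by rewrite upd0 upd_col_mx upd_col_mxu -upd_mul => /eqP.
have wq : w (upd (sigma v0) i0 q) = 0.
  by rewrite upd0; exact: (covector_position_eq0 k0_gt0 chart0 cOmega Vv0 Omega0).
(* Now the position row: [y v0] is a combination of [q] and [F v0] with a nonzero coefficient of
   [F v0]. As [q] gives 0 there, so does [F v0], and hence also [p v0]. *)
have [ws /(_ i0)] := cousin v0 Vv0.
rewrite /y covector_updP// wq mulr0 add0r => /eqP.
rewrite mulf_eq0 invr_eq0 gt_eqF//= => /eqP wF.
move: ws; rewrite sigmaE covector_updP// wq wF !mulr0 addr0.
by rewrite eqxx.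
Qed.

End NoConstantCalibration.

(** * Blow-ups of Lawlor cones and the conclusion *)

Section RegularCones.
Context {R : realType}.

(** The covector A -> det(A [pinvmx tau]) equals 1 at [tau]; by [covector_minors] some minor of
    [tau] is nonzero. *)
Lemma row_free_minor (m d : nat) (tau : 'M[R]_(m, d)) :
  row_free tau -> exists J, minor J tau != 0.
Proof.
move=> tau_free; apply: contrapT => no.
have minor0 J : minor J tau = 0.
  by apply/eqP/negPn/negP => J0; apply: no; exists J.
pose w (A : 'M[R]_(m, d)) := minor [ffun i => i] (A *m pinvmx tau).
have cw : covector w.
  exact: (covector_mulr (pinvmx tau) (@minor_covector R m m [ffun i => i])).
have w1 : w tau = 1.
  rewrite /w mulmxVp// /minor -[RHS](det1 R m); congr (\det _).
  by apply/matrixP => a b; rewrite !mxE ffunE.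
have := covector_minors cw tau; rewrite big1 => [|J _]; last by rewrite minor0 mulr0.
by move=> /eqP; rewrite w1 mulr1 pnatr_eq0 -leqn0 leqNgt fact_gt0.
Qed.

(** For k = 0 all shape operators are empty matrices, and over an empty [B] there is nothing to
    check; in both cases [B] would count as totally geodesic. *)
Lemma not_totally_geodesic_gt0 (d k : nat) (B : set 'rV[R]_d) :
  ~ totally_geodesic k B -> (0 < k)%N /\ exists p, B p.
Proof.
move=> nB; split.
  by case: k nB => // nB; exfalso; apply: nB => p v S _ _ _; rewrite [S]flatmx0.
by apply: contrapT => nex; apply: nB => p v S Bp; exfalso; apply: nex; exists p.
Qed.

(** The position row is a unit vector orthogonal to the tangent rows, so its coefficient in a
    relation vanishes; the tangent rows are free by themselves. *)
Lemma tangent_frame_row_free (d k : nat) (B : set 'rV[R]_d) V U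
    (f : 'rV[R]_k -> 'rV[R]_d) u :
  (0 < k)%N -> local_param B V U f -> B `<=` @unit_sphere R d -> V u ->
  row_free (col_mx (f u) ('J f u)).
Proof.
move=> k0 chart B1 Vu; apply: inj_row_free => x.
rewrite -[x](@hsubmxK _ 1 1 k) mul_row_col => x0.
have Jp := chart_normal k0 chart B1 Vu.
have l0 : lsubmx x = 0.
  have := congr1 (mulmx^~ (f u)^T) x0; rewrite mulmxDl -!mulmxA Jp mulmx0 addr0 mul0mx.
  have [/B1 pp _] := chart_in chart Vu.
  by rewrite mulmx_tr_dotp pp mulmx1.
move: x0; rewrite l0 mul0mx add0r => x0.
have r0 : rsubmx x = 0.
  apply: (row_free_inj (chart_free chart Vu)); rewrite mul0mx.
  exact: x0.
by rewrite r0 row_mx0.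
Qed.

Lemma lawlor_chart_blowup (d k : nat) (B : set 'rV[R]_d) (L : functional R d k)
    V U (f : 'rV[R]_k -> 'rV[R]_d) u :
  oriented_lawlor_cone B L -> local_param B V U f -> V u ->
  exists2 s, s != 0 &
    blowup (cone_current L) (fun w => s * w (col_mx (f u) ('J f u))).
Proof.
move=> [[B1 cB _ _] /not_totally_geodesic_gt0[k0 _] _ [omega [orient int]]] chart Vu.
exists (Num.sg (omega (f u) ('J f u))).
  by rewrite sgr_eq0; apply/eqP; case: orient => _ _ H; exact: H chart Vu.
exact: (regular_cone_blowup k0 chart Vu B1 cB orient int).
Qed.

Lemma lawlor_blowup (d k : nat) (B : set 'rV[R]_d) (L : functional R d k) :
  oriented_lawlor_cone B L ->
  exists Y J, blowup (cone_current L) Y /\ Y (minor J) != 0.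
Proof.
move=> law; have [[B1 _ embB _] /not_totally_geodesic_gt0[k0 [p Bp]] _ _] := law.
have [V [U [f [chart Up]]]] := embB p Bp.
have [u Vu fu] : exists2 u, V u & f u = p.
  have : (B `&` U) p by [].
  by case: chart => _ _ _ <- _ [u Vu <-]; exists u.
have [s s0 bY] := lawlor_chart_blowup law chart Vu.
have [J J0] := row_free_minor (tangent_frame_row_free k0 chart B1 Vu).
by exists (fun w => s * w (col_mx (f u) ('J f u))), J; split; rewrite ?mulf_neq0.
Qed.

End RegularCones.

Theorem corollary4p4 (R : realType) (n : nat) (N m : nat -> nat)
    (L : forall i : nat, functional R (N i).+1 (m i))
    (B : forall i : nat, set 'rV[R]_(N i).+1) :
  (1 <= n)%N ->
  normal_current (L 0%N) ->
  supported_in (L 0%N) (@unit_sphere R (N 0%N).+1) ->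
  without_boundary (L 0%N) ->
  nonzero_current (cone_current (L 0%N)) ->
  cone_mass_minimizing (cone_current (L 0%N)) ->
  (forall i : nat, (1 <= i <= n)%N -> oriented_lawlor_cone (B i) (L i)) ->
  is_minimal_product (B 1%N) ->
  ~ exists phi : diff_form R (sum_upto (fun i => (N i).+1) n)
                             (sum_upto (fun i => (m i).+1) n),
      continuous_calibration phi /\
      calibrates phi (iter_product (fun i => cone_current (L i)) n).
Proof.
move=> n1 [cL0 _ _] _ _ C0 [mu [xi [pol _]]] law prodB [phi [cal calC]].
have [X0 [J0 [bX X0J]]] := cone_blowup cL0 pol C0.
(* [E] evaluates [C_0] with its fixed weight and each [C_i] with i >= 2 at one regular point; the
   point of [C_1] is left free, to vary over all charts. *)
have [i /andP[i2 iN]|E HE] := factor_contraction_exists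
  (C := fun i => cone_current (L i)) n1 bX X0J.
  by apply: (@lawlor_blowup _ _ _ (B i)); apply: law; rewrite iN (ltnW i2).
have law1 : oriented_lawlor_cone (B 1%N) (L 1%N) by apply: law.
have [[B1 _ embB _] /not_totally_geodesic_gt0[k0 [p Bp]] _ _] := law1.
have cw : covector (E (phi 0)).
  by case: HE => H _ _ _ _; apply: H; case: cal.
apply: (no_constant_calibration (w := E (phi 0)) k0 B1 embB prodB Bp cw) => V U f u chart Vu.
have [s s0 bY] := lawlor_chart_blowup law1 chart Vu; exists s => //.
apply: (factor_contraction_calibrated HE cal calC bY s0).
exact: row_free_minor (tangent_frame_row_free k0 chart B1 Vu).
Qed.
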